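(* Let $g\in L^2(\mathbb R)$ with $\|g\|_{L^2(\mathbb R)}=1$, and for $h>0$ let $\mathcal H_h$, $k_z^h$ and $T_h(\sigma)$ be as defined in the context. Let $\sigma\in L^1(\mathbb R^2)\cap L^2(\mathbb R^2)$ with $\sigma\ge0$. Let $\psi:[0,\infty)\to\mathbb R$ be continuous and suppose that $\lim_{t\to\infty}\psi(t)/t$ exists and is finite. Then $$\lim_{h\to0}h\,\operatorname{Tr}\bigl(T_h(\sigma)\psi(T_h(\sigma))\bigr)=\int_{\mathbb R^2}\sigma(z)\psi(\sigma(z))\,dz.$$
   Context: For $h>0$ put $D_hf(t)=h^{-1/4}f(t/\sqrt h)$, $g_h=D_hg$, and $\pi_h(x,\xi)f(t)=e^{2\pi i\xi t/h}f(t-x)$ for $(x,\xi)\in\mathbb R^2$. The short-time Fourier transform is $V_{g_h}f(x,\xi)=\langle f,\pi_h(x,\xi)g_h\rangle_{L^2(\mathbb R)}$, $f\in L^2(\mathbb R)$. $\mathcal H_h$ denotes the range of $V_{g_h}$, equipped with the inner product for which $V_{g_h}:L^2(\mathbb R)\to\mathcal H_h$ is unitary. The normalized reproducing kernels are $k_z^h(w)=\langle\pi_h(z)g_h,\pi_h(w)g_h\rangle_{L^2(\mathbb R)}$, $z,w\in\mathbb R^2$. With $d\nu_h(z)=h^{-1}\,dz$ (where $dz$ is Lebesgue measure on $\mathbb R^2$), the operator $T_h(\sigma)$ on $\mathcal H_h$ is defined weakly by $$T_h(\sigma)f=\int_{\mathbb R^2}\sigma(z)\langle f,k_z^h\rangle_{\mathcal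 H_h}k_z^h\,d\nu_h(z),$$ and $\psi(T_h(\sigma))$ is defined by functional calculus of the positive operator $T_h(\sigma)$. The limit is over $h>0$, $h\to0$. *)

(* Defs.v *)
From HB Require Import structures.
From mathcomp Require Import all_boot all_order all_algebra.
From mathcomp Require Import all_classical all_reals all_analysis.
From mathcomp Require Export complex.

Set Implicit Arguments.
Unset Strict Implicit.
Unset Printing Implicit Defensive.

Import Order.TTheory GRing.Theory Num.Theory.
Import numFieldNormedType.Exports.

Local Open Scope classical_set_scope.
Local Open Scope ring_scope.
Local Open Scope complex_scope.

(* A complex Hilbert space is presented by a set of vectors inside an ambient *)
(* complex vector space, with an inner product that is linear in its first    *)
(* argument. Values of ip, and of operators, outside the set are irrelevant.  *)
Record ipspace (R : realType) (V : lmodType R[i]) := IPSpace {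
  vecs : set V ;
  ip : V -> V -> R[i] }.

Section Operators.
Context {R : realType} {V : lmodType R[i]} (H : ipspace V).
Implicit Types (A B S : V -> V) (u v : V) (e : nat -> V).

Definition hnorm u : R := Num.sqrt (complex.Re (ip H u u)).

Definition is_bounded_op A : Prop :=
  [/\ forall u, vecs H u -> vecs H (A u),
      forall (c : R[i]) u v, vecs H u -> vecs H v ->
        A (c *: u + v) = c *: A u + A v
    & exists M : R, forall u, vecs H u -> hnorm (A u) <= M * hnorm u].

(* In R[i], 0 <= z means that z is real and nonnegative. *)
Definition is_positive_op A : Prop :=
  [/\ is_bounded_op A,
      forall u v, vecs H u -> vecs H v -> ip H (A u) v = ip H u (A v)
    & forall u, vecs H u -> 0 <= ip H (A u) u].

Definition opnorm A : R :=
  sup [set hnorm (A u) | u in [set u | vecs H u /\ hnorm u <= 1]].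

Definition poly_op (p : {poly R}) A u : V :=
  \sum_(k < size p) (p`_k)%:C *: iter k A u.

(* Continuous functional calculus of a positive bounded operator A, whose     *)
(* spectrum lies in [0, ||A||]: psi(A) is the operator-norm limit of p(A) for *)
(* real polynomials p tending to psi uniformly on [0, ||A||].                 *)
Definition fcalc (psi : R -> R) A : V -> V :=
  xget (@id V : V -> V) [set S : V -> V |
    (forall u, vecs H u -> vecs H (S u)) /\
    forall eps : R, 0 < eps -> exists p : {poly R},
      (forall t, 0 <= t <= opnorm A -> `|p.[t] - psi t| <= eps) /\
      (forall u, vecs H u ->
         hnorm (poly_op p A u - S u) <= eps * hnorm u)].

(* Orthonormal basis of a separable space. Some e n may be 0, so that bases   *)
(* with finitely many elements are sequences too; these zero vectors do not   *)
(* contribute to traces.                                                      *)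
Definition is_onb e : Prop :=
  [/\ forall n, vecs H (e n),
      forall n, ip H (e n) (e n) = 1 \/ e n = 0,
      forall m n, m != n -> ip H (e m) (e n) = 0
    & forall u, vecs H u -> (forall n, ip H u (e n) = 0) -> u = 0].

(* B = |A|, that is, B is positive and B^2 = A^* A *)
Definition is_abs_op A B : Prop :=
  is_positive_op B /\
  forall u v, vecs H u -> vecs H v -> ip H (B u) (B v) = ip H (A u) (A v).

Definition trace_class A : Prop :=
  is_bounded_op A /\
  exists B, is_abs_op A B /\
    forall e, is_onb e -> cvgn (series (fun n => complex.Re (ip H (B (e n)) (e n)))).

(* The series of a trace class operator has the same sum in all bases. *)
Definition trace A : R[i] :=
  xget 0 [set s : R[i] | forall e, is_onb e ->
    (series (fun n => ip H (A (e n)) (e n)) : nat -> R[i]^o) @ \oo --> (s : R[i]^o)].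

End Operators.

Section Toeplitz.
Context {R : realType}.
Implicit Types (f g : R -> R[i]) (z w : R * R) (sigma : R * R -> R) (h : R).

Notation mu := (@lebesgue_measure R).

Definition plane_measure := (mu \x mu)%E.

Definition cintegral {d} {T : measurableType d}
    (m : {measure set T -> \bar R}) (F : T -> R[i]) : R[i] :=
  (\int[m]_x complex.Re (F x)) +i* (\int[m]_x complex.Im (F x)).

(* L^2(R) as functions; functions equal almost everywhere are not identified, *)
(* so that here, unlike in rkhs below, the inner product is only definite up  *)
(* to a.e. equality.                                                          *)
Definition L2 : ipspace (R -> R[i]) := IPSpace
  [set f : R -> R[i] |
     ((fun t => complex.Re (f t)) : R -> R) \in Lfun mu 2%:E /\
     ((fun t => complex.Im (f t)) : R -> R) \in Lfun mu 2%:E]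
  (fun f g => cintegral mu (fun t => f t * conjc (g t))).

Definition dil h f : R -> R[i] :=
  fun t => (h `^ (- 4^-1))%:C * f (t / Num.sqrt h).

Definition tfshift h z f : R -> R[i] :=
  fun t => let a := 2 * pi * z.2 * t / h in (cos a +i* sin a) * f (t - z.1).

Definition stft h g f : R * R -> R[i] :=
  fun z => ip L2 f (tfshift h z (dil h g)).

(* A preimage under the transform; it is unique up to a.e. equality. *)
Definition stft_preim h g (F : R * R -> R[i]) : R -> R[i] :=
  xget 0 [set f | vecs L2 f /\ stft h g f = F].

Definition rkhs h g : ipspace (R * R -> R[i]) := IPSpace
  [set stft h g f | f in vecs L2]
  (fun F G => ip L2 (stft_preim h g F) (stft_preim h g G)).

Definition rkernel h g z : R * R -> R[i] :=
  fun w => ip L2 (tfshift h z (dil h g)) (tfshift h w (dil h g)).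

Definition toeplitz h g sigma (F : R * R -> R[i]) : R * R -> R[i] :=
  xget 0 [set G | vecs (rkhs h g) G /\
    forall U, vecs (rkhs h g) U ->
      ip (rkhs h g) G U =
      (h^-1)%:C * cintegral plane_measure (fun z =>
        (sigma z)%:C * ip (rkhs h g) F (rkernel h g z)
                     * ip (rkhs h g) (rkernel h g z) U)].

End Toeplitz.

(* Main.v *)
(** Let e_n be an orthonormal eigenbasis of T = T_h(sigma), with eigenvalues l_n,
and a_n = |e_n|^2. The reproducing property gives sum_n a_n = 1, Moyal's identity
gives int a_n = h, and the definition of T gives int sigma a_n = h l_n. Hence, for
phi(t) = t psi(t), both quantities to compare have the same shape:
h Tr(T psi(T)) = sum_n int phi(l_n) a_n and int phi(sigma) = sum_n int phi(sigma) a_n.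
Expanding the square, sum_n int (l_n - sigma)^2 a_n = int sigma^2 - int sigma B(sigma),
where B(sigma)(w) = <T k_w, k_w> is the convolution of sigma with the dilation by
sqrt h of a fixed probability density; so this tends to 0 with h. Since psi(t)/t has a
limit, |phi(x) - phi(t) - psi(0) (x - t)| <= eps (x + t + x^2 + t^2) + D (x - t)^2
for x, t >= 0, and the linear term integrates to 0 against each a_n.

The eigenbasis comes from the spectral theorem, T being positive and
Hilbert-Schmidt. Moyal's identity is Plancherel's identity for the functions
t |-> f(t) conj(g(t - x)); the latter is obtained by inserting the factor
exp(- eps |xi|), whose Fourier transform is the Poisson kernel. *)

Require Import Defs.
From HB Require Import structures.
From mathcomp Require Import all_boot all_order all_algebra.
From mathcomp Require Import all_classical all_reals all_analysis.
From mathcomp Require Import complex.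
From mathcomp Require Import measurable_realfun.
From mathcomp Require Import ring lra.

Import Order.TTheory GRing.Theory Num.Theory.
Import numFieldNormedType.Exports.

Local Open Scope classical_set_scope.
Local Open Scope ring_scope.
Local Open Scope complex_scope.

Set Implicit Arguments.
Unset Strict Implicit.
Unset Printing Implicit Defensive.

(** * Hilbert spaces *)

(** Every term of the bound on phi must vanish at x = t = 0, since the a_n have infinite total mass.
    For small x and t the difference |x - t| is bounded neither by a small multiple of x + t nor by
    a multiple of (x - t)^2; so the linear part psi(0) t of phi has to cancel exactly, and it does
    because l_n is the mean of sigma under the density a_n / h. At infinity phi may grow like t^2,
    which is matched by sigma in L^2. The constant D depends on eps but not on h, so eps is fixed
    first. T, psi(T), the trace and the preimages under the transform are chosen from their
    characterizations; each has to be shown to exist, and to be unique as far as it is used.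
    Orthonormal bases may contain zero vectors; the formula h l_n = int sigma a_n assigns the
    eigenvalue 0 to them. sigma is nonnegative only almost everywhere, and psi is arbitrary on the
    negative axis; the proof therefore works with max(sigma, 0) and with the extension of psi by the
    constant psi(0), and relates the integral of sigma psi(sigma) to these at the end. *)

Section ComplexSquare.
Context {R : realType}.
Implicit Types (z w : R[i]) (a b : R).

(** The squared modulus as a real number: the norm of [R[i]] has values in [R[i]], and working with
    squares keeps square roots out of the estimates. *)
Definition sqn z : R := complex.Re z ^+ 2 + complex.Im z ^+ 2.

Lemma sqn_ge0 z : 0 <= sqn z.
Proof. by rewrite /sqn addr_ge0 ?sqr_ge0. Qed.

Lemma sqnE z : z * conjc z = (sqn z)%:C.
Proof.
by case: z => a b; apply/eqP; rewrite eq_complex /sqn /=; apply/andP; split; apply/eqP; ring.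
Qed.

Lemma sqn_eq0 z : sqn z = 0 -> z = 0.
Proof.
case: z => a b /eqP; rewrite /sqn /= paddr_eq0 ?sqr_ge0// !sqrf_eq0.
by move=> /andP[/eqP-> /eqP->].
Qed.

Lemma sqn0 : sqn 0 = 0. Proof. by rewrite /sqn /= expr0n addr0. Qed.

Lemma sqnM z w : sqn (z * w) = sqn z * sqn w.
Proof. by case: z => a b; case: w => c d; rewrite /sqn /=; ring. Qed.

Lemma sqnJ z : sqn (conjc z) = sqn z.
Proof. by case: z => a b; rewrite /sqn /=; ring. Qed.

Lemma sqnN z : sqn (- z) = sqn z.
Proof. by case: z => a b; rewrite /sqn /=; ring. Qed.

Lemma sqn_real a : sqn a%:C = a ^+ 2.
Proof. by rewrite /sqn /=; ring. Qed.

Lemma sqnD_le z w : sqn (z + w) <= 2 * sqn z + 2 * sqn w.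
Proof.
case: z => a b; case: w => c d; rewrite /sqn /=.
have := sqr_ge0 (a - c); have := sqr_ge0 (b - d); nra.
Qed.

Lemma sqr_Re_le z : complex.Re z ^+ 2 <= sqn z.
Proof. by rewrite /sqn lerDl sqr_ge0. Qed.

Lemma sqr_Im_le z : complex.Im z ^+ 2 <= sqn z.
Proof. by rewrite /sqn lerDr sqr_ge0. Qed.

Lemma ReD z w : complex.Re (z + w) = complex.Re z + complex.Re w.
Proof. by case: z; case: w. Qed.

Lemma ImD z w : complex.Im (z + w) = complex.Im z + complex.Im w.
Proof. by case: z; case: w. Qed.

Lemma ReN z : complex.Re (- z) = - complex.Re z. Proof. by case: z. Qed.
Lemma ImN z : complex.Im (- z) = - complex.Im z. Proof. by case: z. Qed.

Lemma ReJ z : complex.Re (conjc z) = complex.Re z. Proof. by case: z. Qed.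
Lemma ImJ z : complex.Im (conjc z) = - complex.Im z. Proof. by case: z. Qed.

Lemma ReM z w : complex.Re (z * w) =
  complex.Re z * complex.Re w - complex.Im z * complex.Im w.
Proof. by case: z; case: w. Qed.

Lemma ImM z w : complex.Im (z * w) =
  complex.Re z * complex.Im w + complex.Im z * complex.Re w.
Proof. by case: z => a b; case: w => c d /=; ring. Qed.

Lemma Re_sum n (F : nat -> R[i]) :
  complex.Re (\sum_(k < n) F k) = \sum_(k < n) complex.Re (F k).
Proof. by elim: n => [|n IH]; rewrite ?big_ord0// !big_ord_recr /= ReD IH. Qed.

Lemma ReZ a z : complex.Re (a%:C * z) = a * complex.Re z.
Proof. by rewrite ReM /= mul0r subr0. Qed.

Lemma ImZ a z : complex.Im (a%:C * z) = a * complex.Im z.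
Proof. by rewrite ImM /= mul0r addr0. Qed.

Lemma complex_eq z w :
  complex.Re z = complex.Re w -> complex.Im z = complex.Im w -> z = w.
Proof. by case: z => a b; case: w => c d /= -> ->. Qed.

End ComplexSquare.

Section Hilbert.
Context {R : realType} {V : lmodType R[i]} (H : ipspace V).
Local Notation C := R[i].
Implicit Types (u v w : V) (e : nat -> V) (c : C).

Definition nsq u : R := complex.Re (ip H u u).

(** [V] has no topology, so completeness is stated through [nsq]. Separability is a countable family
    with trivial orthogonal complement, the form that Gram-Schmidt consumes and that indicators of
    intervals supply. *)
Record is_hilbert : Prop := IsHilbert {
  hil_0 : vecs H 0 ;
  hil_lin : forall c u v, vecs H u -> vecs H v -> vecs H (c *: u + v) ;
  hil_ipl : forall c u v w, vecs H u -> vecs H v -> vecs H w ->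
    ip H (c *: u + v) w = c * ip H u w + ip H v w ;
  hil_ipC : forall u v, vecs H u -> vecs H v -> ip H v u = conjc (ip H u v) ;
  hil_ge0 : forall u, vecs H u -> 0 <= nsq u ;
  hil_def : forall u, vecs H u -> nsq u = 0 -> u = 0 ;
  hil_complete : forall u_ : nat -> V, (forall n, vecs H (u_ n)) ->
    (forall eps : R, 0 < eps -> exists N, forall m n, (N <= n <= m)%N ->
      nsq (u_ m - u_ n) <= eps) ->
    exists2 u, vecs H u &
      forall eps : R, 0 < eps -> exists N, forall n, (N <= n)%N ->
        nsq (u_ n - u) <= eps ;
  hil_sep : exists2 b : nat -> V, (forall n, vecs H (b n)) &
    forall u, vecs H u -> (forall n, ip H u (b n) = 0) -> u = 0 }.

Hypothesis hH : is_hilbert.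

Let v0 := hil_0 hH.
Let ipC := hil_ipC hH.
Hint Resolve v0 : core.

Lemma vecsD u v : vecs H u -> vecs H v -> vecs H (u + v).
Proof. by move=> hu hv; rewrite -[u]scale1r; exact: (hil_lin hH). Qed.

Lemma vecsZ c u : vecs H u -> vecs H (c *: u).
Proof. by move=> hu; rewrite -[_ *: _]addr0; exact: (hil_lin hH). Qed.

Lemma vecsN u : vecs H u -> vecs H (- u).
Proof. by move=> hu; rewrite -scaleN1r; exact: vecsZ. Qed.

Lemma vecsB u v : vecs H u -> vecs H v -> vecs H (u - v).
Proof. by move=> hu hv; apply: vecsD => //; exact: vecsN. Qed.

Lemma vecs_sum n (F : nat -> V) :
  (forall k, vecs H (F k)) -> vecs H (\sum_(k < n) F k).
Proof.
by move=> hF; elim: n => [|n IH]; rewrite ?big_ord0// big_ord_recr/=; exact: vecsD.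
Qed.

Lemma ipDl u v w : vecs H u -> vecs H v -> vecs H w ->
  ip H (u + v) w = ip H u w + ip H v w.
Proof. by move=> hu hv hw; rewrite -{1}[u]scale1r (hil_ipl hH)// mul1r. Qed.

Lemma ip0l w : vecs H w -> ip H 0 w = 0.
Proof.
move=> hw; have := ipDl v0 v0 hw; rewrite addr0 => /eqP.
by rewrite -subr_eq0 opprD addrA subrr sub0r oppr_eq0 => /eqP.
Qed.

Lemma ipZl c u w : vecs H u -> vecs H w -> ip H (c *: u) w = c * ip H u w.
Proof. by move=> hu hw; rewrite -[_ *: _]addr0 (hil_ipl hH)// ip0l// addr0. Qed.

Lemma ipNl u w : vecs H u -> vecs H w -> ip H (- u) w = - ip H u w.
Proof. by move=> hu hw; rewrite -scaleN1r ipZl// mulN1r. Qed.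

Lemma ipBl u v w : vecs H u -> vecs H v -> vecs H w ->
  ip H (u - v) w = ip H u w - ip H v w.
Proof. by move=> hu hv hw; rewrite ipDl ?ipNl//; exact: vecsN. Qed.

Lemma ipDr u v w : vecs H u -> vecs H v -> vecs H w ->
  ip H w (u + v) = ip H w u + ip H w v.
Proof.
move=> hu hv hw; rewrite [LHS]ipC//; last exact: vecsD.
by rewrite ipDl// rmorphD /= -!ipC.
Qed.

Lemma ip0r w : vecs H w -> ip H w 0 = 0.
Proof. by move=> hw; rewrite ipC// ip0l// conjc0. Qed.

Lemma ipZr c u w : vecs H u -> vecs H w -> ip H w (c *: u) = conjc c * ip H w u.
Proof.
by move=> hu hw; rewrite [LHS]ipC//; [rewrite ipZl// rmorphM /= -ipC | exact: vecsZ].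
Qed.

Lemma ipNr u w : vecs H u -> vecs H w -> ip H w (- u) = - ip H w u.
Proof. by move=> hu hw; rewrite -scaleN1r ipZr// rmorphN1 mulN1r. Qed.

Lemma ipBr u v w : vecs H u -> vecs H v -> vecs H w ->
  ip H w (u - v) = ip H w u - ip H w v.
Proof. by move=> hu hv hw; rewrite ipDr ?ipNr//; exact: vecsN. Qed.

Lemma ip_suml n (F : nat -> V) w : (forall k, vecs H (F k)) -> vecs H w ->
  ip H (\sum_(k < n) F k) w = \sum_(k < n) ip H (F k) w.
Proof.
move=> hF hw; elim: n => [|n IH]; rewrite ?big_ord0 ?ip0l// !big_ord_recr /=.
by rewrite ipDl ?IH//; exact: vecs_sum.
Qed.

Lemma ip_nsq u : vecs H u -> ip H u u = (nsq u)%:C.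
Proof.
move=> hu; apply: complex_eq => //=.
have /(congr1 (@complex.Im _)) := ipC hu hu; rewrite ImJ => h.
lra.
Qed.

Lemma nsq0 : nsq 0 = 0. Proof. by rewrite /nsq ip0l. Qed.

Lemma nsqZ c u : vecs H u -> nsq (c *: u) = sqn c * nsq u.
Proof.
move=> hu; have hc := vecsZ c hu.
rewrite {1}/nsq ipZl// ipZr// mulrA sqnE ip_nsq//.
by rewrite ReZ.
Qed.

Lemma nsqN u : vecs H u -> nsq (- u) = nsq u.
Proof. by move=> hu; rewrite -scaleN1r nsqZ// sqnN (_ : 1 = 1%:C)// sqn_real expr1n mul1r. Qed.

Lemma nsqBC u v : vecs H u -> vecs H v -> nsq (u - v) = nsq (v - u).
Proof. by move=> hu hv; rewrite -opprB nsqN//; exact: vecsB. Qed.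

Lemma nsqD u v : vecs H u -> vecs H v ->
  nsq (u + v) = nsq u + 2 * complex.Re (ip H u v) + nsq v.
Proof.
move=> hu hv; rewrite {1}/nsq ipDl ?ipDr//; last exact: vecsD.
by rewrite (ipC hu hv) !ReD ReJ /nsq; ring.
Qed.

Lemma nsqB u v : vecs H u -> vecs H v ->
  nsq (u - v) = nsq u - 2 * complex.Re (ip H u v) + nsq v.
Proof.
move=> hu hv; rewrite nsqD//; last exact: vecsN.
by rewrite ipNr// ReN nsqN//; ring.
Qed.

Lemma nsqD_le u v : vecs H u -> vecs H v -> nsq (u + v) <= 2 * nsq u + 2 * nsq v.
Proof.
move=> hu hv; have := hil_ge0 hH (vecsB hu hv); rewrite nsqB// nsqD//; lra.
Qed.

(** The vector |v|^2 u - <u, v> v has squared norm |v|^2 (|u|^2 |v|^2 - |<u, v>|^2). *)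
Lemma cauchy_schwarz u v : vecs H u -> vecs H v ->
  sqn (ip H u v) <= nsq u * nsq v.
Proof.
move=> hu hv.
have [v0'|v_neq0] := eqVneq (nsq v) 0.
  by rewrite (hil_def hH hv v0') ip0r// sqn0 nsq0 mulr0.
have nv : 0 < nsq v by rewrite lt_neqAle eq_sym v_neq0 (hil_ge0 hH hv).
have := hil_ge0 hH (vecsB (vecsZ (nsq v)%:C hu) (vecsZ (ip H u v) hv)).
rewrite nsqB ?nsqZ ?ipZl ?ipZr ?sqn_real//; try exact: vecsZ.
rewrite (mulrC (conjc _)) sqnE -rmorphM /=.
have := hil_ge0 hH hu; have := sqn_ge0 (ip H u v).
move: (sqn _) (nsq u) (nsq v) nv => s a b b0 s0 a0 h.
have : 0 <= b * (a * b - s) by nra.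
by rewrite pmulr_rge0// subr_ge0.
Qed.

Lemma sqn_ip_le u v (M : R) : vecs H u -> vecs H v -> nsq u <= M ->
  sqn (ip H u v) <= M * nsq v.
Proof.
move=> hu hv uM; apply: (le_trans (cauchy_schwarz hu hv)).
by rewrite ler_wpM2r// (hil_ge0 hH).
Qed.

Definition onsys e := [/\ forall n, vecs H (e n),
      forall n, ip H (e n) (e n) = 1 \/ e n = 0 &
      forall m n, m != n -> ip H (e m) (e n) = 0].

Lemma onb_onsys e : is_onb H e -> onsys e.
Proof. by case. Qed.

Section OrthonormalSystem.
Variable e : nat -> V.
Hypothesis he : onsys e.

Let ve n : vecs H (e n). Proof. by case: he. Qed.
Hint Resolve ve : core.

(** Zero vectors are allowed in [e], so a family [c] of coefficients is admissible when
    [c k * ip H (e k) (e k) = c k], that is, when it vanishes wherever [e] does. Fourier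
    coefficients are admissible. *)
Lemma onsys_ip_diag u n : vecs H u -> ip H u (e n) * ip H (e n) (e n) = ip H u (e n).
Proof.
move=> hu; case: he => _ /(_ n)[->|->] _; first by rewrite mulr1.
by rewrite ip0r// mul0r.
Qed.

Definition comb (c : nat -> C) n := \sum_(k < n) c k *: e k.

Lemma vecs_comb (c : nat -> C) n : vecs H (comb c n).
Proof. by apply: (vecs_sum n (F := fun k => c k *: e k)) => k; exact: vecsZ. Qed.
Hint Resolve vecs_comb : core.

Lemma ip_comb (c : nat -> C) n j : (forall k, c k * ip H (e k) (e k) = c k) ->
  ip H (comb c n) (e j) = if (j < n)%N then c j else 0.
Proof.
move=> hc; rewrite /comb (ip_suml n (F := fun k => c k *: e k))//; last by move=> k; exact: vecsZ.
case: he => _ _ orth.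
have [jn|nj] := ltnP j n.
  rewrite (bigD1 (Ordinal jn))//= ipZl// hc big1 ?addr0// => i ij.
  by rewrite ipZl// orth ?mulr0.
rewrite big1// => i _; rewrite ipZl// orth ?mulr0//.
by rewrite ltn_eqF// (leq_trans _ nj).
Qed.

Lemma nsq_comb (c : nat -> C) n : (forall k, c k * ip H (e k) (e k) = c k) ->
  nsq (comb c n) = \sum_(k < n) sqn (c k).
Proof.
move=> hc; elim: n => [|n IH]; first by rewrite /comb !big_ord0 nsq0.
rewrite {1}/comb big_ord_recr /= -/(comb c n) nsqD//; last exact: vecsZ.
rewrite ipZr// ip_comb// ltnn mulr0 /= mulr0 addr0 IH big_ord_recr /=.
rewrite /nsq ipZr ?ipZl//; last exact: vecsZ.
by rewrite hc mulrC sqnE.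
Qed.

Lemma combB (c : nat -> C) n m : (n <= m)%N ->
  comb c m - comb c n = comb (fun k => if (n <= k)%N then c k else 0) m.
Proof.
move=> nm; rewrite /comb.
rewrite [X in _ - X](big_ord_widen m (fun k => c k *: e k) nm).
rewrite [X in _ - X]big_mkcond -sumrB.
apply: eq_bigr => i _; rewrite ltnNge; case: leqP => //= _.
  by rewrite subr0.
by rewrite subrr scale0r.
Qed.

Definition proj u := comb (fun k => ip H u (e k)).

Lemma nsq_sub_proj u n : vecs H u ->
  nsq (u - proj u n) = nsq u - \sum_(k < n) sqn (ip H u (e k)).
Proof.
move=> hu; rewrite /proj nsqB// nsq_comb//; last by move=> k; exact: onsys_ip_diag.
rewrite (_ : complex.Re _ = \sum_(k < n) sqn (ip H u (e k))); last first.
  rewrite [ip H u _]ipC//.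
  rewrite ReJ /comb (ip_suml n (F := fun k => ip H u (e k) *: e k))//; last first.
    by move=> k; exact: vecsZ.
  rewrite (Re_sum n (fun k => ip H (ip H u (e k) *: e k) u)); apply: eq_bigr => k _.
  by rewrite ipZl// (ipC hu)// sqnE.
by ring.
Qed.

Lemma bessel u n : vecs H u -> \sum_(k < n) sqn (ip H u (e k)) <= nsq u.
Proof.
move=> hu; rewrite -subr_ge0 -nsq_sub_proj//; apply: (hil_ge0 hH).
by apply: vecsB => //; exact: vecs_comb.
Qed.


(** Bounded sums of squares make the partial combinations Cauchy; completeness gives the limit, and
    the inner product with a fixed [e j] passes to it by Cauchy-Schwarz. *)
Lemma riesz_fischer (c : nat -> C) (M : R) : (forall k, c k * ip H (e k) (e k) = c k) ->
  (forall n, \sum_(k < n) sqn (c k) <= M) ->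
  exists u, [/\ vecs H u, forall n, ip H u (e n) = c n &
    forall eps : R, 0 < eps -> exists N, forall n, (N <= n)%N ->
      nsq (comb c n - u) <= eps].
Proof.
move=> hc hM.
pose s := series (fun k => sqn (c k)).
have sE n : s n = \sum_(k < n) sqn (c k) by rewrite /s /series /= big_mkord.
have snd : nondecreasing_seq s.
  by apply/nondecreasing_seqP => n; rewrite !sE big_ord_recr /= lerDl sqn_ge0.
have sM : has_ubound (range s) by exists M => _ [n _ <-]; rewrite sE.
have /cvg_ex[l sl] := nondecreasing_is_cvgn snd sM.
have [u hu cu] : exists2 u, vecs H u & forall eps : R, 0 < eps ->
    exists N, forall n, (N <= n)%N -> nsq (comb c n - u) <= eps.
  apply: (hil_complete hH) => // eps e0.
  have /cvgrPdist_le /(_ _ e0)[N _ hN] := sl.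
  exists N => m n /andP[Nn nm].
  rewrite combB// nsq_comb//; last first.
    by move=> k; case: ifP; rewrite ?mul0r.
  have -> : \sum_(k < m) sqn (if (n <= k)%N then c k else 0) = s m - s n.
    rewrite !sE (big_ord_widen m (fun k => sqn (c k)) nm) [X in _ - X]big_mkcond -sumrB.
    apply: eq_bigr => i _; rewrite ltnNge; case: leqP => //= _.
      by rewrite subr0.
    by rewrite sqn0 subrr.
  have slel k : s k <= l.
    by rewrite -(cvg_lim _ sl)//; apply: nondecreasing_cvgn_le => //; apply/cvg_ex; exists l.
  have := hN n Nn; rewrite /= ger0_norm ?subr_ge0// => h.
  by apply: le_trans h; rewrite lerB// slel.
exists u; split => // j.
apply/eqP; rewrite -subr_eq0; apply/eqP/sqn_eq0/eqP; rewrite eq_le sqn_ge0 andbT.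
apply/ler_addgt0Pl => eps e0; rewrite addr0.
have [N hN] := cu _ e0.
(* The coefficient of [comb c n] at [j] is [c j] only from n = j + 1 on. *)
have := hN (maxn N j.+1) (leq_maxl _ _) => h; apply: le_trans h.
set n := maxn _ _.
have -> : ip H u (e j) - c j = - ip H (comb c n - u) (e j).
  by rewrite ipBl// ip_comb// leq_max leqnn orbT opprB.
rewrite sqnN.
have := cauchy_schwarz (vecsB (vecs_comb c n) hu) (ve j) => h; apply: (le_trans h).
have hn := hil_ge0 hH (vecsB (vecs_comb c n) hu).
rewrite -[leRHS]mulr1 ler_wpM2l//.
by case: he => _ /(_ j)[]; rewrite /nsq => -> //= _; rewrite ip0r//= ler01.
Qed.

End OrthonormalSystem.

Section Onb.
Variable e : nat -> V.
Hypothesis he : is_onb H e.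

Let oe := onb_onsys he.
Let ve n : vecs H (e n). Proof. by case: oe. Qed.
Hint Resolve ve : core.
Let vc (c : nat -> C) n : vecs H (comb e c n). Proof. exact: vecs_comb. Qed.
Hint Resolve vc : core.

Lemma onb_eq u v : vecs H u -> vecs H v -> (forall n, ip H u (e n) = ip H v (e n)) -> u = v.
Proof.
move=> hu hv uv; apply/eqP; rewrite -subr_eq0; apply/eqP.
case: he => _ _ _; apply; first exact: vecsB.
by move=> n; rewrite ipBl// uv subrr.
Qed.

(** Riesz-Fischer yields a limit of the projections with the same coefficients as [u]; by totality
    it is [u]. *)
Lemma proj_cvg u : vecs H u -> forall eps : R, 0 < eps -> exists N, forall n, (N <= n)%N ->
  nsq (u - proj e u n) <= eps.
Proof.
move=> hu eps e0.
have [||w [hw wu h]] := @riesz_fischer e oe (fun k => ip H u (e k)) (nsq u).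
- by move=> k; exact: onsys_ip_diag.
- by move=> n; exact: bessel.
have {}wu : w = u by exact: onb_eq.
have [N hN] := h _ e0; exists N => n Nn.
by rewrite nsqBC//; [have := hN _ Nn; rewrite wu|exact: vc].
Qed.

Lemma ip_comb_r u v n : vecs H u -> vecs H v ->
  ip H (proj e u n) v = \sum_(k < n) ip H u (e k) * conjc (ip H v (e k)).
Proof.
move=> hu hv; rewrite /proj /comb (ip_suml n (F := fun k => ip H u (e k) *: e k))//.
  by apply: eq_bigr => k _; rewrite ipZl// -ipC.
by move=> k; exact: vecsZ.
Qed.

Lemma parseval_ip u v : vecs H u -> vecs H v ->
  forall eps : R, 0 < eps -> exists N, forall n, (N <= n)%N ->
  sqn (ip H u v - \sum_(k < n) ip H u (e k) * conjc (ip H v (e k))) <= eps.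
Proof.
move=> hu hv eps e0.
have e1 : 0 < eps / (nsq v + 1).
  by rewrite divr_gt0// ltr_wpDl// (hil_ge0 hH).
have [N hN] := proj_cvg hu e1; exists N => n Nn.
rewrite -ip_comb_r// -ipBl//; last exact: vc.
have hv0 := hil_ge0 hH hv.
apply: (le_trans (sqn_ip_le _ _ (hN _ Nn))) => //; first by apply: vecsB => //; exact: vc.
rewrite mulrAC ler_pdivrMr ?ltr_wpDl//; nra.
Qed.

(** Two Parseval series agree term by term. In this form it proves symmetry of a diagonal operator
    A, and <|A| u, |A| v> = <A u, A v>, without handling any sum. *)
Lemma parseval_eq u v u' v' : vecs H u -> vecs H v -> vecs H u' -> vecs H v' ->
  (forall k, ip H u (e k) * conjc (ip H v (e k)) = ip H u' (e k) * conjc (ip H v' (e k))) ->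
  ip H u v = ip H u' v'.
Proof.
move=> hu hv hu' hv' E.
apply/eqP; rewrite -subr_eq0; apply/eqP/sqn_eq0/eqP; rewrite eq_le sqn_ge0 andbT.
apply/ler_addgt0Pl => eps e0; rewrite addr0.
have e1 : 0 < eps / 4 by rewrite divr_gt0.
have [N hN] := parseval_ip hu hv e1.
have [N' hN'] := parseval_ip hu' hv' e1.
have := hN (maxn N N') (leq_maxl _ _).
have := hN' (maxn N N') (leq_maxr _ _).
under eq_bigr do rewrite -E.
set S := \sum_(_ < _) _; move=> h1 h2.
rewrite (_ : ip H u v - _ = (ip H u v - S) + - (ip H u' v' - S)); last by ring.
by apply: (le_trans (sqnD_le _ _)); rewrite sqnN; lra.
Qed.

Lemma parseval u : vecs H u ->
  (fun n => \sum_(k < n) sqn (ip H u (e k))) @ \oo --> nsq u.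
Proof.
move=> hu; apply/cvgrPdist_le => eps e0.
have [N hN] := proj_cvg hu e0; exists N => // n /= Nn.
by rewrite -nsq_sub_proj// ger0_norm; [exact: hN|apply: (hil_ge0 hH); apply: vecsB; last exact: vc].
Qed.

End Onb.

(** Gram-Schmidt that keeps dependent vectors: [nrm] sends 0 to 0, and such an index carries the
    zero vector allowed in [is_onb]. A vector orthogonal to all [e n] is orthogonal to all [b n],
    because [b n] minus its projection [p n] is proportional to [e n]. *)
Lemma onb_exists : exists e, is_onb H e.
Proof.
have [b vb tb] := hil_sep hH.
pose nrm v := ((Num.sqrt (nsq v))^-1)%:C *: v.
have vnrm v : vecs H v -> vecs H (nrm v) by exact: vecsZ.
have nrm1 v : vecs H v -> ip H (nrm v) (nrm v) = 1 \/ nrm v = 0.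
  move=> hv; have [v0'|vn0] := eqVneq (nsq v) 0.
    by right; rewrite /nrm (hil_def hH hv v0') scaler0.
  left; rewrite ip_nsq; last exact: vnrm.
  rewrite /nrm nsqZ// sqn_real exprVn sqr_sqrtr ?(hil_ge0 hH)// mulVf//.
pose step (l : seq V) := nrm (b (size l) - \sum_(i < size l) ip H (b (size l)) (nth 0 l i) *: nth 0 l i).
(* Course-of-values recursion through the list of the vectors already built, [e n] being the one
   added to [gs n]. *)
pose gs := fix gs n := if n is m.+1 then rcons (gs m) (step (gs m)) else [::].
have sgs n : size (gs n) = n by elim: n => //= n IH; rewrite size_rcons IH.
pose e n := step (gs n).
have ngs n k : (k < n)%N -> nth 0 (gs n) k = e k.
  elim: n => // n IH; rewrite ltnS /= nth_rcons sgs; case: ltngtP => // [kn _|-> _]; [exact: IH|by []].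
have eE n : e n = nrm (b n - \sum_(i < n) ip H (b n) (e i) *: e i).
  rewrite /e /step sgs; congr (nrm (_ - _)).
  by apply: eq_bigr => i _; rewrite ngs.
have ve n : vecs H (e n).
  have [m] := ubnP n; elim: m n => // m IH n nm; rewrite eE; apply: vnrm; apply: vecsB => //.
  (* [vecs_sum] asks for membership at every index, whereas the induction hypothesis covers only i <
     n; the other terms are replaced by 0. *)
  rewrite (_ : \sum_(i < n) _ = \sum_(i < n) (if (i < n)%N then ip H (b n) (e i) *: e i else 0)); last first.
    by apply: eq_bigr => i _; rewrite ltn_ord.
  apply: (vecs_sum n (F := fun i => if (i < n)%N then ip H (b n) (e i) *: e i else 0)) => k.
  by case: ifP => // kn; apply: vecsZ; apply: IH; exact: leq_trans kn _.
pose p n := \sum_(i < n) ip H (b n) (e i) *: e i.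
have vp n : vecs H (p n).
  by apply: (vecs_sum n (F := fun i => ip H (b n) (e i) *: e i)) => k; exact: vecsZ.
have one n : ip H (e n) (e n) = 1 \/ e n = 0.
  by rewrite eE; apply: nrm1; apply: vecsB => //; exact: vp.
have diag u n : vecs H u -> ip H u (e n) * ip H (e n) (e n) = ip H u (e n).
  by move=> hu; case: (one n) => ->; rewrite ?mulr1// ip0r// mul0r.
have orth n m : (m < n)%N -> ip H (e n) (e m) = 0.
  have [k] := ubnP n; elim: k n m => // k IH n m nk mn.
  rewrite eE /nrm; move: (Num.sqrt _)^-1 => a; rewrite ipZl//; last by apply: vecsB => //; exact: vp.
  rewrite ipBl//; last exact: vp.
  rewrite (ip_suml n (F := fun i => ip H (b n) (e i) *: e i))//; last by move=> i; exact: vecsZ.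
  rewrite (bigD1 (Ordinal mn))//= ipZl// diag// big1 ?addr0 ?subrr ?mulr0// => i im.
  rewrite ipZl//.
  have [im'|mi|E] := ltngtP i m.
  - rewrite (ipC (ve m) (ve i)) IH ?conjc0 ?mulr0//; exact: (leq_trans mn).
  - rewrite IH ?mulr0//; exact: (leq_trans (ltn_ord i)).
  - by move/eqP: im; case; exact: val_inj.
exists e; split => //.
  move=> m n; rewrite neq_ltn => /orP[mn|]; last exact: orth.
  by rewrite ipC// orth// conjc0.
move=> u hu h0; apply: tb => // n.
have vbp : vecs H (b n - p n) by apply: vecsB => //; exact: vp.
have up : ip H u (p n) = 0.
  rewrite ipC// (ip_suml n (F := fun i => ip H (b n) (e i) *: e i))//; last by move=> i; exact: vecsZ.
  by rewrite big1 ?conjc0// => i _; rewrite ipZl// (ipC hu)// h0 conjc0 mulr0.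
have ubp : ip H u (b n - p n) = 0.
  have [E|N] := eqVneq (nsq (b n - p n)) 0; first by rewrite (hil_def hH vbp E) ip0r.
  have := h0 n; rewrite eE /nrm ipZr// => /eqP; rewrite mulf_eq0 => /orP[|/eqP//].
  rewrite conjc_eq0 => /eqP/complexI/eqP; rewrite invr_eq0 sqrtr_eq0.
  by rewrite leNgt lt_neqAle eq_sym N (hil_ge0 hH vbp).
by have := ipDr vbp (vp n) hu; rewrite subrK up ubp addr0.
Qed.

(* |Q(F, u_N)| <= K^(1/2) |u_N| for u_N the truncated sequence of coefficients *)
(* bounds the partial sums of squares of these coefficients. *)
Lemma riesz_representation (l : V -> C) (K : R) : 0 <= K ->
  (forall a u v, vecs H u -> vecs H v -> l (a *: u + v) = conjc a * l u + l v) ->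
  (forall u, vecs H u -> sqn (l u) <= K * nsq u) ->
  exists2 w, vecs H w & forall u, vecs H u -> ip H w u = l u.
Proof.
move=> K0 llin lK.
have [e he] := onb_exists.
have oe := onb_onsys he.
have ve n : vecs H (e n) by case: oe.
have l0 : l 0 = 0.
  have := llin 1 0 0 v0 v0; rewrite scale1r addr0 conjc1 mul1r => /eqP.
  by rewrite -subr_eq0 opprD addrA subrr sub0r oppr_eq0 => /eqP.
have lZ a u : vecs H u -> l (a *: u) = conjc a * l u.
  by move=> hu; rewrite -[_ *: _]addr0 llin// l0 addr0.
have lD u v : vecs H u -> vecs H v -> l (u + v) = l u + l v.
  by move=> hu hv; rewrite -{1}[u]scale1r llin// conjc1 mul1r.
have lN u : vecs H u -> l (- u) = - l u.
  by move=> hu; rewrite -scaleN1r lZ// rmorphN1 mulN1r.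
have lsum n (F : nat -> V) : (forall k, vecs H (F k)) ->
    l (\sum_(k < n) F k) = \sum_(k < n) l (F k).
  move=> hF; elim: n => [|n IH]; rewrite ?big_ord0 ?l0// !big_ord_recr /= lD ?IH//.
  exact: vecs_sum.
pose c n := l (e n).
have cdiag k : c k * ip H (e k) (e k) = c k.
  by rewrite /c; case: oe => _ /(_ k)[->|->] _; rewrite ?mulr1// l0 mul0r.
have hc n : \sum_(k < n) sqn (c k) <= K.
  have := lK _ (vecs_comb oe c n); rewrite (nsq_comb oe)//.
  rewrite /comb (lsum n (fun k => c k *: e k)); last by move=> k; exact: vecsZ.
  under eq_bigr do rewrite lZ// mulrC sqnE.
  rewrite -(rmorph_sum (real_complex R)) /= sqn_real.
  set S := \sum_(_ < _) _.
  have S0 : 0 <= S by apply: sumr_ge0 => *; exact: sqn_ge0.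
  have [->//|Sn0] := eqVneq S 0.
  by rewrite expr2 ler_pM2r// lt_neqAle eq_sym Sn0.
have [w [hw wc _]] := riesz_fischer oe cdiag hc.
exists w => // u hu.
apply/eqP; rewrite -subr_eq0; apply/eqP/sqn_eq0/eqP; rewrite eq_le sqn_ge0 andbT.
apply/ler_addgt0Pl => eps e0; rewrite addr0.
pose D := 2 * nsq w + 2 * K + 1.
have D0 : 0 < D by rewrite /D; have := hil_ge0 hH hw; lra.
have [N /(_ N (leqnn _)) hN] := proj_cvg he hu (divr_gt0 e0 D0).
have vp : vecs H (proj e u N) by exact: vecs_comb.
have vup := vecsB hu vp.
have E : ip H w (proj e u N) = l (proj e u N).
  rewrite /proj /comb (lsum N (fun k => ip H u (e k) *: e k)); last by move=> k; exact: vecsZ.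
  rewrite ipC// (ip_suml N (F := fun k => ip H u (e k) *: e k))//; last by move=> k; exact: vecsZ.
  rewrite rmorph_sum /=; apply: eq_bigr => k _.
  by rewrite ipZl// rmorphM /= -(ipC (ve k))// wc lZ.
have -> : ip H w u - l u = ip H w (u - proj e u N) - l (u - proj e u N).
  by rewrite lD ?lN ?ipBr// ?E; [ring|exact: vecsN].
apply: (le_trans (sqnD_le _ _)); rewrite sqnN.
have h1 := cauchy_schwarz hw vup.
have h2 := lK _ vup.
have h3 := hil_ge0 hH vup.
rewrite ler_pdivlMr// in hN.
move: h1 h2 h3 hN; rewrite /D; have := hil_ge0 hH hw; nra.
Qed.

End Hilbert.

(** * The spectral theorem for positive Hilbert-Schmidt operators *)

(** Convergence along an ultrafilter replaces the extraction of subsequences: countably many bounded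
    sequences converge along the same [U], with no diagonal argument. *)
Lemma ultra_cvg_bounded {R : realType} (T : Type) (U : set_system T) (f : T -> R) (M : R) :
  UltraFilter U -> (forall k, `|f k| <= M) -> exists l : R, f k @[k --> U] --> l.
Proof.
move=> UU fM.
have FP : ProperFilter (f @ U) by apply: fmap_proper_filter.
have /(_ (f @ U) FP)[|p [_ pc]] := @segment_compact R (- M) M.
  by apply: (@filterE _ U) => k /=; have := fM k; rewrite ler_norml in_itv.
exists p => B Bp.
have [//|UC] := in_ultra_setVsetC (f @^-1` B) UU.
have [x [/= xB Bx]] := pc (~` B) B UC Bp.
by [].
Qed.

Section Spectral.
Context {R : realType} {V : lmodType R[i]} (H : ipspace V).
Hypothesis hH : is_hilbert H.
Local Notation C := R[i].
Local Notation nsq := (nsq H).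
Implicit Types (u v w : V).

Let v0 := hil_0 hH.
Let ipC := hil_ipC hH.
Let vZ := vecsZ hH.
Let vD := vecsD hH.
Let vB := vecsB hH.
Hint Resolve v0 vZ vD vB : core.

(** Boundedness of [d] controls the contribution of the tail of [v] uniformly in k, by
    Cauchy-Schwarz; the remaining part of [v] is a finite combination of basis vectors. *)
Lemma weak_null_test (U : set_system nat) (d : nat -> V) (M : R) e :
  UltraFilter U -> is_onb H e -> (forall k, vecs H (d k)) -> (forall k, nsq (d k) <= M) ->
  (forall n (eps : R), 0 < eps -> \forall k \near U, sqn (ip H (d k) (e n)) <= eps) ->
  forall v (eps : R), vecs H v -> 0 < eps -> \forall k \near U, sqn (ip H (d k) v) <= eps.
Proof.
move=> UU he vd dM hd v eps hv e0.
have ve n : vecs H (e n) by case: he.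
have M0 : 0 <= M by exact: le_trans (hil_ge0 hH (vd 0%N)) (dM 0%N).
have M1 : 0 < M + 1 by lra.
have e1 : 0 < eps / 4 / (M + 1) by rewrite !divr_gt0.
have [N /(_ N (leqnn _)) hN] := proj_cvg hH he hv e1.
have comb_small n (c : nat -> C) : forall eps : R, 0 < eps ->
    \forall k \near U, sqn (ip H (d k) (comb e c n)) <= eps.
  elim: n => [|n IH] dl d0.
    by apply: nearW => k; rewrite /comb big_ord0 (ip0r hH)// sqn0 ltW.
  have d1 : 0 < dl / 4 by rewrite divr_gt0.
  have c1 : 0 < sqn (c n) + 1 by rewrite ltr_wpDl// sqn_ge0.
  have d2 : 0 < dl / 4 / (sqn (c n) + 1) by rewrite divr_gt0.
  near=> k.
  have h1 : sqn (ip H (d k) (comb e c n)) <= dl / 4 by near: k; exact: IH.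
  have h2 : sqn (ip H (d k) (e n)) <= dl / 4 / (sqn (c n) + 1) by near: k; exact: hd.
  rewrite /comb big_ord_recr /= -/(comb e c n) (ipDr hH); auto; last first.
    by apply: (vecs_sum hH n (F := fun i => c i *: e i)) => i; auto.
  apply: (le_trans (sqnD_le _ _)); rewrite (ipZr hH)// sqnM sqnJ.
  rewrite ler_pdivlMr// in h2.
  have := sqn_ge0 (c n); have := sqn_ge0 (ip H (d k) (e n)); nra.
have vp : vecs H (proj H e v N) by apply: vecs_comb => //; exact: onb_onsys.
have e4 : 0 < eps / 4 by rewrite divr_gt0.
near=> k.
have h1 : sqn (ip H (d k) (proj H e v N)) <= eps / 4 by near: k; exact: comb_small.
have -> : ip H (d k) v = ip H (d k) (proj H e v N) + ip H (d k) (v - proj H e v N).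
  by rewrite (ipBr hH)//; ring.
apply: (le_trans (sqnD_le _ _)).
have hp := vecsB hH hv vp.
have h2 := sqn_ip_le hH (vd k) hp (dM k).
rewrite ler_pdivlMr// in hN.
have := hil_ge0 hH hp; nra.
Unshelve. all: end_near.
Qed.

Section Operator.
Variable T : V -> V.
Hypothesis vT : forall u, vecs H u -> vecs H (T u).
Hint Resolve vT : core.
Hypothesis Tlin : forall (c : C) u v, vecs H u -> vecs H v -> T (c *: u + v) = c *: T u + T v.
Hypothesis Tsym : forall u v, vecs H u -> vecs H v -> ip H (T u) v = ip H u (T v).
Hypothesis Tpos : forall u, vecs H u -> 0 <= complex.Re (ip H (T u) u).

Let q u : R := complex.Re (ip H (T u) u).

Lemma TD u v : vecs H u -> vecs H v -> T (u + v) = T u + T v.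
Proof. by move=> hu hv; rewrite -{1}[u]scale1r Tlin// scale1r. Qed.

Lemma T0 : T 0 = 0.
Proof. by apply: (addrI (T 0)); rewrite -TD// !addr0. Qed.

Lemma TZ (c : C) u : vecs H u -> T (c *: u) = c *: T u.
Proof. by move=> hu; rewrite -[c *: u]addr0 Tlin// T0 addr0. Qed.

Lemma qZ (a : R) u : vecs H u -> q (a%:C *: u) = a ^+ 2 * q u.
Proof.
move=> hu; rewrite /q TZ// (ipZl hH) ?(ipZr hH); auto.
by rewrite conjc_real !ReZ; ring.
Qed.

(* Cauchy-Schwarz for the semi-definite form (u, v) |-> <T u, v>. *)
Lemma T_cauchy_schwarz u v : vecs H u -> vecs H v ->
  complex.Re (ip H (T u) v) ^+ 2 <= q u * q v.
Proof.
move=> hu hv.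
have quad (s : R) : 0 <= q u + 2 * s * complex.Re (ip H (T u) v) + s ^+ 2 * q v.
  have hs := vecsZ hH s%:C hv.
  have := Tpos (vecsD hH hu hs).
  rewrite TD// (ipDl hH) ?(ipDr hH); auto.
  rewrite !ReD -/(q u) -/(q (_ *: v)) qZ//.
  rewrite (Tsym hs hu) (ipZl hH)// ?(ipZr hH)//; auto; rewrite conjc_real !ReZ (ipC (vT hu) hv) ReJ.
  by move=> h; apply: le_trans h _; lra.
have qv := Tpos hv; have qu := Tpos hu; rewrite -/(q _) in qv qu.
move: quad qv qu; move: (q u) (q v) (complex.Re _) => a b r quad b0 a0.
have [b1|bn0] := eqVneq b 0.
  have [->|rn0] := eqVneq r 0; first by rewrite b1 mulr0 expr0n.
  (* When <T v, v> = 0 the quadratic polynomial is affine in s, and at this point it equals -1. *)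
  have := quad (- (a + 1) / (2 * r)); rewrite b1 mulr0 addr0.
  have -> : 2 * (- (a + 1) / (2 * r)) * r = - (a + 1) by field.
  lra.
have := quad (- r / b).
have -> : a + 2 * (- r / b) * r + (- r / b) ^+ 2 * b = (a * b - r ^+ 2) / b by field.
by rewrite pmulr_lge0 ?subr_ge0// invr_gt0 lt_neqAle eq_sym bn0.
Qed.

(** Cauchy-Schwarz for the form at u and T u gives |T u|^4 <= q(u) q(T u) <= q(u) M |T u|^2. The
    bound M is only assumed on an invariant set [W], for use on the orthogonal complement of a set
    of eigenvectors. *)
Lemma nsq_T_le (W : set V) (M : R) :
  (forall u, W u -> vecs H u) -> (forall u, W u -> W (T u)) ->
  (forall u, W u -> q u <= M * nsq u) ->
  forall u, W u -> nsq (T u) <= M * q u.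
Proof.
move=> Wv WT WM u Wu.
have hu := Wv _ Wu.
have := T_cauchy_schwarz hu (vT hu).
rewrite -/(nsq (T u)) => h.
have := WM _ (WT _ Wu) => h1.
have n0 := hil_ge0 hH (vT hu).
have q0 := Tpos hu; rewrite -/(q u) in q0.
have [->|nn0] := eqVneq (nsq (T u)) 0; last first.
  have : nsq (T u) * nsq (T u) <= (M * q u) * nsq (T u) by rewrite -expr2; nra.
  by rewrite ler_pM2r// lt_neqAle eq_sym nn0.
have [->|qn0] := eqVneq (q u) 0; first by rewrite mulr0.
have := WM _ Wu; have := hil_ge0 hH hu => nu0 h2.
have qp : 0 < q u by rewrite lt_neqAle eq_sym qn0.
nra.
Qed.

Hypothesis HS : exists2 b, is_onb H b & exists S : R, forall n, \sum_(k < n) nsq (T (b k)) <= S.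

(** Complete continuity of a Hilbert-Schmidt operator: in |T d|^2 = sum_i |<d, T b_i>|^2 the tail is
    at most M sum_(i >= N) |T b_i|^2, uniformly in d, and each of the finitely many other terms
    tends to 0 by weak convergence. *)
Lemma T_weak_strong (U : set_system nat) (d : nat -> V) (M : R) :
  UltraFilter U -> (forall k, vecs H (d k)) -> (forall k, nsq (d k) <= M) ->
  (forall v (eps : R), vecs H v -> 0 < eps -> \forall k \near U, sqn (ip H (d k) v) <= eps) ->
  forall eps : R, 0 < eps -> \forall k \near U, nsq (T (d k)) <= eps.
Proof.
move=> UU vd dM wd eps e0.
have [b hb [S hS]] := HS.
have vb n : vecs H (b n) by case: hb.
have M0 : 0 <= M by exact: le_trans (hil_ge0 hH (vd 0%N)) (dM 0%N).
pose s := series (fun k => nsq (T (b k))).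
have sE n : s n = \sum_(k < n) nsq (T (b k)) by rewrite /s /series /= big_mkord.
have snd : nondecreasing_seq s.
  by apply/nondecreasing_seqP => n; rewrite !sE big_ord_recr /= lerDl (hil_ge0 hH (vT (vb n))).
have sM : has_ubound (range s) by exists S => _ [n _ <-]; rewrite sE.
have /cvg_ex[l sl] := nondecreasing_is_cvgn snd sM.
have slel k : s k <= l.
  by rewrite -(cvg_lim _ sl)//; apply: nondecreasing_cvgn_le => //; apply/cvg_ex; exists l.
have M1 : 0 < M + 1 by lra.
have e1 : 0 < eps / 2 / (M + 1) by rewrite !divr_gt0.
have /cvgrPdist_le /(_ _ e1)[N _ /(_ N (leqnn N)) /= hN] := sl.
rewrite ger0_norm ?subr_ge0// in hN.
have fin : forall n (dl : R), 0 < dl ->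
    \forall k \near U, \sum_(i < n) sqn (ip H (d k) (T (b i))) <= dl.
  elim=> [|n IH] dl d0; first by apply: nearW => k; rewrite big_ord0 ltW.
  have d1 : 0 < dl / 2 by rewrite divr_gt0.
  near=> k; rewrite big_ord_recr /= (splitr dl) lerD//.
  - by near: k; exact: IH.
  - by near: k; exact: (wd _ _ (vT (vb n))).
have e2 : 0 < eps / 2 by rewrite divr_gt0.
near=> k.
have hk : \sum_(i < N) sqn (ip H (d k) (T (b i))) <= eps / 2 by near: k; exact: fin.
have P := parseval hH hb (vT (vd k)).
rewrite -(cvg_lim _ P)//; apply: limr_le; first by apply/cvg_ex; exists (nsq (T (d k))).
exists N => // n /= Nn.
have tail : \sum_(N <= i < n) sqn (ip H (d k) (T (b i))) <= M * (s n - s N).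
  rewrite /s /series /= [X in X - _](big_cat_nat (n:=N))//= addrAC subrr add0r mulr_sumr.
  apply: ler_sum => i _; apply: (sqn_ip_le hH); auto.
under eq_bigr do rewrite Tsym//.
rewrite -(big_mkord xpredT (fun i => sqn (ip H (d k) (T (b i))))) (big_cat_nat (n:=N))//= big_mkord.
rewrite (splitr eps) lerD//; apply: (le_trans tail).
have := slel n; rewrite ler_pdivlMr// in hN.
by nra.
Unshelve. all: end_near.
Qed.

Lemma nsq_T_bounded : exists S : R, forall u, vecs H u -> nsq (T u) <= S * nsq u.
Proof.
have [b hb [S hS]] := HS; exists S => u hu.
have vb n : vecs H (b n) by case: hb.
have P := parseval hH hb (vT hu).
rewrite -(cvg_lim _ P)//; apply: limr_le; first by apply/cvg_ex; exists (nsq (T u)).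
apply: nearW => n /=.
apply: (@le_trans _ _ (\sum_(k < n) nsq u * nsq (T (b k)))).
  by apply: ler_sum => k _; rewrite Tsym//; apply: (cauchy_schwarz hH); auto.
by rewrite -mulr_sumr mulrC ler_wpM2r// (hil_ge0 hH).
Qed.

Lemma q_le : exists S : R, forall u, vecs H u -> q u <= S * nsq u.
Proof.
have [S hS] := nsq_T_bounded; exists (S + 1) => u hu.
have := hil_ge0 hH (vB (vT hu) hu); rewrite (nsqB hH); auto.
have := hS _ hu; have := hil_ge0 hH hu; have := hil_ge0 hH (vT hu); rewrite -/(q u); lra.
Qed.

Lemma normalize u : vecs H u -> u != 0 -> exists2 a : R, a != 0 & nsq (a%:C *: u) = 1.
Proof.
move=> hu u0; have n0 : nsq u != 0.
  by apply: contra u0 => /eqP /(hil_def hH hu) ->.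
have np : 0 < nsq u by rewrite lt_neqAle eq_sym n0 (hil_ge0 hH).
exists (Num.sqrt (nsq u))^-1; first by rewrite invr_eq0 sqrtr_eq0 -ltNge.
by rewrite (nsqZ hH)// sqn_real exprVn sqr_sqrtr ?(hil_ge0 hH)// mulVf.
Qed.

(** The form q is maximized over the unit ball of [W]. A maximizing sequence has a weak limit u
    along an ultrafilter, and compactness gives q(u) >= M; then |T u - M u|^2 <= M (M |u|^2 - q(u))
    <= 0. The ball is used instead of the sphere because a weak limit is only known to have norm at
    most 1; norm 1 follows from M <= q(u) = M |u|^2 when M > 0. *)
Lemma top_eigenvector (E : set V) : (forall e, E e -> vecs H e) ->
  let W := [set v | vecs H v /\ forall e, E e -> ip H v e = 0] in
  (forall v, W v -> W (T v)) -> (exists2 u, W u & u != 0) ->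
  exists v, [/\ W v, nsq v = 1 & exists l : R, T v = l%:C *: v].
Proof.
move=> vE W WT [u0 Wu0 u0n].
have Wv v : W v -> vecs H v by case.
have WZ (c : C) v : W v -> W (c *: v).
  by move=> [hv h]; split; auto => e Ee; rewrite (ipZl hH)// ?h ?mulr0//; exact: vE.
have W0 : W 0 by split => // e Ee; rewrite (ip0l hH)//; exact: vE.
pose Q := [set q v | v in [set v | W v /\ nsq v <= 1]].
have [S hS] := q_le.
have S0 : 0 <= S.
  have [a a0 na] := normalize (Wv _ Wu0) u0n.
  by have := hS _ (vZ a%:C (Wv _ Wu0)); rewrite na mulr1; apply: le_trans; apply: Tpos; auto.
have q0 : q 0 = 0 by rewrite /q T0 (ip0l hH).
have supQ : has_sup Q.
  split; first by exists 0, 0; [split => //; rewrite (nsq0 hH) ler01|exact: q0].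
  exists S => _ [v [Wv' nv] <-]; apply: (le_trans (hS _ (Wv _ Wv'))).
  by rewrite -[leRHS]mulr1 ler_wpM2l.
have [M ME] : exists M, M = sup Q by exists (sup Q).
have M_ub v : W v -> nsq v <= 1 -> q v <= M.
  by move=> Wv' nv; rewrite ME; apply: sup_ubound; [case: supQ|exists v].
have WM v : W v -> q v <= M * nsq v.
  move=> Wv'; have [->|vn0] := eqVneq v 0; first by rewrite q0 (nsq0 hH) mulr0.
  have [a a0 na] := normalize (Wv _ Wv') vn0.
  have := M_ub _ (WZ a%:C _ Wv'); rewrite na lexx => /(_ isT).
  have hv := Wv _ Wv'; rewrite qZ//; move: na; rewrite (nsqZ hH)// sqn_real => na h.
  have a2 : 0 < a ^+ 2 by rewrite exprn_even_gt0.
  by rewrite -(ler_pM2l a2) mulrCA na mulr1.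
have M0 : 0 <= M by rewrite -q0; apply: M_ub => //; rewrite (nsq0 hH) ler01.
have TM := nsq_T_le Wv WT WM.
(* If q vanishes on [W], so does T by [TM], and any unit vector of [W] is an eigenvector. *)
have [Mz|Mn0] := eqVneq M 0.
  have [a a0 na] := normalize (Wv _ Wu0) u0n.
  exists (a%:C *: u0); split => //; first exact: WZ.
  exists 0; rewrite scale0r; apply: (hil_def hH); first by apply: vT; apply: vZ; exact: Wv.
  apply/eqP; rewrite eq_le (hil_ge0 hH) ?andbT; last by apply: vT; apply: vZ; exact: Wv.
  by have := TM _ (WZ a%:C _ Wu0); rewrite Mz mul0r.
have /choice[w hw] : forall k : nat, exists v, [/\ W v, nsq v <= 1 & M - (k.+1%:R)^-1 < q v].
  move=> k; have k0 : 0 < (k.+1%:R : R)^-1 by rewrite invr_gt0.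
  by have [_ [v [Wv' nv] <-] h] := sup_adherent k0 supQ; exists v; rewrite ME.
have Ww k : W (w k) by case: (hw k).
have vw k : vecs H (w k) by exact: Wv.
have nw k : nsq (w k) <= 1 by case: (hw k).
have [U [UU sU]] := ultraFilterLemma eventually_filter.
have [b hb HSb] := HS.
have vb n : vecs H (b n) by case: hb.
have nb n : nsq (b n) <= 1.
  by case: hb => _ /(_ n)[h|->] _ _; [rewrite /nsq h|rewrite (nsq0 hH)].
have snb k n : sqn (ip H (w k) (b n)) <= 1.
  apply: (le_trans (sqn_ip_le hH (vw k) (vb n) (nw k))); by rewrite mul1r.
have sq1 (x : R) : x ^+ 2 <= 1 -> `|x| <= 1 by rewrite -real_normK ?num_real// expr_le1.
(* The weak limit is built from the limits of the coefficients: Bessel's inequality passes to the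
   limit, and Riesz-Fischer gives the vector. *)
have /choice[c hc] : forall n, exists c : C,
    complex.Re (ip H (w k) (b n)) @[k --> U] --> complex.Re c /\
    complex.Im (ip H (w k) (b n)) @[k --> U] --> complex.Im c.
  move=> n.
  have [|x hx] := @ultra_cvg_bounded R _ U (fun k => complex.Re (ip H (w k) (b n))) 1 UU.
    by move=> k; apply: sq1; exact: le_trans (sqr_Re_le _) _.
  have [|y hy] := @ultra_cvg_bounded R _ U (fun k => complex.Im (ip H (w k) (b n))) 1 UU.
    by move=> k; apply: sq1; exact: le_trans (sqr_Im_le _) _.
  by exists (x +i* y).
have sc n : sqn (ip H (w k) (b n)) @[k --> U] --> sqn (c n).
  by rewrite /sqn; apply: cvgD; rewrite ?expr2; under eq_fun do rewrite expr2; apply: cvgM; case: (hc n).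
have sumc n : \sum_(i < n) sqn (c i) <= 1.
  have h : \sum_(i < n) sqn (ip H (w k) (b i)) @[k --> U] --> \sum_(i < n) sqn (c i).
    elim: n => [|n IH]; first by rewrite big_ord0; under eq_fun do rewrite big_ord0; exact: cvg_cst.
    by rewrite big_ord_recr /=; under eq_fun do rewrite big_ord_recr /=; exact: cvgD.
  rewrite -(cvg_lim _ h)//; apply: limr_le; first by apply/cvg_ex; exists (\sum_(i < n) sqn (c i)).
  by apply: nearW => k; apply: le_trans (bessel hH (onb_onsys hb) n (vw k)) _.
have cdiag k : c k * ip H (b k) (b k) = c k.
  case: hb => _ /(_ k)[->|bk0] _ _; first by rewrite mulr1.
  have := sc k; under eq_fun do rewrite bk0 (ip0r hH)// sqn0.
  move=> /(cvg_lim (@Rhausdorff R)); rewrite lim_cst// => /esym/sqn_eq0 ->; exact: mul0r.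
have [u [hu ub _]] := riesz_fischer hH (onb_onsys hb) cdiag sumc.
have nu : nsq u <= 1.
  have P := parseval hH hb hu; rewrite -(cvg_lim _ P)//.
  apply: limr_le; first by apply/cvg_ex; exists (nsq u).
  apply: nearW => n; rewrite (eq_bigr (fun k : 'I_n => sqn (c k))); first exact: sumc.
  by move=> k _; rewrite ub.
pose d k := w k - u.
have vd k : vecs H (d k) by apply: vB.
have nd k : nsq (d k) <= 4.
  apply: le_trans (_ : 2 * nsq (w k) + 2 * nsq (- u) <= 4).
    by apply: (nsqD_le hH) => //; exact: (vecsN hH).
  by rewrite (nsqN hH)//; have := nw k; lra.
have wd : forall v (eps : R), vecs H v -> 0 < eps -> \forall k \near U, sqn (ip H (d k) v) <= eps.
  apply: (weak_null_test UU hb vd nd) => n eps e0.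
  have e2 : 0 < eps / 2 by rewrite divr_gt0.
  have e3 : 0 < Num.sqrt (eps / 2) by rewrite sqrtr_gt0.
  have [/cvgrPdist_le /(_ _ e3) h1 /cvgrPdist_le /(_ _ e3) h2] := hc n.
  near=> k.
  have h3 : `|complex.Re (c n) - complex.Re (ip H (w k) (b n))| <= Num.sqrt (eps / 2) by near: k.
  have h4 : `|complex.Im (c n) - complex.Im (ip H (w k) (b n))| <= Num.sqrt (eps / 2) by near: k.
  rewrite /d (ipBl hH)// ub /sqn !ReD !ImD !ReN !ImN (splitr eps) -opprB sqrrN -[X in _ + X ^+ 2]opprB sqrrN.
  have sqle (x : R) : `|x| <= Num.sqrt (eps / 2) -> x ^+ 2 <= eps / 2.
    by move=> hx; rewrite -(sqr_sqrtr (ltW e2)) -(real_normK (num_real x)) ler_sqr ?nnegrE ?sqrtr_ge0 ?normr_ge0.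
  by rewrite lerD// sqle.
have Wu : W u.
  split => // e Ee; have ve := vE _ Ee.
  apply/sqn_eq0/eqP; rewrite eq_le sqn_ge0 andbT.
  apply/ler_addgt0Pl => eps e0; rewrite addr0.
  have : \forall k \near U, sqn (ip H u e) <= eps.
    have := wd e eps ve e0; apply: filterS => k.
    by rewrite /d (ipBl hH)//; case: (Ww k) => _ /(_ _ Ee) ->; rewrite sub0r sqnN.
  by move=> /filter_ex[].
have Td := T_weak_strong UU vd nd wd.
(* In q(u + d_k) = q(u) + 2 Re <d_k, T u> + <T d_k, d_k> the second term tends to 0 by weak
   convergence, the third because T d_k tends to 0 in norm. The four quarters of eps pay for 1/(k +
   1), twice for the inner product with T u, and once for the last term; the extra 1/4 in [e6]
   compensates |d_k|^2 <= 4. *)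
have Mq : M <= q u.
  apply/ler_addgt0Pr => eps e0.
  have e4 : 0 < eps / 4 by rewrite divr_gt0.
  have e5 : 0 < (eps / 4) ^+ 2 by rewrite exprn_gt0.
  have e6 : 0 < (eps / 4) ^+ 2 / 4 by rewrite divr_gt0.
  have sqle (x : R) : x ^+ 2 <= (eps / 4) ^+ 2 -> x <= eps / 4.
    move=> hx; rewrite real_leNgt ?num_real//; apply/negP => h.
    have : (eps / 4) ^+ 2 < x ^+ 2 by rewrite ltrXn2r ?nnegrE// ltW// (lt_trans e4).
    by rewrite ltNge hx.
  have : \forall k \near U, M <= q u + eps.
    near=> k.
    have h1 : sqn (ip H (d k) (T u)) <= (eps / 4) ^+ 2.
      by near: k; apply: wd => //; exact: vT.
    have h2 : nsq (T (d k)) <= (eps / 4) ^+ 2 / 4 by near: k; exact: Td.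
    have h3 : (k.+1%:R)^-1 <= eps / 4.
      near: k; apply: sU; have := near_infty_natSinv_lt (PosNum e4).
      by apply: filterS => k /ltW.
    have [_ _ h4] := hw k.
    have wE : w k = u + d k by rewrite /d addrC subrK.
    have qE : q (w k) = q u + 2 * complex.Re (ip H (d k) (T u)) + complex.Re (ip H (T (d k)) (d k)).
      rewrite wE; move: (vd k); move: (d k) => dk hd.
      rewrite /q TD// (ipDl hH) ?(ipDr hH); auto.
      rewrite (Tsym hd hu) !ReD (ipC hd (vT hu)) ReJ; ring.
    have h5 := sqle _ (le_trans (sqr_Re_le _) h1).
    have h6 : complex.Re (ip H (T (d k)) (d k)) <= eps / 4.
      apply: sqle; apply: (le_trans (sqr_Re_le _)).
      apply: (le_trans (cauchy_schwarz hH (vT (vd k)) (vd k))).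
      have := nd k; have := hil_ge0 hH (vd k); have := hil_ge0 hH (vT (vd k)).
      rewrite ler_pdivlMr// in h2; nra.
    move: h3 h4 h5 h6; rewrite qE.
    move: (_^-1) (q u) (complex.Re (ip H (d k) (T u))) (complex.Re (ip H (T (d k)) (d k))) e0 => *; lra.
  by move=> /filter_ex[].
exists u.
have TuM : T u = M%:C *: u.
  apply/eqP; rewrite -subr_eq0; apply/eqP/(hil_def hH); auto.
  apply/eqP; rewrite eq_le (hil_ge0 hH) ?andbT; auto.
  rewrite (nsqB hH); auto.
  rewrite (ipZr hH); auto.
  rewrite conjc_real ReZ -/(q u) (nsqZ hH)// sqn_real.
  have := TM _ Wu; nra.
split => //; last by exists M.
apply/eqP; rewrite eq_le nu /=.
have : q u = M * nsq u by rewrite /q TuM (ipZl hH)// ReZ.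
have Mp : 0 < M by rewrite lt_neqAle eq_sym Mn0.
move=> qE; rewrite -(ler_pM2l Mp) mulr1 -qE//.
Unshelve. all: end_near.
Qed.


Let is_eig (u : V) := [/\ vecs H u, nsq u = 1 & exists l : R, T u = l%:C *: u].

(** Every element of [E] has a nonzero inner product with some [b n] of a countable total family,
    and Bessel's inequality allows only finitely many with |<b n, u>|^2 > 1/(m + 1). *)
Lemma orthonormal_countable (E : set V) : (forall u, E u -> vecs H u /\ nsq u = 1) ->
  (forall u v, E u -> E v -> u <> v -> ip H u v = 0) -> countable E.
Proof.
move=> E1 E2.
have [b vb tb] := hil_sep hH.
pose D n m := [set u | E u /\ (m.+1%:R)^-1 < sqn (ip H (b n) u)].
have Dfin n m : finite_set (D n m).
  apply: contrapT => /infinite_set_fset.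
  (* More than |b n|^2 (m + 1) such vectors would contradict Bessel's inequality. *)
  have [k hk] : exists k : nat, nsq (b n) * m.+1%:R < k%:R.
    exists (Num.bound (nsq (b n) * m.+1%:R)); apply: archi_boundP.
    by rewrite mulr_ge0// (hil_ge0 hH).
  move=> /(_ k)[B BD kB].
  pose s := finmap.enum_fset B.
  have us : uniq s by exact: finmap.fset_uniq.
  pose e i := nth 0 s i.
  have eD i : (i < size s)%N -> D n m (e i).
    by move=> si; apply: BD => /=; exact: mem_nth.
  have e0 i : (size s <= i)%N -> e i = 0 by move=> si; rewrite /e nth_default.
  have oe : onsys H e.
    split=> [i|i|i j ij].
    - by have [/e0->//|/eD[/E1[]]] := leqP (size s) i.
    - have [/e0->|/eD[/E1[h1 h2] _]] := leqP (size s) i; first by right.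
      by left; rewrite (ip_nsq hH)// h2.
    - have vj k' : vecs H (e k') by have [/e0->//|/eD[/E1[]]] := leqP (size s) k'.
      have [/e0->|si] := leqP (size s) i; first by rewrite (ip0l hH).
      have [/e0->|sj] := leqP (size s) j; first by rewrite (ip0r hH).
      apply: E2; [by case: (eD _ si)|by case: (eD _ sj)|].
      by move=> /eqP; rewrite /e nth_uniq// (negbTE ij).
  have := bessel hH oe k (vb n).
  have : \sum_(i < k) (m.+1%:R : R)^-1 <= \sum_(i < k) sqn (ip H (b n) (e i)).
    apply: ler_sum => i _; apply: ltW.
    by have [] := eD i (leq_trans (ltn_ord i) kB).
  rewrite sumr_const card_ord -[X in X <= _ -> _]mulr_natl => h1 h2.
  have := le_trans h1 h2; rewrite ler_pdivrMr ?ltr0n// leNgt.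
  by rewrite hk.
have -> : E = \bigcup_n (\bigcup_m (E `&` D n m)).
  apply/seteqP; split => u; last by move=> [n _ [m _ []]].
  move=> Eu; have [hu nu] := E1 _ Eu.
  have [n bn] : exists n, ip H u (b n) != 0.
    apply: contrapT => /forallNP h.
    have u0 : u = 0 by apply: tb => // n; apply/eqP/negPn/negP; exact: h.
    by move: nu; rewrite u0 (nsq0 hH) => /eqP; rewrite eq_sym oner_eq0.
  exists n => //; have s0 : 0 < sqn (ip H (b n) u).
    rewrite (ipC hu (vb n)) sqnJ lt_neqAle sqn_ge0 andbT eq_sym.
    by apply: contra bn => /eqP /sqn_eq0 ->.
  have [m _ hm] := near_infty_natSinv_lt (PosNum s0).
  by exists m => //; split => //; split => //; exact: (hm m (leqnn m)).
apply: bigcup_countable => // n _; apply: bigcup_countable => // m _.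
by apply: finite_set_countable; apply: finite_setIr.
Qed.

(** Zorn's lemma gives a maximal orthonormal set of eigenvectors. It is total: on its orthogonal
    complement, which T preserves by symmetry, [top_eigenvector] would produce one more. An
    injection of this countable set into [nat] turns it into a sequence, with 0 at the indices not
    reached. *)
Theorem spectral_theorem : exists e, exists l : nat -> R, is_onb H e /\
  forall n, T (e n) = (l n)%:C *: e n.
Proof.
pose P := [set E : set V | (forall u, E u -> is_eig u) /\
   forall u v, E u -> E v -> u <> v -> ip H u v = 0].
have [E [[E1 E2] Emax]] : exists E, P E /\ forall B, E `<` B -> ~ P B.
  apply: Zorn_bigcup => F FP Ftot; split.
    by move=> u [X FX Xu]; case: (FP _ FX) => h _; exact: h.
  move=> u v [X FX Xu] [Y FY Yv].
  by case: (Ftot _ _ FX FY) => XY; [case: (FP _ FY) => _|case: (FP _ FX) => _]; apply => //; exact: XY.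
have vE u : E u -> vecs H u by move=> /E1[].
have tot u : vecs H u -> (forall v, E v -> ip H u v = 0) -> u = 0.
  move=> hu h; apply: contrapT => /eqP un0.
  have [||v [[hv vW] nv [l lv]]] := @top_eigenvector E vE.
  - move=> v [hv vE']; split; auto => x Ex; rewrite Tsym//; last exact: vE.
    have [_ _ [l ->]] := E1 _ Ex.
    by rewrite (ipZr hH) ?vE' ?mulr0//; exact: vE.
  - by exists u.
  have nEv : ~ E v.
    move=> Ev; have := vW _ Ev; rewrite (ip_nsq hH)// nv => /eqP.
    by rewrite oner_eq0.
  apply: (Emax (E `|` [set v])).
    by split; [exact: subsetUl|move=> /(_ v) h1; apply: nEv; apply: h1; right].
  split; first by move=> x [/E1//|->]; split => //; exists l.
  move=> x y [Ex|->] [Ey|->] xy.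
  - exact: E2.
  - by rewrite ipC ?vW ?conjc0//; exact: vE.
  - exact: vW.
  - by [].
have /countable_injP[f finj] : countable E.
  by apply: orthonormal_countable => // u /E1[].
pose e n : V := xget 0 [set u | E u /\ f u = n].
have eE n : E (e n) /\ f (e n) = n \/ e n = 0.
  by rewrite /e; case: xgetP => [x _|_]; [left|right].
have fE u : E u -> e (f u) = u.
  move=> Eu; have [[h1 h2]|e0] := eE (f u); first by apply: finj; rewrite ?inE.
  move: e0; rewrite /e; case: xgetP => [x _ [Ex fx] _|/(_ u)/= h]; last by case: h.
  by apply: finj; rewrite ?inE.
have ve n : vecs H (e n) by have [[/vE]|->] := eE n.
have /choice[l hl] : forall n, exists l : R, T (e n) = l%:C *: e n.
  move=> n; have [[/E1[_ _ //]]|->] := eE n.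
  by exists 0; rewrite T0 scaler0.
exists e, l; split => //; split => //.
- move=> n; have [[/E1[h1 h2 _] _]|->] := eE n; last by right.
  by left; rewrite (ip_nsq hH)// h2.
- move=> m n mn; have [[Em fm]|->] := eE m; last by rewrite (ip0l hH).
  have [[En fn]|->] := eE n; last by rewrite (ip0r hH).
  apply: E2 => // emn; move/eqP: mn; apply.
  by rewrite -fm -fn emn.
- move=> u hu h; apply: tot => // v Ev.
  by rewrite -(fE _ Ev).
Qed.

End Operator.
End Spectral.

(** * Functional calculus and traces of diagonal operators *)

Section Weierstrass.
Context {R : realType}.
Implicit Types (f phi : R -> R) (x : R).

(** Counterexamples for d = 1/(k + 1) would converge along an ultrafilter to a common point, against
    continuity there. *)
Lemma uniform_continuity f (L : R) : continuous f -> forall eps : R, 0 < eps ->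
  exists2 d : R, 0 < d & forall x y, 0 <= x <= L -> 0 <= y <= L ->
    `|x - y| <= d -> `|f x - f y| <= eps.
Proof.
move=> cf eps e0; apply: contrapT => H.
have /choice[w hw] : forall k : nat, exists w : R * R, [/\ 0 <= w.1 <= L, 0 <= w.2 <= L,
    `|w.1 - w.2| <= (k.+1%:R)^-1 & eps < `|f w.1 - f w.2|].
  move=> k; apply: contrapT => Hk; apply: H.
  exists (k.+1%:R)^-1; first by rewrite invr_gt0.
  move=> x y hx hy xy; rewrite leNgt; apply/negP => h.
  by apply: Hk; exists (x, y).
have [U [UU sU]] := ultraFilterLemma eventually_filter.
have bd (x : R) : 0 <= x <= L -> `|x| <= L by move=> /andP[x0 xL]; rewrite ger0_norm.
have [|x hx] := @ultra_cvg_bounded R _ U (fun k => (w k).1) L UU.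
  by move=> k; apply: bd; case: (hw k).
have hy : (w k).2 @[k --> U] --> x.
  have -> : (fun k => (w k).2) = (fun k => (w k).1 - ((w k).1 - (w k).2)).
    by apply/funext => k; rewrite opprB addrC subrK.
  rewrite -[X in _ --> X]subr0; apply: cvgB => //.
  apply/cvgrPdist_le => d d0; apply: sU.
  have := near_infty_natSinv_lt (PosNum d0); apply: filterS => k /ltW h.
  by rewrite sub0r normrN; apply: le_trans h; case: (hw k).
have h : `|f (w k).1 - f (w k).2| @[k --> U] --> (0 : R).
  rewrite -(normr0 R) -(subrr (f x)); apply: cvg_norm; apply: cvgB.
  - exact: (cvg_comp _ _ hx (cf x)).
  - exact: (cvg_comp _ _ hy (cf x)).
have : eps <= 0.
  rewrite -(cvg_lim (@Rhausdorff R) h); apply: limr_ge; first by apply/cvg_ex; exists 0.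
  by apply: nearW => k; apply: ltW; case: (hw k).
by rewrite leNgt e0.
Qed.

(* The expectation of phi (k + i) for k binomial with parameters n and x. *)
Fixpoint bernstein n (phi : nat -> R) : {poly R} :=
  if n is m.+1 then (1 - 'X) * bernstein m phi + 'X * bernstein m (phi \o S)
  else (phi 0%N)%:P.

Lemma bernsteinS n (phi : nat -> R) x : (bernstein n.+1 phi).[x] =
  (1 - x) * (bernstein n phi).[x] + x * (bernstein n (phi \o S)).[x].
Proof. by rewrite /= !hornerE. Qed.

Lemma bernstein_le n (phi chi : nat -> R) x : 0 <= x <= 1 ->
  (forall k, (k <= n)%N -> phi k <= chi k) -> (bernstein n phi).[x] <= (bernstein n chi).[x].
Proof.
move=> /andP[x0 x1]; elim: n phi chi => [|n IH] phi chi h; first by rewrite /= !hornerC h.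
rewrite !bernsteinS lerD// ler_wpM2l ?subr_ge0//; apply: IH => k kn /=; apply: h => //.
exact: leqW.
Qed.

Lemma bernstein_lin n (a b : R) (phi chi : nat -> R) x :
  (bernstein n (fun k => a * phi k + b * chi k)).[x] =
  a * (bernstein n phi).[x] + b * (bernstein n chi).[x].
Proof.
elim: n phi chi => [|n IH] phi chi; first by rewrite /= !hornerC.
by rewrite !bernsteinS /comp /= !IH; ring.
Qed.

Lemma bernstein1 n x : (bernstein n (fun=> 1)).[x] = 1.
Proof. by elim: n => [|n IH]; rewrite ?bernsteinS /comp ?IH /= ?hornerC//; ring. Qed.

Lemma bernstein_id n x : (bernstein n (fun k => k%:R)).[x] = n%:R * x.
Proof.
elim: n => [|n IH]; first by rewrite /= hornerC mul0r.
rewrite bernsteinS /comp IH.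
have -> : (fun k => k.+1%:R) = (fun k : nat => 1 * k%:R + 1 * 1 :> R).
  by apply/funext => k; rewrite mul1r mulr1 -natr1.
by rewrite bernstein_lin bernstein1 IH -natr1; ring.
Qed.

Lemma bernstein_sqr n x : (bernstein n (fun k => k%:R ^+ 2)).[x] =
  n%:R * x * (1 - x) + (n%:R * x) ^+ 2.
Proof.
elim: n => [|n IH]; first by rewrite /= hornerC; ring.
rewrite bernsteinS /comp IH.
have -> : (fun k => k.+1%:R ^+ 2) = (fun k : nat => 1 * (k%:R ^+ 2) + 1 * (2 * k%:R + 1 * 1) :> R).
  by apply/funext => k; rewrite -natr1; ring.
by rewrite bernstein_lin IH bernstein_lin bernstein1 bernstein_id -natr1; ring.
Qed.

(** Bernstein's proof: |f(k/n) - f(x)| <= eps/2 + K (k/n - x)^2 for all k, by uniform continuity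
    near x and by the bound 2 M away from it; the expectation of the right-hand side involves only
    the binomial variance x (1 - x) / n. *)
Lemma weierstrass01 f : continuous f -> forall eps : R, 0 < eps ->
  exists p : {poly R}, forall x, 0 <= x <= 1 -> `|p.[x] - f x| <= eps.
Proof.
move=> cf eps e0.
have e2 : 0 < eps / 2 by rewrite divr_gt0.
have [d d0 hd] := uniform_continuity 1 cf e2.
have [M M0 hM] : exists2 M : R, 0 <= M & forall x, 0 <= x <= 1 -> `|f x| <= M.
  have [c _ hc] : exists2 c, c \in `[0, 1]%R & forall t, t \in `[0, 1]%R -> `|f t| <= `|f c|.
    apply: (@EVT_max R (fun x => `|f x|)) => //; apply: continuous_subspaceT => x.
    by apply: cvg_norm; exact: cf.
  by exists `|f c| => // x hx; apply: hc; rewrite in_itv.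
have d2 : 0 < d ^+ 2 by rewrite exprn_gt0.
pose K := 2 * M / d ^+ 2.
have K0 : 0 <= K by rewrite /K divr_ge0 ?mulr_ge0// ltW.
have [n hn] : exists n : nat, K / (eps / 2) < n.+1%:R.
  exists (Num.bound (K / (eps / 2))); apply: lt_trans (_ : (Num.bound (K / (eps / 2)))%:R < _).
    by apply: archi_boundP; rewrite divr_ge0// ltW.
  by rewrite ltr_nat.
have n0 : (0 : R) < n.+1%:R by rewrite ltr0n.
pose phi (k : nat) := f (k%:R / n.+1%:R).
exists (bernstein n.+1 phi) => x hx.
have key k : (k <= n.+1)%N -> `|phi k - f x| <= eps / 2 + K * (k%:R / n.+1%:R - x) ^+ 2.
  move=> kn; have hk : 0 <= (k%:R / n.+1%:R : R) <= 1.
    by rewrite divr_ge0//= ler_pdivrMr// mul1r ler_nat.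
  have [h|h] := leP `|k%:R / n.+1%:R - x| d.
    apply: (le_trans (hd _ _ hk hx h)); rewrite lerDl mulr_ge0// sqr_ge0//.
  have h2 : d ^+ 2 <= (k%:R / n.+1%:R - x) ^+ 2.
    by rewrite -(real_normK (num_real (_ - x))) ler_sqr ?nnegrE// ltW.
  apply: le_trans (_ : 2 * M <= _).
    apply: (le_trans (ler_normB _ _)); have := hM _ hk; have := hM _ hx; rewrite -/(phi k); lra.
  have : 2 * M <= K * (k%:R / n.+1%:R - x) ^+ 2.
    rewrite -[leLHS](@divfK _ (d ^+ 2)) ?gt_eqF//; exact: ler_wpM2l.
  by move=> h3; apply: (le_trans h3); rewrite lerDr ltW.
have var : (bernstein n.+1 (fun k => eps / 2 + K * (k%:R / n.+1%:R - x) ^+ 2)).[x] <= eps.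
  have -> : (fun k => eps / 2 + K * (k%:R / n.+1%:R - x) ^+ 2) =
      (fun k : nat => (eps / 2 + K * x ^+ 2) * 1 + 1 * ((K / n.+1%:R ^+ 2) * (k%:R ^+ 2) + (- 2 * K * x / n.+1%:R) * k%:R)).
    by apply/funext => k; field; rewrite -?natr1 gt_eqF.
  rewrite bernstein_lin bernstein1 bernstein_lin bernstein_sqr bernstein_id.
  have -> : (eps / 2 + K * x ^+ 2) * 1 + 1 * (K / n.+1%:R ^+ 2 * (n.+1%:R * x * (1 - x) + (n.+1%:R * x) ^+ 2) +
     - 2 * K * x / n.+1%:R * (n.+1%:R * x)) = eps / 2 + K * (x * (1 - x)) / n.+1%:R.
    by field; rewrite -?natr1 gt_eqF.
  rewrite [leRHS]splitr lerD2l ler_pdivrMr//.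
  rewrite ltr_pdivrMr// mulrC in hn.
  apply: le_trans (ltW hn); rewrite -[leRHS]mulr1 ler_wpM2l//.
  case/andP: hx => x0 x1; nra.
have E : (bernstein n.+1 phi).[x] - f x = (bernstein n.+1 (fun k => 1 * phi k + (- f x) * 1)).[x].
  by rewrite bernstein_lin bernstein1; ring.
rewrite ler_norml; apply/andP; split.
  have h := bernstein_lin n.+1 (-1) 0 (fun k => eps / 2 + K * (k%:R / n.+1%:R - x) ^+ 2) (fun=> 1) x.
  rewrite [X in _ = _ + X]mul0r [RHS]addr0 in h.
  apply: (@le_trans _ _ (-1 * (bernstein n.+1 (fun k => eps / 2 + K * (k%:R / n.+1%:R - x) ^+ 2)).[x])); first by rewrite mulN1r lerN2.
  rewrite -h E; apply: bernstein_le => // k kn.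
  by have := key k kn; rewrite ler_norml mulN1r mul0r addr0 mul1r mulr1 => /andP[].
apply: le_trans var; rewrite E; apply: bernstein_le => // k kn.
by have := key k kn; rewrite ler_norml mul1r mulr1 => /andP[].
Qed.

Lemma weierstrass f (L : R) : 0 < L -> continuous f -> forall eps : R, 0 < eps ->
  exists p : {poly R}, forall x, 0 <= x <= L -> `|p.[x] - f x| <= eps.
Proof.
move=> L0 cf eps e0.
have [|p hp] := @weierstrass01 (fun x => f (L * x)) _ _ e0.
  by move=> x; apply: (cvg_comp (fun x => L * x) f); [exact: mulrl_continuous|exact: cf].
exists (p \Po (L^-1 *: 'X)) => x /andP[x0 xL].
rewrite horner_comp !hornerE.
have := hp (L^-1 * x); rewrite mulVKf ?gt_eqF//; apply.
by rewrite mulr_ge0 ?invr_ge0 ?(ltW L0)//= mulrC ler_pdivrMr// mul1r.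
Qed.

End Weierstrass.

Lemma conjcZ {R : realType} (a : R) (z : R[i]) : conjc (a%:C * z) = a%:C * conjc z.
Proof. by case: z => b c; apply: complex_eq; rewrite /=; ring. Qed.

Lemma sqr_le_norm {R : realType} (x y : R) : 0 <= y -> x ^+ 2 <= y ^+ 2 -> `|x| <= y.
Proof. by move=> y0; rewrite -(real_normK (num_real x)) ler_sqr ?nnegrE. Qed.

(** * Operators diagonal in an orthonormal basis *)

Section DiagonalOperators.
Context {R : realType} {V : lmodType R[i]} (H : ipspace V).
Hypothesis hH : is_hilbert H.
Local Notation C := R[i].
Local Notation nsq := (nsq H).
Implicit Types (u v w : V) (A B : V -> V) (m : nat -> R).

Let v0 := hil_0 hH.
Let ipC := hil_ipC hH.
Let vZ := vecsZ hH.
Let vD := vecsD hH.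
Let vB := vecsB hH.
Hint Resolve v0 vZ vD vB : core.

Lemma hnorm_le (c : R) u v : vecs H u -> vecs H v -> 0 <= c ->
  (hnorm H u <= c * hnorm H v) = (nsq u <= c ^+ 2 * nsq v).
Proof.
move=> hu hv c0; rewrite /hnorm -[complex.Re (ip H u u)]/(nsq u) -[complex.Re (ip H v v)]/(nsq v).
have nu := hil_ge0 hH hu; have nv := hil_ge0 hH hv.
by rewrite -[RHS]ler_sqrt ?mulr_ge0 ?sqr_ge0// sqrtrM ?sqr_ge0// sqrtr_sqr ger0_norm.
Qed.

Variable e : nat -> V.
Hypothesis he : is_onb H e.
Let ve n : vecs H (e n). Proof. by case: he. Qed.
Hint Resolve ve : core.
Let oe := onb_onsys he.

(** Diagonality is expressed by coefficients, which determine a vector. Where [e n = 0] the entry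
    [m n] is unconstrained; hence the side conditions [e n = 0 -> m n = 0] in what follows. *)
Definition has_diag A m := forall u, vecs H u ->
  vecs H (A u) /\ forall n, ip H (A u) (e n) = (m n)%:C * ip H u (e n).

Lemma has_diag_vecs A m u : has_diag A m -> vecs H u -> vecs H (A u).
Proof. by move=> h /h[]. Qed.

Lemma has_diag_ip A m u n : has_diag A m -> vecs H u ->
  ip H (A u) (e n) = (m n)%:C * ip H u (e n).
Proof. by move=> h /h[_]; exact. Qed.

Definition diagop m : V -> V := fun u =>
  xget 0 [set w | vecs H w /\ forall n, ip H w (e n) = (m n)%:C * ip H u (e n)].

Lemma diagopP m (M : R) : (forall n, `|m n| <= M) -> has_diag (diagop m) m.
Proof.
move=> mM u hu; rewrite /diagop; case: xgetP => [w _ [] //|h].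
exfalso.
have M0 : 0 <= M by exact: le_trans (mM 0%N).
have [||w [hw wu _]] := @riesz_fischer R V H hH e oe (fun n => (m n)%:C * ip H u (e n)) (M ^+ 2 * nsq u).
- by move=> k; rewrite -mulrA (onsys_ip_diag hH).
- move=> n; apply: le_trans (_ : \sum_(k < n) M ^+ 2 * sqn (ip H u (e k)) <= _).
    apply: ler_sum => k _; rewrite sqnM sqn_real ler_wpM2r ?sqn_ge0//.
    by rewrite -(real_normK (num_real (m k))) ler_sqr ?nnegrE.
  rewrite -mulr_sumr ler_wpM2l ?sqr_ge0//; exact: (bessel hH).
by apply: (h w); split.
Qed.

Lemma has_diag_nsq A m (M : R) u : has_diag A m -> vecs H u ->
  (forall n, e n = 0 \/ `|m n| <= M) -> nsq (A u) <= M ^+ 2 * nsq u.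
Proof.
move=> hA hu mM.
have P := parseval hH he (has_diag_vecs hA hu).
rewrite -(cvg_lim (@Rhausdorff R) P); apply: limr_le; first by apply/cvg_ex; exists (nsq (A u)).
apply: nearW => n; apply: le_trans (_ : \sum_(k < n) M ^+ 2 * sqn (ip H u (e k)) <= _).
  apply: ler_sum => k _; rewrite (has_diag_ip _ hA hu) sqnM sqn_real.
  have [->|mk] := mM k; first by rewrite (ip0r hH)// sqn0 !mulr0.
  rewrite ler_wpM2r ?sqn_ge0//.
  have M0 : 0 <= M by exact: le_trans mk.
  by rewrite -(real_normK (num_real (m k))) ler_sqr ?nnegrE.
rewrite -mulr_sumr ler_wpM2l ?sqr_ge0//; exact: (bessel hH).
Qed.

Lemma has_diag_bounded A m (M : R) : has_diag A m -> (forall n, `|m n| <= M) -> is_bounded_op H A.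
Proof.
move=> hA mM; have M0 : 0 <= M by exact: le_trans (mM 0%N).
have hv u : vecs H u -> vecs H (A u) by apply: has_diag_vecs hA.
split=> [u|c u v hu hv'|]; first exact: hv.
  apply: (onb_eq hH he); auto => n.
  rewrite (has_diag_ip _ hA); auto.
  rewrite !(ipDl hH) ?(ipZl hH); auto.
  by rewrite !(has_diag_ip _ hA)//; ring.
exists M => u hu; rewrite hnorm_le; auto.
by apply: has_diag_nsq hA hu _ => n; right.
Qed.

Lemma has_diag_sym A m u v : has_diag A m -> vecs H u -> vecs H v ->
  ip H (A u) v = ip H u (A v).
Proof.
move=> hA hu hv; have [hAu hAv] := (has_diag_vecs hA hu, has_diag_vecs hA hv).
apply: (parseval_eq hH he) => // k.
by rewrite !(has_diag_ip _ hA)// conjcZ; ring.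
Qed.

Lemma has_diag_quad A m u : has_diag A m -> vecs H u ->
  (fun n => \sum_(k < n) m k * sqn (ip H u (e k))) @ \oo --> complex.Re (ip H (A u) u).
Proof.
move=> hA hu; have hAu := has_diag_vecs hA hu.
apply/cvgrPdist_le => eps e0.
have e2 : 0 < eps ^+ 2 by rewrite exprn_gt0.
have [N hN] := parseval_ip hH he hAu hu e2.
exists N => // n /= Nn.
apply: sqr_le_norm; first exact: ltW.
apply: le_trans (hN n Nn); apply: le_trans (sqr_Re_le _).
rewrite ReD ReN (Re_sum _ (fun k => ip H (A u) (e k) * conjc (ip H u (e k)))).
rewrite [leLHS](_ : _ = (complex.Re (ip H (A u) u) - \sum_(k < n) complex.Re (ip H (A u) (e k) * conjc (ip H u (e k)))) ^+ 2)//.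
congr ((_ - _) ^+ 2); apply: eq_bigr => k _.
by rewrite (has_diag_ip _ hA)// -mulrA sqnE ReZ.
Qed.

Lemma has_diag_real A m u : has_diag A m -> vecs H u ->
  ip H (A u) u = (complex.Re (ip H (A u) u))%:C.
Proof.
move=> hA hu; apply: complex_eq => //=.
have := has_diag_sym hA hu hu; rewrite (ipC (has_diag_vecs hA hu) hu).
by move=> /(congr1 (@complex.Im _)); rewrite ImJ; lra.
Qed.

Lemma has_diag_ge0 A m u : has_diag A m -> (forall n, 0 <= m n) -> vecs H u ->
  0 <= complex.Re (ip H (A u) u).
Proof.
move=> hA m0 hu; have P := has_diag_quad hA hu.
rewrite -(cvg_lim (@Rhausdorff R) P); apply: limr_ge.
  by apply/cvg_ex; exists (complex.Re (ip H (A u) u)).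
by apply: nearW => n; apply: sumr_ge0 => k _; rewrite mulr_ge0// sqn_ge0.
Qed.

Lemma has_diag_positive A m (M : R) : has_diag A m -> (forall n, 0 <= m n <= M) ->
  is_positive_op H A.
Proof.
move=> hA mM; split.
- by apply: (has_diag_bounded hA (M := M)) => n; case/andP: (mM n) => m0 m1; rewrite ger0_norm.
- by move=> u v; exact: has_diag_sym hA.
- move=> u hu; rewrite (has_diag_real hA hu) ler0c; apply: has_diag_ge0 hA _ hu.
  by move=> n; case/andP: (mM n).
Qed.

Lemma has_diag_comp A B m m' : has_diag A m -> has_diag B m' ->
  has_diag (A \o B) (fun n => m n * m' n).
Proof.
move=> hA hB u hu; have hBu := has_diag_vecs hB hu.
split=> [|n] /=; first exact: has_diag_vecs hA hBu.
by rewrite (has_diag_ip _ hA)// (has_diag_ip _ hB)// mulrA rmorphM.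
Qed.

Lemma has_diag_abs A B m : has_diag A m -> has_diag B (fun n => `|m n|) ->
  forall u v, vecs H u -> vecs H v -> ip H (B u) (B v) = ip H (A u) (A v).
Proof.
move=> hA hB u v hu hv.
apply: (parseval_eq hH he); [exact: has_diag_vecs hB _|exact: has_diag_vecs hB _|exact: has_diag_vecs hA _|exact: has_diag_vecs hA _|].
move=> k; rewrite !(has_diag_ip _ hA)// !(has_diag_ip _ hB)// !conjcZ.
rewrite mulrACA [RHS]mulrACA -!rmorphM /=; congr (_%:C * _).
by rewrite -normrM ger0_norm// -expr2 sqr_ge0.
Qed.

Lemma has_diag_iter A m k : has_diag A m -> has_diag (iter k A) (fun n => m n ^+ k).
Proof.
move=> hA; elim: k => [|k IH] u hu /=; first by split => // n; rewrite expr0 mul1r.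
split=> [|n]; first by apply: has_diag_vecs hA _; exact: has_diag_vecs IH _.
rewrite (has_diag_ip _ hA); last exact: has_diag_vecs IH _.
by rewrite (has_diag_ip _ IH)// exprS rmorphM mulrA.
Qed.

Lemma has_diag_poly A m (p : {poly R}) : has_diag A m -> has_diag (poly_op p A) (fun n => p.[m n]).
Proof.
move=> hA u hu.
have hi k := has_diag_iter k hA.
have hvi k : vecs H (iter k A u) by exact: has_diag_vecs (hi k) hu.
rewrite /poly_op; split=> [|n].
  by apply: (vecs_sum hH _ (F := fun k => (p`_k)%:C *: iter k A u)) => k; auto.
rewrite (ip_suml hH _ (F := fun k => (p`_k)%:C *: iter k A u))//; last by move=> k; auto.
rewrite horner_coef rmorph_sum /= mulr_suml; apply: eq_bigr => k _.
by rewrite (ipZl hH)// (has_diag_ip _ (hi k))// rmorphM mulrA.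
Qed.


Section Calculus.
Variables (T : V -> V) (l : nat -> R) (L : R).
Hypothesis hT : has_diag T l.
Hypothesis l0 : forall n, 0 <= l n.
Hypothesis lL : forall n, l n <= L.
Hypothesis el : forall n, e n = 0 -> l n = 0.

Let hnorm_ge0 u : 0 <= hnorm H u. Proof. exact: sqrtr_ge0. Qed.

Lemma opnorm_has_sup : has_sup [set hnorm H (T u) | u in [set u | vecs H u /\ hnorm H u <= 1]].
Proof.
have h0 : hnorm H 0 = 0 by rewrite /hnorm -[complex.Re _]/(nsq 0) (nsq0 hH) sqrtr0.
split; first by exists (hnorm H (T 0)), 0 => //; split => //; rewrite h0 ler01.
exists L => _ [u [hu u1] <-].
have L0 : 0 <= L by exact: le_trans (lL 0%N).
apply: le_trans (_ : L * hnorm H u <= _); last by rewrite -[leRHS]mulr1 ler_wpM2l.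
rewrite hnorm_le//; last exact: has_diag_vecs hT hu.
by apply: has_diag_nsq hT hu _ => n; right; rewrite ger0_norm.
Qed.

(** The functional calculus tests polynomials only on [[0, opnorm H T]], so every entry has to lie
    there. At a zero basis vector the convention [l n = 0] ensures it. *)
Lemma opnorm_ge n : 0 <= l n <= opnorm H T.
Proof.
rewrite l0 /=.
have ub u : vecs H u -> hnorm H u <= 1 -> hnorm H (T u) <= opnorm H T.
  by move=> hu u1; apply: sup_ubound; [case: opnorm_has_sup|exists u].
case: oe => _ /(_ n)[en|en] _; last first.
  rewrite el//; apply: le_trans (hnorm_ge0 (T 0)) (ub _ v0 _).
  by rewrite /hnorm -[complex.Re _]/(nsq 0) (nsq0 hH) sqrtr0 ler01.
have n1 : nsq (e n) = 1 by rewrite /nsq en.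
have := ub _ (ve n); rewrite /hnorm -[complex.Re (ip H (e n) (e n))]/(nsq (e n)) n1 sqrtr1 lexx => /(_ isT).
apply: le_trans; rewrite -[leLHS]ger0_norm// -sqrtr_sqr ler_wsqrtr//.
have hTe : vecs H (T (e n)) by exact: has_diag_vecs hT _.
have := cauchy_schwarz hH hTe (ve n); rewrite (has_diag_ip _ hT)// sqnM sqn_real en.
by rewrite (_ : 1 = 1%:C)// sqn_real expr1n n1 !mulr1.
Qed.

Variable psi psi0 : R -> R.
Hypothesis psi0_cont : continuous psi0.
Hypothesis psi0E : forall t, 0 <= t -> psi0 t = psi t.

(** [psi0] is a continuous function on the whole line that extends [psi] from the half-line; the
    extreme value theorem and [weierstrass] are applied to it. *)
Lemma psi_bounded : exists2 K : R, 0 <= K & forall n, `|psi (l n)| <= K.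
Proof.
have L0 : 0 <= L by exact: le_trans (lL 0%N).
have [c _ hc] : exists2 c, c \in `[0, L]%R & forall t, t \in `[0, L]%R -> `|psi0 t| <= `|psi0 c|.
  apply: (@EVT_max R (fun x => `|psi0 x|)) => //; apply: continuous_subspaceT => x.
  by apply: cvg_norm; exact: psi0_cont.
by exists `|psi0 c| => // n; rewrite -psi0E//; apply: hc; rewrite in_itv /= l0 lL.
Qed.

(** [fcalc] picks some operator with the approximation property. The diagonal operator D has it, by
    Weierstrass, and any other one agrees with D on vectors: both are within eps |u| of p(T) u for
    the same polynomial p. *)
Lemma fcalc_has_diag : has_diag (fcalc H psi T) (fun n => psi (l n)).
Proof.
have [K K0 hK] := psi_bounded.
have hD := diagopP hK.
set D := diagop _ in hD.
have approx (p : {poly R}) (eps : R) u : 0 <= eps ->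
    (forall t, 0 <= t <= opnorm H T -> `|p.[t] - psi t| <= eps) ->
    vecs H u -> hnorm H (poly_op p T u - D u) <= eps * hnorm H u.
  move=> e0 hp hu; have hP := has_diag_poly p hT.
  have hB : has_diag (fun u => poly_op p T u - D u) (fun n => p.[l n] - psi (l n)).
    move=> v hv; have [hPv hDv] := (has_diag_vecs hP hv, has_diag_vecs hD hv).
    split=> [|n]; first by auto.
    by rewrite (ipBl hH)// (has_diag_ip _ hP)// (has_diag_ip _ hD)// rmorphB mulrBl.
  rewrite hnorm_le//; last exact: has_diag_vecs hB hu.
  by apply: has_diag_nsq hB hu _ => n; right; apply: hp; exact: opnorm_ge.
have hDin : (forall u, vecs H u -> vecs H (D u)) /\
    forall eps : R, 0 < eps -> exists p : {poly R},
      (forall t, 0 <= t <= opnorm H T -> `|p.[t] - psi t| <= eps) /\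
      (forall u, vecs H u -> hnorm H (poly_op p T u - D u) <= eps * hnorm H u).
  split=> [u|eps e0]; first exact: has_diag_vecs hD.
  have o0 : 0 <= opnorm H T by have /andP[h1 h2] := opnorm_ge 0; exact: le_trans h2.
  (* The interval is enlarged to length ||T|| + 1, which is positive even when T = 0. *)
  have [p hp] := weierstrass (ltr_wpDl o0 ltr01) psi0_cont e0.
  have hp' t : 0 <= t <= opnorm H T -> `|p.[t] - psi t| <= eps.
    move=> /andP[t0 to]; rewrite -psi0E//; apply: hp; rewrite t0 /=.
    by rewrite (le_trans to)// lerDl.
  by exists p; split => // u hu; apply: approx => //; exact: ltW.
suff S_eq S : ((forall u, vecs H u -> vecs H (S u)) /\
    forall eps : R, 0 < eps -> exists p : {poly R},
      (forall t, 0 <= t <= opnorm H T -> `|p.[t] - psi t| <= eps) /\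
      (forall u, vecs H u -> hnorm H (poly_op p T u - S u) <= eps * hnorm H u)) ->
    has_diag S (fun n => psi (l n)).
  by rewrite /fcalc; case: xgetP => [S _ /S_eq//|/(_ D)/= h]; case: h.
move=> [vS hS] u hu; suff -> : S u = D u by exact: hD.
have [hSu hDu] := (vS _ hu, has_diag_vecs hD hu).
apply/eqP; rewrite -subr_eq0; apply/eqP/(hil_def hH); auto.
apply/eqP; rewrite eq_le (hil_ge0 hH) ?andbT; auto.
apply/ler_addgt0Pl => eps e0; rewrite addr0.
have nu := hil_ge0 hH hu.
have e1 : 0 < eps / 4 / (nsq u + 1) by rewrite !divr_gt0// ltr_wpDl.
have e2 : 0 < Num.sqrt (eps / 4 / (nsq u + 1)) by rewrite sqrtr_gt0.
have [p [hp1 hp2]] := hS _ e2.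
have hPu := has_diag_vecs (has_diag_poly p hT) hu.
have := hp2 _ hu; have := approx _ _ _ (ltW e2) hp1 hu.
rewrite !hnorm_le; auto.
rewrite (sqr_sqrtr (ltW e1)) => h1 h2.
have -> : S u - D u = (poly_op p T u - D u) - (poly_op p T u - S u).
  by rewrite opprB [RHS]addrC addrA subrK.
apply: le_trans (nsqD_le hH _ _) _; auto; first by apply: (vecsN hH); auto.
rewrite (nsqN hH); auto.
have : eps / 4 / (nsq u + 1) * nsq u <= eps / 4.
  by rewrite mulrAC ler_pdivrMr ?ltr_wpDl//; nra.
by lra.
Qed.

End Calculus.

Section Trace.
Variables (A : V -> V) (m : nat -> R).
Hypothesis hA : has_diag A m.
Hypothesis em : forall n, e n = 0 -> m n = 0.

(** Expanding <A f_k, f_k> = sum_n m_n |<f_k, e_n>|^2 and exchanging the nonnegative sums, Parseval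
    in the basis f leaves sum_n m_n |e_n|^2; [em] handles the indices with e_n = 0. Extended real
    values spare any discussion of summability. *)
Lemma trace_nneseries f : (forall n, 0 <= m n) -> is_onb H f ->
  (\sum_(0 <= k <oo) (complex.Re (ip H (A (f k)) (f k)))%:E = \sum_(0 <= n <oo) (m n)%:E)%E.
Proof.
move=> m0 hf.
have vf k : vecs H (f k) by case: hf.
have -> : (\sum_(0 <= k <oo) (complex.Re (ip H (A (f k)) (f k)))%:E =
    \sum_(0 <= k <oo) \sum_(0 <= n <oo) (m n * sqn (ip H (f k) (e n)))%:E)%E.
  apply: eq_eseriesr => k _; apply/esym/cvg_lim => //.
  under eq_fun do rewrite big_mkord sumEFin.
  by apply: cvg_EFin; [exact: nearW|exact: has_diag_quad].
rewrite nneseries_interchange; last by move=> k n; rewrite lee_fin mulr_ge0// sqn_ge0.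
apply: eq_eseriesr => n _.
under eq_eseriesr do rewrite EFinM.
rewrite nneseriesZl; last by move=> k _; rewrite lee_fin sqn_ge0.
have -> : (\sum_(0 <= k <oo) (sqn (ip H (f k) (e n)))%:E = (nsq (e n))%:E)%E.
  apply/cvg_lim => //; under eq_fun do rewrite big_mkord sumEFin.
  apply: cvg_EFin; first exact: nearW.
  have := parseval hH hf (ve n).
  by under eq_fun do under eq_bigr do rewrite (ipC (vf _) (ve n)) sqnJ.
case: oe => _ /(_ n)[en|en] _; last by rewrite em// mul0e.
by rewrite -EFinM /nsq en /= mulr1.
Qed.

Lemma trace_series f (s : R) : (forall n, 0 <= m n) -> is_onb H f ->
  series m @ \oo --> s ->
  series (fun n => complex.Re (ip H (A (f n)) (f n))) @ \oo --> s.
Proof.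
move=> m0 hf ms.
have vf k : vecs H (f k) by case: hf.
have E := trace_nneseries m0 hf.
have Es : (\sum_(0 <= n <oo) (m n)%:E = s%:E)%E.
  apply/cvg_lim => //; under eq_fun do rewrite sumEFin.
  by apply: cvg_EFin; [exact: nearW|exact: ms].
have nn k : (0 <= (complex.Re (ip H (A (f k)) (f k)))%:E)%E.
  by rewrite lee_fin; apply: has_diag_ge0 hA m0 (vf k).
have := is_cvg_nneseries (u_ := fun k => (complex.Re (ip H (A (f k)) (f k)))%:E) (P := xpredT) (N := 0).
move=> /(_ (fun k _ _ => nn k)) /cvg_ex[x hx].
have xs : x = s%:E by rewrite -Es -E; apply/esym/cvg_lim.
move: hx; rewrite xs; under eq_fun do rewrite sumEFin.
by move=> /fine_cvgP[_].
Qed.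

End Trace.

Lemma cvg_real_complex (U : Type) (G : set_system U) {FG : Filter G}
    (F : U -> R) (s : R) : F @ G --> s -> ((fun n => (F n)%:C) : U -> R[i]^o) @ G --> (s%:C : R[i]^o).
Proof.
move=> Fs; apply/cvgrPdist_le => -[a b] /=; rewrite ltcE /= => /andP[/eqP -> a0].
have /cvgrPdist_le /(_ _ a0) := Fs; apply: filterS => n h.
by rewrite -rmorphB /= normc_def /= expr0n addr0 sqrtr_sqr lecR.
Qed.

(** Basis independence is available for nonnegative entries only, so A is written as B - N, where B
    = |A| has the entries |m_n| and N the entries |m_n| - m_n. *)
Theorem diag_trace A m (M s s1 : R) : has_diag A m -> (forall n, `|m n| <= M) ->
  (forall n, e n = 0 -> m n = 0) ->
  series (fun n => `|m n|) @ \oo --> s1 -> series m @ \oo --> s ->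
  trace_class H A /\ trace H A = s%:C.
Proof.
move=> hA mM em ms1 ms.
have hB := @diagopP (fun n => `|m n|) M (fun n => ltac:(rewrite normr_id; exact: mM)).
set B := diagop _ in hB.
have emB n : e n = 0 -> `|m n| = 0 by move=> /em ->; rewrite normr0.
split.
  split; first exact: has_diag_bounded hA mM.
  exists B; split.
    split; first by apply: (has_diag_positive hB (M := M)) => n; rewrite normr_ge0 mM.
    exact: has_diag_abs hA hB.
  move=> f hf; apply/cvg_ex; exists s1.
  exact: (trace_series hB emB _ hf ms1).
have trA f : is_onb H f ->
    (series (fun n => ip H (A (f n)) (f n)) : nat -> R[i]^o) @ \oo --> (s%:C : R[i]^o).
  move=> hf; have vf k : vecs H (f k) by case: hf.
  pose N := diagop (fun n => `|m n| - m n).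
  have bN n : `| `|m n| - m n | <= 2 * M.
    by apply: (le_trans (ler_normB _ _)); rewrite normr_id; have := mM n; lra.
  have hN : has_diag N _ := diagopP bN.
  have tB := trace_series hB emB (fun n => normr_ge0 _) hf ms1.
  have tN : series (fun n => complex.Re (ip H (N (f n)) (f n))) @ \oo --> s1 - s.
    apply: (trace_series hN) => //.
    - by move=> n /em ->; rewrite normr0 subr0.
    - by move=> n; rewrite subr_ge0 ler_norm.
    - rewrite (_ : series _ = series (fun n => `|m n|) - series m); first exact: cvgB.
      by apply/funext => n; rewrite /series /= fctE sumrB.
  have E n : ip H (A (f n)) (f n) =
      (complex.Re (ip H (B (f n)) (f n)) - complex.Re (ip H (N (f n)) (f n)))%:C.
    rewrite rmorphB /= -(has_diag_real hB)// -(has_diag_real hN)//.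
    rewrite -(ipBl hH)//; [|exact: has_diag_vecs hB _|exact: has_diag_vecs hN _].
    congr (ip H _ _); apply: (onb_eq hH he).
    - exact: has_diag_vecs hA _.
    - by apply: vB; [exact: has_diag_vecs hB _|exact: has_diag_vecs hN _].
    - move=> k; rewrite (ipBl hH)//; [|exact: has_diag_vecs hB _|exact: has_diag_vecs hN _].
      by rewrite (has_diag_ip _ hA)// (has_diag_ip _ hB)// (has_diag_ip _ hN)// rmorphB; ring.
  have -> : series (fun n => ip H (A (f n)) (f n)) = (fun n => (series (fun n => complex.Re (ip H (B (f n)) (f n))) n -
      series (fun n => complex.Re (ip H (N (f n)) (f n))) n)%:C).
    apply/funext => n; rewrite /series /= -sumrB rmorph_sum /=; apply: eq_bigr => k _; exact: E.
  apply: cvg_real_complex; rewrite -[s](subKr s1); exact: cvgB.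
rewrite /trace; case: xgetP => [x _ /= hx|/(_ s%:C)/= h]; last by case: h.
have := cvg_unique _ (hx _ he) (trA _ he); apply; exact: norm_hausdorff.
Qed.

End DiagonalOperators.

(** * Continuity of translations in L2 *)

Section Affine.
Context {R : realType}.
Local Notation mu := (@lebesgue_measure R).

Lemma measurable_affine (a b : R) : measurable_fun setT (fun x : R => a * x + b).
Proof. by apply: measurable_funD => //; exact: measurable_funM. Qed.

Lemma preimage_affine_oc (a b : R) (x : R * R) : a != 0 ->
  (`|a|%:E * mu ((fun y : R => (a * y + b)%R) @^-1` `]x.1, x.2]))%E = mu `]x.1, x.2].
Proof.
move=> a0; case: x => c d /=.
have [ap|an] := ltP 0 a.
  have -> : (fun y : R => (a * y + b)%R) @^-1` `]c, d] = `](c - b) / a, (d - b) / a]%classic.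
    apply/seteqP; split=> y /=; rewrite !in_itv /= ltr_pdivrMr// ler_pdivlMr// => /andP[h1 h2];
    by apply/andP; split; lra.
  rewrite !lebesgue_measure_itv /= !lte_fin ltr_pM2r ?invr_gt0// ltrD2r gtr0_norm//.
  case: ifP => _; last by rewrite mule0.
  by rewrite -!EFinB -EFinM; congr (_%:E); field.
have {}an : a < 0 by rewrite lt_neqAle a0.
have -> : (fun y : R => (a * y + b)%R) @^-1` `]c, d] = `[(d - b) / a, (c - b) / a[%classic.
  apply/seteqP; split=> y /=; rewrite !in_itv /= ler_ndivrMr// ltr_ndivlMr// => /andP[h1 h2];
  by apply/andP; split; lra.
rewrite !lebesgue_measure_itv /= !lte_fin ltr_nM2r ?invr_lt0// ltrD2r ltr0_norm//.
case: ifP => _; last by rewrite mule0.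
by rewrite -!EFinB -EFinM; congr (_%:E); field.
Qed.

(** Lebesgue measure is characterized by its values on the intervals ]c, d]; |a| times its image
    under x -> a x + b takes the same values there, hence is Lebesgue measure. *)
Lemma ge0_integral_affine (a b : R) (f : R -> \bar R) : a != 0 ->
  measurable_fun setT f -> (forall x, (0 <= f x)%E) ->
  (\int[mu]_x f x = `|a|%:E * \int[mu]_x f (a * x + b)%R)%E.
Proof.
move=> a0 mf f0.
have na : 0 <= `|a| by [].
pose phi := fun x : measurableTypeR R => (a * x + b : measurableTypeR R).
have mphi : measurable_fun setT phi by exact: measurable_affine.
pose nu_ := mscale (NngNum na) (pushforward mu phi).
pose nu : {measure set _ -> \bar R} := nu_ mphi.
have E A : measurable A -> mu A = nu A.
  apply: lebesgue_measure_unique => _ [x _ <-].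
  by rewrite -(preimage_affine_oc b x a0).
rewrite (@eq_measure_integral _ _ _ _ nu); last by move=> A mA _; rewrite -E.
rewrite ge0_integral_mscale//=; congr (_ * _)%E.
by rewrite (ge0_integral_pushforward mphi).
Qed.

Lemma ge0_integral_shift (b : R) (f : R -> \bar R) :
  measurable_fun setT f -> (forall x, (0 <= f x)%E) ->
  (\int[mu]_x f (x - b)%R = \int[mu]_x f x)%E.
Proof.
move=> mf f0; rewrite (@ge0_integral_affine 1 (- b) f)// normr1 mul1e.
by apply: eq_integral => x _; rewrite mul1r.
Qed.

Lemma ge0_integral_reflect (b : R) (f : R -> \bar R) :
  measurable_fun setT f -> (forall x, (0 <= f x)%E) ->
  (\int[mu]_x f (b - x)%R = \int[mu]_x f x)%E.
Proof.
move=> mf f0; rewrite (@ge0_integral_affine (-1) b f)// ?oppr_eq0// normrN1 mul1e.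
by apply: eq_integral => x _; rewrite mulN1r addrC.
Qed.

Lemma ge0_integral_scale (c : R) (f : R -> \bar R) : 0 < c ->
  measurable_fun setT f -> (forall x, (0 <= f x)%E) ->
  (\int[mu]_x f (x / c)%R = c%:E * \int[mu]_x f x)%E.
Proof.
move=> c0 mf f0; rewrite (@ge0_integral_affine c^-1 0 f)// ?invr_eq0 ?gt_eqF//.
rewrite muleA -EFinM gtr0_norm ?invr_gt0// divff ?gt_eqF// mul1e.
by apply: eq_integral => x _; rewrite addr0 mulrC.
Qed.

End Affine.

Section NonnegIntegrals.
Context {R : realType} d (T : measurableType d) (m : {measure set T -> \bar R}).
Implicit Types (f g : T -> R).

Lemma int_ge0 f : (forall x, 0 <= f x) -> (0 <= \int[m]_x (f x)%:E)%E.
Proof. by move=> f0; apply: integral_ge0 => x _; rewrite lee_fin. Qed.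

Lemma int_le f g : measurable_fun setT f -> measurable_fun setT g ->
  (forall x, 0 <= f x) -> (forall x, f x <= g x) ->
  (\int[m]_x (f x)%:E <= \int[m]_x (g x)%:E)%E.
Proof.
move=> mf mg f0 fg; apply: ge0_le_integral => //.
- by move=> x _; rewrite lee_fin.
- exact/measurable_EFinP.
- exact/measurable_EFinP.
- by move=> x _; rewrite lee_fin.
Qed.

Lemma int_D f g : measurable_fun setT f -> measurable_fun setT g ->
  (forall x, 0 <= f x) -> (forall x, 0 <= g x) ->
  (\int[m]_x (f x + g x)%:E = \int[m]_x (f x)%:E + \int[m]_x (g x)%:E)%E.
Proof.
move=> mf mg f0 g0; under eq_integral do rewrite EFinD.
by rewrite ge0_integralD//; [move=> x _; rewrite lee_fin|exact/measurable_EFinP|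
  move=> x _; rewrite lee_fin|exact/measurable_EFinP].
Qed.

Lemma int_Z (c : R) f : 0 <= c -> measurable_fun setT f -> (forall x, 0 <= f x) ->
  (\int[m]_x (c * f x)%:E = c%:E * \int[m]_x (f x)%:E)%E.
Proof.
move=> c0 mf f0; under eq_integral do rewrite EFinM.
by rewrite ge0_integralZl//; [exact/measurable_EFinP|move=> x _; rewrite lee_fin].
Qed.

Definition int2 f : \bar R := (\int[m]_x (f x ^+ 2)%:E)%E.

Lemma int2_ge0 f : (0 <= int2 f)%E.
Proof. by apply: int_ge0 => x; exact: sqr_ge0. Qed.

Lemma int2D_le f g : measurable_fun setT f -> measurable_fun setT g ->
  (int2 (fun x => (f x + g x)%R) <= 2%:E * int2 f + 2%:E * int2 g)%E.
Proof.
move=> mf mg; have mf2 := measurable_funX 2 mf; have mg2 := measurable_funX 2 mg.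
rewrite /int2 -int_Z//; last by move=> x; exact: sqr_ge0.
rewrite -int_Z//; last by move=> x; exact: sqr_ge0.
rewrite -int_D//; try by move=> x; rewrite mulr_ge0// sqr_ge0.
- apply: int_le => //.
  + by apply: measurable_funX; exact: measurable_funD.
  + by apply: measurable_funD; exact: measurable_funM.
  + by move=> x; exact: sqr_ge0.
  + by move=> x; have := sqr_ge0 (f x - g x); nra.
- exact: measurable_funM.
- exact: measurable_funM.
Qed.

End NonnegIntegrals.

Section TranslationL2.
Context {R : realType}.
Local Notation mu := (@lebesgue_measure R).
Implicit Types (f g : R -> R).

Lemma measurable_shift f (r : R) : measurable_fun setT f ->
  measurable_fun setT (fun t : R => f (t - r)).
Proof.
move=> mf; apply: (measurableT_comp mf).
by apply: measurable_funB.
Qed.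

Lemma int_shift f (r : R) : measurable_fun setT f -> (forall t, 0 <= f t) ->
  (\int[mu]_t (f (t - r)%R)%:E = \int[mu]_t (f t)%:E)%E.
Proof.
move=> mf f0; apply: (@ge0_integral_shift R r (EFin \o f)); first exact/measurable_EFinP.
by move=> x; rewrite lee_fin.
Qed.

Lemma int_indic_itv (a b c : R) : a <= b ->
  (\int[mu]_t (c * \1_(`[a, b]%classic) t)%:E = (c * (b - a))%:E)%E.
Proof.
move=> ab.
have h : (\int[mu]_t (\1_(`[a, b]%classic) t)%:E = (b - a)%:E)%E.
  rewrite integral_indic// setIT.
  apply: (etrans (@lebesgue_measure_itv R `[a, b])); rewrite /= lte_fin.
  have [_|ba] := ltP a b; first by rewrite EFinB.
  by rewrite (_ : b - a = 0)//; lra.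
under eq_integral do rewrite EFinM.
rewrite integralZl// ?h//.
apply/integrableP; split; first exact/measurable_EFinP/measurable_indic.
by under eq_integral do rewrite gee0_abs ?lee_fin ?indicE ?ler0n// -indicE; rewrite h ltry.
Qed.

(** For |r| <= 1 the difference is supported in [-(K + 1), K + 1], of length 2 (K + 1), and uniform
    continuity makes it at most [eta] there. *)
Lemma translation_continuous (f : R -> R) (K : R) : 0 <= K -> continuous f ->
  (forall t, K < `|t| -> f t = 0) ->
  forall eps : R, 0 < eps -> exists2 dl : R, 0 < dl & forall r, `|r| <= dl ->
  (\int[mu]_t (`|f t - f (t - r)|)%:E <= eps%:E)%E.
Proof.
move=> K0 cf fK eps e0.
have K1 : 0 < 2 * (K + 1) by lra.
pose eta := eps / (2 * (K + 1)).
have eta0 : 0 < eta by rewrite /eta divr_gt0.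
(* [uniform_continuity] concerns intervals [0, L]; the shift by K + 2 moves [-(K + 2), K + 2], which
   contains t and t - r, to such an interval. *)
have cf' : continuous (fun x : R => f (x - (K + 2))).
  by move=> x; apply: (cvg_comp (fun x : R => x - (K + 2)) f); [apply: cvgB; [exact: cvg_id|exact: cvg_cst]|exact: cf].
have [d d0 hd] := uniform_continuity (2 * (K + 2)) cf' eta0.
exists (Num.min 1 d) => [|r]; first by rewrite lt_min ltr01 d0.
rewrite le_min => /andP[r1 rd].
have mf : measurable_fun setT f by exact: continuous_measurable_fun.
pose I := `[(- (K + 1))%R, (K + 1)%R]%classic : set R.
apply: (@le_trans _ _ (\int[mu]_t (eta * \1_I t)%:E)%E).
  apply: int_le.
  - by apply: measurableT_comp => //; apply: measurable_funB => //; exact: measurable_shift.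
  - by apply: measurable_funM => //; apply: measurable_indic; exact: measurable_itv.
  - by move=> x; exact: normr_ge0.
  move=> t; rewrite indicE; have [tI|tI] := boolP (t \in I).
    rewrite mulr1; move: tI r1; rewrite inE /I /= in_itv /= ler_norml => /andP[t1 t2] /andP[r1 r2].
    have := hd (t + (K + 2)) (t - r + (K + 2)).
    rewrite !addrK; apply; [apply/andP; split; lra|apply/andP; split; lra|].
    by rewrite (_ : _ - _ = r)//; ring.
  have tK : K + 1 < `|t|.
    rewrite ltNge; apply: contra tI; rewrite ler_norml => h.
    by rewrite inE /I /= in_itv.
  rewrite (fK t) ?(fK (t - r)) ?subrr ?normr0 ?mulr0//; last by lra.
  by have := lerB_dist t r; lra.
rewrite int_indic_itv; last by lra.
rewrite lee_fin (_ : eta * _ = eps)// /eta; field.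
by apply/eqP; lra.
Qed.

Lemma int_mono_set (A : set R) (f : R -> R) : measurable A -> measurable_fun setT f ->
  (forall t, 0 <= f t) -> (forall t, ~ A t -> f t = 0) ->
  (\int[mu]_t (f t)%:E = \int[mu]_(t in A) (f t)%:E)%E.
Proof.
move=> mA mf f0 fA; rewrite [RHS]integral_mkcond; apply: eq_integral => t _.
rewrite patchE; case: ifPn => // /negP; rewrite inE => h; rewrite fA//.
Qed.

(** Three errors of eps/3: f is approximated in L^1 by a continuous function on an interval, which
    is then cut off so as to have compact support. *)
Lemma translation_L1_bounded (f : R -> R) (M K : R) : 0 < K -> measurable_fun setT f ->
  (forall t, `|f t| <= M) -> (forall t, K < `|t| -> f t = 0) ->
  forall eps : R, 0 < eps -> exists2 dl : R, 0 < dl & forall r, `|r| <= dl ->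
  (\int[mu]_t (`|f t - f (t - r)|)%:E <= eps%:E)%E.
Proof.
move=> K0 mf fM fK eps e0.
pose E := `[(- (K + 1))%R, (K + 1)%R]%classic : set R.
have mE : measurable E by exact: measurable_itv.
have finE : (mu E < +oo)%E.
  by rewrite /E lebesgue_measure_itv /=; case: ifP => _; rewrite -?EFinB ltry.
have intf : mu.-integrable E (EFin \o f).
  have mfE : measurable_fun E f by exact: measurable_funS mf.
  apply/integrableP; split; first exact/measurable_EFinP.
  apply: (@le_lt_trans _ _ (\int[mu]_(x in E) (cst M%:E) x)%E).
    apply: ge0_le_integral => //.
    - by apply: measurableT_comp => //; exact/measurable_EFinP.
    - by move=> t _; rewrite lee_fin; exact: le_trans (fM t).
  by rewrite integral_cst// lte_mul_pinfty// lee_fin; exact: le_trans (fM 0).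
have [g [cg ig lg]] := approximation_continuous_integrable mE finE intf.
have e3 : 0 < eps / 3 by rewrite divr_gt0.
have [n hn] : exists n, (\int[mu]_(z in E) `|(f z - g n z)%:E| <= (eps / 3)%:E)%E.
  move/fine_cvgP : lg => [fin /cvgrPdist_le /(_ _ e3)[N1 _ h1]].
  case: fin => N2 _ h2.
  exists (maxn N1 N2); have := h1 _ (leq_maxl N1 N2); rewrite /= sub0r normrN => h.
  rewrite -(fineK (h2 _ (leq_maxr N1 N2))) lee_fin; exact: le_trans (ler_norm _) h.
(* The cut-off is 1 on [-K, K], outside which f vanishes; so f = f chi, and multiplying the
   approximation by chi does not increase its distance to f. *)
pose chi := fun t : R => Num.max 0 (Num.min 1 (K + 1 - `|t|)).
have cchi : continuous chi.
  move=> t; apply: (@continuous_max _ _ (fun=> 0) (fun t : R => Num.min 1 (K + 1 - `|t|))).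
    exact: cvg_cst.
  apply: (@continuous_min _ _ (fun=> 1) (fun t : R => K + 1 - `|t|)); first exact: cvg_cst.
  by apply: cvgB; [exact: cvg_cst|exact: norm_continuous].
have chi01 t : 0 <= chi t <= 1.
  by rewrite /chi le_max lexx /= ge_max ler01 ge_min lexx.
have chi1 t : `|t| <= K -> chi t = 1.
  move=> tK; rewrite /chi min_l; last by lra.
  by rewrite max_r.
have chi0 t : K + 1 < `|t| -> chi t = 0.
  by move=> tK; rewrite /chi max_l// ge_min; apply/orP; right; lra.
pose k t := g n t * chi t.
have ck : continuous k by move=> t; apply: cvgM; [exact: cg|exact: cchi].
have mk : measurable_fun setT k by exact: continuous_measurable_fun.
have k0 t : K + 1 < `|t| -> k t = 0 by move=> /chi0; rewrite /k => ->; rewrite mulr0.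
have K10 : 0 <= K + 1 by lra.
have [dl dl0 hdl] := translation_continuous K10 ck k0 e3.
have mfk : measurable_fun setT (fun t => `|f t - k t|).
  by apply: measurableT_comp => //; exact: measurable_funB.
have fk : (\int[mu]_t (`|f t - k t|)%:E <= (eps / 3)%:E)%E.
  apply: le_trans hn; rewrite (int_mono_set mE)//; last first.
    move=> t /= Et.
    have tK : K + 1 < `|t|.
      by rewrite ltNge; apply/negP; rewrite ler_norml => h; apply: Et; rewrite /E /= in_itv.
    by rewrite k0// fK ?subrr ?normr0//; lra.
  apply: ge0_le_integral => //.
  - by apply/measurable_EFinP; exact: measurable_funS mfk.
  - apply/measurable_EFinP; apply: measurableT_comp => //; apply: measurable_funB.
      exact: measurable_funS mf.
    by apply: measurable_funS (continuous_measurable_fun (cg n)).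
  move=> t _; rewrite /= lee_fin.
  have fchi : f t = f t * chi t.
    by have [/chi1 ->|/fK ->] := leP `|t| K; rewrite ?mulr1// mul0r.
  rewrite {1}fchi /k -mulrBl normrM -[leRHS]mulr1 ler_wpM2l//.
  by have /andP[h1 h2] := chi01 t; rewrite ger0_norm.
exists dl => // r hr.
have mfr := measurable_shift r mf.
have mkr := measurable_shift r mk.
have mfkr := measurable_shift r mfk.
have mkk : measurable_fun setT (fun t : R => `|k t - k (t - r)|).
  by apply: measurableT_comp => //; exact: measurable_funB.
apply: (@le_trans _ _ (\int[mu]_t (`|f t - k t| + (`|k t - k (t - r)| + `|f (t - r) - k (t - r)|))%:E)%E).
  apply: int_le.
  - by apply: measurableT_comp => //; exact: measurable_funB.
  - by apply: measurable_funD => //; exact: measurable_funD.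
  - by move=> t; exact: normr_ge0.
  - move=> t; rewrite [X in `|X|](_ : _ = (f t - k t) + ((k t - k (t - r)) - (f (t - r) - k (t - r)))); last by ring.
    by apply: (le_trans (ler_normD _ _)); rewrite lerD2l; exact: ler_normB.
rewrite int_D//; last exact: measurable_funD.
rewrite int_D//.
rewrite (int_shift r mfk)//.
have -> : eps%:E = ((eps / 3)%:E + ((eps / 3)%:E + (eps / 3)%:E))%E.
  by rewrite -!EFinD; congr (_%:E); field.
by rewrite leeD// leeD// hdl.
Qed.


(** For a bounded function (f(t) - f(t - r))^2 <= 2 M |f(t) - f(t - r)|, so the L^1 statement
    suffices; 2 M + 1 is used to have a positive divisor. *)
Lemma translation_L2_bounded (f : R -> R) (M K : R) : 0 < K -> measurable_fun setT f ->
  (forall t, `|f t| <= M) -> (forall t, K < `|t| -> f t = 0) ->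
  forall eps : R, 0 < eps -> exists2 dl : R, 0 < dl & forall r, `|r| <= dl ->
  (int2 mu (fun t => f t - f (t - r))%R <= eps%:E)%E.
Proof.
move=> K0 mf fM fK eps e0.
have M0 : 0 <= M by exact: le_trans (fM 0).
have M1 : 0 < 2 * M + 1 by lra.
have e1 : 0 < eps / (2 * M + 1) by rewrite divr_gt0.
have [dl dl0 hdl] := translation_L1_bounded K0 mf fM fK e1.
exists dl => // r /hdl h.
have mfr := measurable_shift r mf.
have ma : measurable_fun setT (fun t : R => `|f t - f (t - r)|).
  by apply: measurableT_comp => //; exact: measurable_funB.
apply: (@le_trans _ _ (\int[mu]_t ((2 * M + 1) * `|f t - f (t - r)|)%:E)%E).
  apply: int_le.
  - by apply: measurable_funX; exact: measurable_funB.
  - exact: measurable_funM.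
  - by move=> t; exact: sqr_ge0.
  move=> t; rewrite -(real_normK (num_real (_ - _))) expr2 ler_wpM2r//.
  by apply: (le_trans (ler_normB _ _)); have := fM t; have := fM (t - r); lra.
rewrite int_Z//; last by rewrite ltW.
apply: (@le_trans _ _ ((2 * M + 1)%:E * (eps / (2 * M + 1))%:E)%E).
  by apply: lee_wpmul2l => //; rewrite lee_fin ltW.
by rewrite -EFinM mulrC divfK ?gt_eqF.
Qed.

Lemma int2_shift (f : R -> R) (r : R) : measurable_fun setT f ->
  int2 mu (fun t => f (t - r)) = int2 mu f.
Proof.
move=> mf; apply: (@int_shift (fun t => f t ^+ 2)); first exact: measurable_funX.
by move=> t; exact: sqr_ge0.
Qed.

Lemma int2_truncation (f : R -> R) : measurable_fun setT f -> (int2 mu f < +oo)%E ->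
  forall eps : R, 0 < eps -> exists n : nat,
  (int2 mu (fun t => f t - (if (`|f t| <= n%:R) && (`|t| <= n%:R) then f t else 0))%R <= eps%:E)%E.
Proof.
move=> mf ff eps e0.
have mf2 : measurable_fun setT (fun t => f t ^+ 2) by exact: measurable_funX.
pose b n t := (`|f t| <= n%:R) && (`|t| <= n%:R) : bool.
have mb n : measurable_fun setT (b n).
  apply: measurable_and; apply: measurable_fun_ler => //; exact: measurableT_comp.
pose u n t := if b n t then f t else 0.
have mu_ n : measurable_fun setT (u n).
  exact: measurable_fun_ifT.
have mv n : measurable_fun setT (fun t => (f t - u n t) ^+ 2).
  by apply: measurable_funX; exact: measurable_funB.
have int_f2 : mu.-integrable setT (fun t => (f t ^+ 2)%:E).
  apply/integrableP; split; first exact/measurable_EFinP.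
  by under eq_integral do rewrite gee0_abs ?lee_fin ?sqr_ge0//.
have [] := @dominated_convergence _ _ R mu setT measurableT
  (fun n t => ((f t - u n t) ^+ 2)%:E) (cst 0%E) (fun t => (f t ^+ 2)%:E).
- by move=> n; apply/measurable_EFinP; exact: mv.
- exact: measurable_cst.
- apply: aeW => t _; apply: cvg_near_cst.
  have [N hN] : exists N : nat, `|f t| <= N%:R /\ `|t| <= N%:R.
    exists (Num.bound (`|f t| + `|t|)).
    have := archi_boundP (addr_ge0 (normr_ge0 (f t)) (normr_ge0 t)).
    by move: (Num.bound _)%:R => c; have := normr_ge0 (f t); have := normr_ge0 t; split; lra.
  exists N => // n /= Nn; rewrite /u /b.
  have Nn' : (N%:R : R) <= n%:R by rewrite ler_nat.
  by case: hN => h1 h2; rewrite (le_trans h1)// (le_trans h2)//= subrr expr0n.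
- exact: int_f2.
- apply: aeW => t n _ /=; rewrite lee_fin ger0_norm ?sqr_ge0// /u.
  by case: ifP => _; rewrite ?subr0// subrr expr0n sqr_ge0.
move=> _ _; rewrite integral0 => h.
move/fine_cvgP : h => [[N1 _ fin] /cvgrPdist_le /(_ _ e0)[N2 _ h]].
exists (maxn N1 N2); have := h _ (leq_maxr N1 N2); rewrite /= sub0r normrN => h1.
have h2 := fin _ (leq_maxl N1 N2); rewrite /= in h2.
change (\int[mu]_x ((f x - u (maxn N1 N2) x) ^+ 2)%:E <= eps%:E)%E.
by rewrite -(fineK h2) lee_fin; exact: le_trans (ler_norm _) h1.
Qed.

Lemma translation_L2 (f : R -> R) : measurable_fun setT f -> (int2 mu f < +oo)%E ->
  forall eps : R, 0 < eps -> exists2 dl : R, 0 < dl & forall r, `|r| <= dl ->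
  (int2 mu (fun t => f t - f (t - r))%R <= eps%:E)%E.
Proof.
move=> mf ff eps e0.
(* Two applications of [int2D_le] cost 2 (eps/4) + 2 (2 (eps/16) + 2 (eps/16)) = eps: the
   translation of the truncated function counts for eps/4, each truncation error for eps/16. *)
have e1 : 0 < eps / 16 by rewrite divr_gt0.
have [n hn] := int2_truncation mf ff e1.
pose u (t : R) := if (`|f t| <= n%:R) && (`|t| <= n%:R) then f t else 0.
have {}hn : (int2 mu (fun t => f t - u t)%R <= (eps / 16)%:E)%E := hn.
have mu_ : measurable_fun setT u.
  apply: measurable_fun_ifT => //.
  by apply: measurable_and; apply: measurable_fun_ler => //; exact: measurableT_comp.
have e2 : 0 < eps / 4 by rewrite divr_gt0.
(* The radius n + 1 is positive even if n = 0. *)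
have un t : `|u t| <= n.+1%:R.
  rewrite /u; case: ifP => [/andP[h _]|_]; last by rewrite normr0.
  by apply: (le_trans h); rewrite ler_nat.
have u0 t : n.+1%:R < `|t| -> u t = 0.
  move=> h; rewrite /u ifF//; apply/negbTE; rewrite negb_and -!ltNge; apply/orP; right.
  by apply: le_lt_trans h; rewrite ler_nat.
have [dl dl0 hdl] := translation_L2_bounded (ltr0Sn R n) mu_ un u0 e2.
exists dl => // r /hdl h.
have mur := measurable_shift r mu_.
have mfr := measurable_shift r mf.
have mfu : measurable_fun setT (fun t => f t - u t) by exact: measurable_funB.
have mfur := measurable_shift r mfu.
have muu : measurable_fun setT (fun t : R => u t - u (t - r)) by exact: measurable_funB.
have nmfur : measurable_fun setT (fun t : R => (-1) * (f (t - r) - u (t - r))).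
  by apply: measurable_funM => //; exact: mfur.
have -> : (fun t : R => f t - f (t - r)) = (fun t => (u t - u (t - r)) + ((f t - u t) + (-1) * (f (t - r) - u (t - r)))).
  by apply/funext => t; ring.
have E1 : (int2 mu (fun t : R => (-1) * (f (t - r) - u (t - r)))%R = int2 mu (fun t => f t - u t)%R).
  rewrite -(int2_shift r mfu) /int2; apply: eq_integral => t _; congr (_%:E); ring.
apply: (le_trans (int2D_le _ _ _)) => //; first exact: measurable_funD.
have h2 := int2D_le mu mfu nmfur; rewrite E1 in h2.
apply: (@le_trans _ _ (2%:E * (eps / 4)%:E + 2%:E * (2%:E * (eps / 16)%:E + 2%:E * (eps / 16)%:E))%E).
  apply: leeD; apply: lee_wpmul2l => //.
  by apply: (le_trans h2); apply: leeD; apply: lee_wpmul2l.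
rewrite !(=^~ EFinM, =^~ EFinD) lee_fin; lra.
Qed.

End TranslationL2.

(** * Plancherel's identity through the Poisson kernel *)

Lemma measurable_sin_ {R : realType} : measurable_fun [set: R] (@sin R).
Proof. by apply: continuous_measurable_fun; exact: continuous_sin. Qed.
Lemma measurable_cos_ {R : realType} : measurable_fun [set: R] (@cos R).
Proof. by apply: continuous_measurable_fun; exact: continuous_cos. Qed.
Lemma measurable_expR_ {R : realType} : measurable_fun [set: R] (@expR R).
Proof. by apply: continuous_measurable_fun; exact: continuous_expR. Qed.
Lemma measurable_compT {R : realType} d (T : measurableType d) (F : R -> R) (g : T -> R) :
  measurable_fun setT F -> measurable_fun setT g -> measurable_fun setT (fun x => F (g x)).
Proof. by move=> mF mg; exact: (measurableT_comp mF). Qed.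
Lemma measurable_inv_pos {R : realType} d (T : measurableType d) (g : T -> R) :
  (forall x, 0 < g x) -> measurable_fun setT g -> measurable_fun setT (fun x => (g x)^-1).
Proof.
move=> g0 mg.
have -> : (fun x => (g x)^-1) = (fun x => expR (- ln (g x))).
  by apply/funext => x; rewrite expRN lnK// posrE.
by apply: (measurable_compT measurable_expR_); apply: measurableT_comp => //; exact: measurableT_comp.
Qed.

Ltac meas1 := lazymatch goal with
  | H : measurable_fun _ ?F |- measurable_fun _ ?F => exact: H
  | |- measurable_fun _ (fun _ => ?c) => exact: measurable_cst
  | |- measurable_fun _ (fun x => x) => exact: measurable_id
  | |- measurable_fun _ (fun x => x.1) => exact: measurable_fst
  | |- measurable_fun _ (fun x => x.2) => exact: measurable_snd
  | |- measurable_fun _ (fun x => (@?f x) ^+ _) => apply: (@measurable_funX _ _ _ _ f)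
  | |- measurable_fun _ (fun x => (@?f x) * (@?g x)) => apply: (@measurable_funM _ _ _ _ f g)
  | |- measurable_fun _ (fun x => - (@?f x)) => apply: (@measurable_funN _ _ _ _ f)
  | |- measurable_fun _ (fun x => (@?f x) + (@?g x)) => apply: (@measurable_funD _ _ _ _ f g)
  | |- measurable_fun _ (fun x => cos (@?f x)) => apply: (@measurable_compT _ _ _ cos f measurable_cos_)
  | |- measurable_fun _ (fun x => sin (@?f x)) => apply: (@measurable_compT _ _ _ sin f measurable_sin_)
  | |- measurable_fun _ (fun x => expR (@?f x)) => apply: (@measurable_compT _ _ _ expR f measurable_expR_)
  | |- measurable_fun _ (fun x => `|@?f x|) => apply: (@measurable_compT _ _ _ Num.norm f (@normr_measurable _ setT))
  | H : measurable_fun _ ?F |- measurable_fun _ (fun x => ?F (@?g x)) =>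
      apply: (@measurable_compT _ _ _ F g H)
  end.
(* The measurable structure of R, its Borel structure and the domain of the *)
(* Lebesgue measure are convertible but not syntactically equal. *)
Ltac meas := lazymatch goal with
  |- @measurable_fun _ _ _ _ _ ?f =>
    let H := fresh in have H : measurable_fun setT f; [repeat meas1|exact H] end.

Section RealIntegrable.
Context {R : realType} d (T : measurableType d) (m : {measure set T -> \bar R}).
Implicit Types (f g : T -> R).

Definition rint f := m.-integrable setT (EFin \o f).

Lemma rint_meas f : rint f -> measurable_fun setT f.
Proof. by move=> /integrableP[/measurable_EFinP]. Qed.

Lemma rintP f : measurable_fun setT f -> (\int[m]_x (`|f x|)%:E < +oo)%E -> rint f.
Proof. by move=> mf h; apply/integrableP; split => //; exact/measurable_EFinP. Qed.

Lemma rint_lty f : rint f -> (\int[m]_x (`|f x|)%:E < +oo)%E.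
Proof. by move=> /integrableP[]. Qed.

Lemma rint_le f g : measurable_fun setT f -> rint g -> (forall x, `|f x| <= g x) -> rint f.
Proof.
move=> mf ig fg; apply: rintP => //; apply: le_lt_trans (rint_lty ig).
apply: int_le.
- exact: measurableT_comp.
- by apply: measurableT_comp => //; exact: rint_meas.
- by [].
- by move=> x; apply: le_trans (fg x) (ler_norm _).
Qed.

Lemma rintD f g : rint f -> rint g -> rint (fun x => f x + g x).
Proof. by move=> h1 h2; apply: (integrableD measurableT h1 h2). Qed.

Lemma rintZ (c : R) f : rint f -> rint (fun x => c * f x).
Proof.
move=> h; have := integrableZl measurableT c h.
by apply: eq_integrable.
Qed.

Lemma rintN f : rint f -> rint (fun x => - f x).
Proof.
move=> /(rintZ (-1)); rewrite (_ : (fun x => -1 * f x) = (fun x => - f x))//.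
by apply/funext => x; rewrite mulN1r.
Qed.

Lemma rintB f g : rint f -> rint g -> rint (fun x => f x - g x).
Proof. by move=> h1 /rintN h2; exact: rintD. Qed.

Lemma rint_norm f : rint f -> rint (fun x => `|f x|).
Proof. by move=> /integrable_abse. Qed.

Lemma EFin_Rintegral f : rint f -> (\int[m]_x f x)%:E = (\int[m]_x (f x)%:E)%E.
Proof. by move=> h; rewrite /Rintegral fineK//; exact: integrable_fin_num. Qed.

Lemma Rint_norm_le f g : measurable_fun setT f -> rint g -> (forall x, `|f x| <= g x) ->
  `|\int[m]_x f x| <= \int[m]_x g x.
Proof.
move=> mf ig fg; have fi := rint_le mf ig fg.
apply: (le_trans (le_normr_Rintegral measurableT fi)).
by apply: le_Rintegral => //; exact: rint_norm.
Qed.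

Lemma rint_mul_L2 f g : measurable_fun setT f -> measurable_fun setT g ->
  (int2 m f < +oo)%E -> (int2 m g < +oo)%E -> rint (fun x => f x * g x).
Proof.
move=> mf mg f2 g2.
have sq h : measurable_fun setT h -> (int2 m h < +oo)%E -> rint (fun x => h x ^+ 2).
  move=> mh h2; apply: rintP; first exact: measurable_funX.
  by under eq_integral do rewrite ger0_norm ?sqr_ge0//.
apply: (@rint_le _ (fun x => f x ^+ 2 + g x ^+ 2)).
- exact: measurable_funM.
- by apply: rintD; exact: sq.
- move=> x; rewrite normrM -(real_normK (num_real (f x))) -(real_normK (num_real (g x))).
  by have := sqr_ge0 (`|f x| - `|g x|); have := normr_ge0 (f x); have := normr_ge0 (g x); nra.
Qed.

End RealIntegrable.

Section RealFubini.
Context d1 d2 (T1 : measurableType d1) (T2 : measurableType d2) (R : realType).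
Variable m1 : {sigma_finite_measure set T1 -> \bar R}.
Variable m2 : {sigma_finite_measure set T2 -> \bar R}.
Implicit Types f : T1 * T2 -> R.

Lemma measurable_section1 f x : measurable_fun setT f -> measurable_fun setT (fun y => f (x, y)).
Proof. by move=> mf; apply: (measurableT_comp mf); exact: measurable_pair1. Qed.

Lemma measurable_section2 f y : measurable_fun setT f -> measurable_fun setT (fun x => f (x, y)).
Proof. by move=> mf; apply: (measurableT_comp mf); exact: measurable_pair2. Qed.

Lemma measurable_int1 (f : T1 * T2 -> \bar R) : measurable_fun setT f -> (forall z, (0 <= f z)%E) ->
  measurable_fun setT (fun x => (\int[m2]_y f (x, y))%E).
Proof. by move=> mf f0; exact: (measurable_fun_fubini_tonelli_F f). Qed.

Lemma measurable_Rint1 f : measurable_fun setT f -> measurable_fun setT (fun x => \int[m2]_y f (x, y)).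
Proof.
move=> mf; apply: (measurableT_comp (@fine_measurable _ setT measurableT)) => //.
under eq_fun do rewrite integralE.
have /measurable_EFinP mf' := mf.
apply: emeasurable_funB.
- rewrite (_ : (fun x : T1 => _) = (fun x => \int[m2]_y (fun z => (f z)%:E)^\+ (x, y))%E); last first.
    by apply/funext => x; apply: eq_integral => y _; rewrite !funeposE.
  apply: measurable_int1; first exact: measurable_funepos.
  by move=> z; exact: funepos_ge0.
- rewrite (_ : (fun x : T1 => _) = (fun x => \int[m2]_y (fun z => (f z)%:E)^\- (x, y))%E); last first.
    by apply/funext => x; apply: eq_integral => y _; rewrite !funenegE.
  apply: measurable_int1; first exact: measurable_funeneg.
  by move=> z; exact: funeneg_ge0.
Qed.

Section Tensor.
Variables (f : T1 * T2 -> R) (b1 : T1 -> R) (b2 : T2 -> R).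
Hypothesis mf : measurable_fun setT f.
Hypothesis i1 : rint m1 b1.
Hypothesis i2 : rint m2 b2.
Hypothesis fb : forall x y, `|f (x, y)| <= b1 x * b2 y.

Lemma tensor_rint1 x : rint m2 (fun y => f (x, y)).
Proof.
apply: (rint_le (measurable_section1 x mf) (rintZ (b1 x) i2)) => y; exact: fb.
Qed.

Lemma tensor_rint2 y : rint m1 (fun x => f (x, y)).
Proof.
apply: (rint_le (measurable_section2 y mf) (rintZ (b2 y) i1)) => x.
by rewrite mulrC; exact: fb.
Qed.

Lemma tensor_rint_Rint : rint m1 (fun x => \int[m2]_y f (x, y)).
Proof.
apply: (@rint_le _ _ _ _ _ (fun x => (\int[m2]_y b2 y) * b1 x)).
- exact: measurable_Rint1.
- exact: rintZ.
- move=> x; rewrite mulrC -RintegralZl//.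
  by apply: Rint_norm_le; [exact: measurable_section1|exact: rintZ|move=> y; exact: fb].
Qed.

(** A bound by a product b1(x) b2(y) of integrable functions gives the joint integrability that
    Fubini's theorem asks for; the exchanges of signed integrals below are of this type. *)
Lemma tensor_Fubini : \int[m1]_x \int[m2]_y f (x, y) = \int[m2]_y \int[m1]_x f (x, y).
Proof.
have ih : (m1 \x m2)%E.-integrable setT (EFin \o f).
  apply/integrable12ltyP; first exact/measurable_EFinP.
  apply: (@le_lt_trans _ _ (\int[m1]_x (`|b1 x| * (\int[m2]_y `|b2 y|))%:E)%E).
    apply: ge0_le_integral => //.
    - by move=> x _; apply: integral_ge0.
    - apply: (measurable_int1 (f := fun z => `|(f z)%:E|)%E) => //.
      by apply: measurableT_comp => //; exact/measurable_EFinP.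
    - by apply/measurable_EFinP; apply: measurable_funM => //; apply: measurableT_comp => //; exact: rint_meas i1.
    move=> x _; rewrite EFinM (EFin_Rintegral (rint_norm i2)).
    rewrite -ge0_integralZl//; last first.
      by apply/measurable_EFinP; apply: measurableT_comp => //; exact: rint_meas i2.
    apply: ge0_le_integral => //.
    - apply: measurableT_comp => //; apply/measurable_EFinP; exact: measurable_section1.
    - apply/measurable_EFinP; apply: measurable_funM => //; apply: measurableT_comp => //; exact: rint_meas i2.
    - by move=> y _; rewrite lee_fin -normrM; apply: le_trans (fb x y) (ler_norm _).
  have := rint_lty (rintZ (\int[m2]_y `|b2 y|) (rint_norm i1)).
  under eq_integral do rewrite normrM normr_id mulrC ger0_norm ?Rintegral_ge0//.
  by [].
have := Fubini ih; rewrite /=.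
have E1 x : (\int[m2]_y (f (x, y))%:E)%E = (\int[m2]_y f (x, y))%:E.
  by rewrite (EFin_Rintegral (tensor_rint1 x)).
have E2 y : (\int[m1]_x (f (x, y))%:E)%E = (\int[m1]_x f (x, y))%:E.
  by rewrite (EFin_Rintegral (tensor_rint2 y)).
under eq_integral do rewrite E1.
under [in RHS]eq_integral do rewrite E2.
by move=> h; rewrite /Rintegral h.
Qed.

End Tensor.
End RealFubini.

(** * Fourier representation and mass of the Poisson kernel *)

Section PoissonKernel.
Context {R : realType}.
Local Notation mu := (@lebesgue_measure R).
Implicit Types (a b eps r x : R).

Let halfline : [set x : R | 0 <= x] = `[0, +oo[%classic.
Proof. by apply/seteqP; split => x /=; rewrite in_itv /= andbT. Qed.

Lemma derive_expR_lin c x : is_derive x 1 (fun x : R => expR (c * x)) (c * expR (c * x)).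
Proof.
have h1 : is_derive x 1 (fun x : R => c * x) c.
  have := @is_deriveM R R (cst c) id x 1 0 1 (is_derive_cst _ _ _) (is_derive_id _ _).
  by move=> h; apply: is_derive_eq h _; rewrite /= scaler0 addr0 /GRing.scale /= mulr1.
have := @is_derive1_comp R expR (fun x : R => c * x) x (expR (c * x)) c (is_derive_expR _) h1.
by move=> h; apply: is_derive_eq h _; rewrite mulrC.
Qed.

Lemma derive_trig_lin b x : is_derive x 1 (fun x : R => cos (b * x)) (- b * sin (b * x)) /\
  is_derive x 1 (fun x : R => sin (b * x)) (b * cos (b * x)).
Proof.
have h1 : is_derive x 1 (fun x : R => b * x) b.
  have := @is_deriveM R R (cst b) id x 1 0 1 (is_derive_cst _ _ _) (is_derive_id _ _).
  by move=> h; apply: is_derive_eq h _; rewrite /= scaler0 addr0 /GRing.scale /= mulr1.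
split.
  have := @is_derive1_comp R cos (fun x : R => b * x) x _ b (is_derive_cos _) h1.
  by move=> h; apply: is_derive_eq h _; ring.
have := @is_derive1_comp R sin (fun x : R => b * x) x _ b (is_derive_sin _) h1.
by move=> h; apply: is_derive_eq h _; ring.
Qed.

Lemma expR_decay eps : 0 < eps -> expR (- eps * x) @[x --> +oo] --> (0 : R).
Proof.
move=> e0.
rewrite (_ : (fun x => expR (- eps * x)) = (fun z => expR (- z)) \o (fun z => eps * z)); last first.
  by apply/funext => x /=; rewrite mulNr.
apply: (@cvg_comp _ _ _ _ _ _ (pinfty_nbhs R)); last exact: cvgr_expR.
exact: gt0_cvgMry.
Qed.

Lemma derive_trig_comb b k0 k1 k2 x :
  is_derive x 1 (fun x : R => k0 + (k1 * sin (b * x) + k2 * cos (b * x)))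
    (k1 * (b * cos (b * x)) + k2 * (- b * sin (b * x))).
Proof.
have [h2 h3] := derive_trig_lin b x.
have h4 := @is_deriveM R R (cst k1) _ x 1 0 _ (is_derive_cst _ _ _) h3.
have h5 := @is_deriveM R R (cst k2) _ x 1 0 _ (is_derive_cst _ _ _) h2.
have := @is_deriveD R R R (cst k0) _ x 1 0 _ (is_derive_cst _ _ _) (is_deriveD h4 h5).
by move=> h; apply: is_derive_eq h _; rewrite /= !scaler0 !addr0 add0r.
Qed.

Lemma derivable_cvg_right (F : R -> R) x d : is_derive x 1 F d -> F y @[y --> x^'+] --> F x.
Proof.
move=> h; apply: cvg_at_right_filter.
by apply: differentiable_continuous; apply/derivable1_diffP; case: h.
Qed.

(** Adding 1 to the cosine makes the integrand nonnegative, as required by the fundamental theorem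
    of calculus on a half-line; the contribution of the 1 is subtracted afterwards by means of the
    case b = 0. *)
Lemma poisson_half eps b : 0 < eps ->
  (\int[mu]_(x in `[0%R, +oo[) (expR (- eps * x) * (1 + cos (b * x)))%:E =
   (eps^-1 + eps / (eps ^+ 2 + b ^+ 2))%:E)%E.
Proof.
move=> e0.
have D0 : 0 < eps ^+ 2 + b ^+ 2 by rewrite ltr_pwDl ?exprn_gt0// sqr_ge0.
pose D := eps ^+ 2 + b ^+ 2.
(* The product e^(-eps x) A(x) is the primitive that vanishes at +oo. *)
pose A x := - eps^-1 + (b / D * sin (b * x) + (- eps / D) * cos (b * x)).
pose F x := expR (- eps * x) * A x.
have dF x : is_derive x 1 F (expR (- eps * x) * (1 + cos (b * x))).
  have h1 := derive_expR_lin (- eps) x.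
  have h4 := derive_trig_comb b (- eps^-1) (b / D) (- eps / D) x.
  have := is_deriveM h1 h4.
  move=> h; apply: is_derive_eq h _; rewrite /GRing.scale /= /D; field.
  by rewrite !gt_eqF.
have Fbd x : `|F x| <= (eps^-1 + (`|b / D| + `|eps / D|)) * expR (- eps * x).
  rewrite /F normrM ger0_norm ?expR_ge0// mulrC ler_wpM2r ?expR_ge0//.
  apply: (le_trans (ler_normD _ _)); rewrite normrN gtr0_norm ?invr_gt0// lerD2l.
  apply: (le_trans (ler_normD _ _)); rewrite !normrM normrN lerD//.
    rewrite -[leRHS]mulr1 ler_wpM2l// ?mulr_ge0//.
    by rewrite ler_norml; apply/andP; split; [exact: sin_geN1|exact: sin_le1].
  rewrite -[leRHS]mulr1 ler_wpM2l// ?mulr_ge0//.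
  by rewrite ler_norml; apply/andP; split; [exact: cos_geN1|exact: cos_le1].
rewrite (@ge0_continuous_FTC2y R (fun x => expR (- eps * x) * (1 + cos (b * x))) F 0 0).
- rewrite -EFinB sub0r /F /A /D !mulr0 sin0 cos0 expR0 mul1r mulr0 add0r mulr1; congr (_%:E).
  by field; rewrite !gt_eqF.
- move=> x _; rewrite mulr_ge0 ?expR_ge0//; have := cos_geN1 (b * x); lra.
- apply: continuous_subspaceT => x; apply: cvgM.
    by apply: (cvg_comp (fun x => - eps * x) expR); [exact: mulrl_continuous|exact: continuous_expR].
  apply: cvgD; first exact: cvg_cst.
  by apply: (cvg_comp (fun x => b * x) cos); [exact: mulrl_continuous|exact: continuous_cos].
- apply/cvgrPdist_le => e1 e10.
  pose K := eps^-1 + (`|b / D| + `|eps / D|).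
  have K0 : 0 < K by rewrite /K ltr_pwDl ?invr_gt0// addr_ge0.
  have /cvgrPdist_le /(_ _ (divr_gt0 e10 K0)) := expR_decay e0.
  apply: filterS => x; rewrite !sub0r !normrN ger0_norm ?expR_ge0// => h.
  by apply: (le_trans (Fbd x)); rewrite mulrC -ler_pdivlMr.
- by move=> x _; case: (dF x).
- exact: derivable_cvg_right (dF 0).
- by move=> x _; rewrite derive1E; apply: (@derive_val _ _ _ _ _ _ _ (dF x)).
Qed.

Lemma poisson_line eps b : 0 < eps ->
  (\int[mu]_x (expR (- eps * `|x|) * (1 + cos (b * x)))%:E =
   (2 * (eps^-1 + eps / (eps ^+ 2 + b ^+ 2)))%:E)%E.
Proof.
move=> e0; rewrite ge0_symfun_integralT.
- rewrite halfline EFinM -(poisson_half b e0); congr (_ * _)%E; apply: eq_integral => x.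
  by rewrite inE /= in_itv /= andbT => x0; rewrite ger0_norm.
- move=> x; rewrite mulr_ge0 ?expR_ge0//; have := cos_geN1 (b * x); lra.
- move=> x; apply: cvgM.
    apply: (cvg_comp (fun x => - eps * `|x|) expR); last exact: continuous_expR.
    by apply: cvgM; [exact: cvg_cst|exact: norm_continuous].
  apply: cvgD; first exact: cvg_cst.
  by apply: (cvg_comp (fun x => b * x) cos); [exact: mulrl_continuous|exact: continuous_cos].
- by move=> x /=; rewrite normrN mulrN cosN.
Qed.

Lemma measurable_expw eps : measurable_fun setT (fun x : R => expR (- eps * `|x|)).
Proof. by meas. Qed.

Lemma int_expw eps : 0 < eps -> (\int[mu]_x (expR (- eps * `|x|))%:E = (2 / eps)%:E)%E.
Proof.
move=> e0; have := poisson_line 0 e0; rewrite expr0n addr0.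
under eq_integral do rewrite mul0r cos0 mulrC.
rewrite int_Z//; last exact: measurable_expw.
  rewrite (_ : (2 * _)%:E = (2%:E * (2 / eps)%:E)%E); last first.
    by rewrite -EFinM; congr (_%:E); field; rewrite gt_eqF.
  move=> h; have := congr1 (fun y => (2^-1)%:E * y)%E h.
  rewrite !muleA -!EFinM (_ : 2^-1 * (1 + 1) = 1 :> R); last by field.
  by rewrite mul1e mul1r.
Qed.

Lemma rint_expw eps : 0 < eps -> rint mu (fun x => expR (- eps * `|x|)).
Proof.
move=> e0; apply: rintP; first exact: measurable_expw.
by under eq_integral do rewrite ger0_norm ?expR_ge0//; rewrite int_expw// ltry.
Qed.

(** The Fourier transform of e^(-eps |xi|) at frequency a r, by [poisson_fourier]. It is not
    normalized: its mass is 2 pi / a, by [int_poisson]. *)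
Definition poisson a eps r : R := 2 * eps / (eps ^+ 2 + (a * r) ^+ 2).

Lemma poisson_fourier eps b : 0 < eps ->
  \int[mu]_x (expR (- eps * `|x|) * cos (b * x)) = 2 * eps / (eps ^+ 2 + b ^+ 2).
Proof.
move=> e0; have iw := rint_expw e0.
have mc : measurable_fun setT (fun x : R => expR (- eps * `|x|) * cos (b * x)) by meas.
have ic : rint mu (fun x => expR (- eps * `|x|) * cos (b * x)).
  apply: (@rint_le _ _ _ mu _ _ mc iw) => x; rewrite normrM ger0_norm ?expR_ge0// -[leRHS]mulr1 ler_wpM2l ?expR_ge0//.
  by rewrite ler_norml; apply/andP; split; [exact: cos_geN1|exact: cos_le1].
have : \int[mu]_x (expR (- eps * `|x|) + expR (- eps * `|x|) * cos (b * x)) = 2 * (eps^-1 + eps / (eps ^+ 2 + b ^+ 2)).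
  by rewrite /Rintegral; under eq_integral do rewrite -{1}[expR _]mulr1 -mulrDr; rewrite poisson_line.
rewrite RintegralD// {1}/Rintegral int_expw//= => h.
by apply: (addrI (2 / eps)); rewrite h mulrDr mulrA.
Qed.

Lemma poisson_gt0 a eps r : 0 < eps -> 0 < poisson a eps r.
Proof.
move=> e0; rewrite /poisson divr_gt0//; first by lra.
by rewrite ltr_pwDl ?exprn_gt0// sqr_ge0.
Qed.

Lemma measurable_poisson a eps : 0 < eps -> measurable_fun setT (poisson a eps).
Proof.
move=> e0; apply: measurable_funM; first exact: measurable_cst.
apply: measurable_inv_pos => [x|]; first by rewrite ltr_pwDl ?exprn_gt0// sqr_ge0.
by meas.
Qed.

Lemma poisson_scale a eps r : 0 < eps -> poisson a eps r = eps^-1 * poisson a 1 (r / eps).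
Proof.
move=> e0; rewrite /poisson; field.
have h : 0 < eps ^+ 2 + (a * r) ^+ 2 by rewrite ltr_pwDl ?exprn_gt0// sqr_ge0.
have h1 : 0 < 1 ^+ 2 + (a * (r / eps)) ^+ 2 by rewrite ltr_pwDl ?exprn_gt0// sqr_ge0.
rewrite !gt_eqF//.
Qed.

Lemma int_poisson1 a : 0 < a -> (\int[mu]_r (poisson a 1 r)%:E = (2 * pi / a)%:E)%E.
Proof.
move=> a0.
have h1 : (\int[mu]_x ((1 + x ^+ 2)^-1)%:E = pi%:E)%E.
  rewrite ge0_symfun_integralT.
  - rewrite halfline.
    have := @integral0y_oneDsqr R; rewrite /oneDsqr => ->; rewrite -EFinM; congr (_%:E); by field.
  - by move=> x; rewrite invr_ge0 addr_ge0// sqr_ge0.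
  - exact: continuous_oneDsqrV.
  - by move=> x /=; rewrite sqrrN.
have mo : measurable_fun setT (fun x : R => (1 + x ^+ 2)^-1).
  by apply: continuous_measurable_fun; exact: continuous_oneDsqrV.
have := @ge0_integral_scale R a^-1 (fun x => ((1 + x ^+ 2)^-1)%:E).
rewrite invr_gt0 h1 => /(_ a0); rewrite invrK => h.
have -> : (\int[mu]_r (poisson a 1 r)%:E = \int[mu]_r (2 * (1 + (r * a) ^+ 2)^-1)%:E)%E.
  by apply: eq_integral => x _; rewrite /poisson mulr1 expr1n [a * x]mulrC.
rewrite int_Z//; last by move=> x; rewrite invr_ge0 addr_ge0// sqr_ge0.
  rewrite h -?EFinM.
  - by congr (_%:E); field; rewrite gt_eqF.
  - exact/measurable_EFinP.
  - by move=> x; rewrite lee_fin invr_ge0 addr_ge0// sqr_ge0.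
by apply: (measurable_compT mo); meas.
Qed.

End PoissonKernel.

Lemma dominated_kernel_cvg0 {R : realType} d (T : measurableType d) (m : {measure set T -> \bar R})
    (K : T -> R) (w : nat -> T -> R) (B : R) :
  rint m K -> (forall x, 0 <= K x) -> (forall n, measurable_fun setT (w n)) ->
  (forall n x, 0 <= w n x <= B) -> (forall x, w n x @[n --> \oo] --> (0 : R)) ->
  (\int[m]_x (K x * w n x)%:E)%E @[n --> \oo] --> 0%E.
Proof.
move=> iK K0 mw wB w0.
have mK := rint_meas iK.
have [] := @dominated_convergence _ _ R m setT measurableT
  (fun n x => (K x * w n x)%:E) (cst 0%E) (fun x => (B * K x)%:E).
- by move=> n; apply/measurable_EFinP; apply: measurable_funM.
- exact: measurable_cst.
- apply: aeW => x _; apply: cvg_EFin; first exact: nearW.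
  by rewrite -(mulr0 (K x)); apply: cvgM; [exact: cvg_cst|exact: w0].
- exact: rintZ.
- apply: aeW => x n _ /=; rewrite lee_fin; have /andP[h1 h2] := wB n x.
  by rewrite ger0_norm ?mulr_ge0// mulrC ler_wpM2r.
by move=> _ _; rewrite integral0.
Qed.

Section Plancherel.
Context {R : realType}.
Local Notation mu := (@lebesgue_measure R).
Variables (a : R) (F : R -> R).
Hypothesis a0 : 0 < a.
Hypothesis iF : rint mu F.
Hypothesis F2 : (int2 mu F < +oo)%E.

Let mF : measurable_fun setT F := rint_meas iF.
Let N := \int[mu]_t `|F t|.
Let C xi := \int[mu]_t (F t * cos (a * xi * t)).
Let S xi := \int[mu]_t (F t * sin (a * xi * t)).
Let c := 2 * pi / a.
Let c0 : 0 < c. Proof. by rewrite /c divr_gt0// mulr_gt0// pi_gt0. Qed.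
Let N0 : 0 <= N. Proof. by apply: Rintegral_ge0. Qed.

Lemma mul_trig_le (x y : R) (y1 : `|y| <= 1) : `|x * y| <= `|x|.
Proof. by rewrite normrM -[leRHS]mulr1 ler_wpM2l. Qed.

Lemma norm_cos_le1 (x : R) : `|cos x| <= 1.
Proof. by rewrite ler_norml; apply/andP; split; [exact: cos_geN1|exact: cos_le1]. Qed.

Lemma norm_sin_le1 (x : R) : `|sin x| <= 1.
Proof. by rewrite ler_norml; apply/andP; split; [exact: sin_geN1|exact: sin_le1]. Qed.

Let mFc xi : measurable_fun setT (fun t => F t * cos (a * xi * t)). Proof. by meas. Qed.
Let mFs xi : measurable_fun setT (fun t => F t * sin (a * xi * t)). Proof. by meas. Qed.
Let iFc xi : rint mu (fun t => F t * cos (a * xi * t)).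
Proof.
apply: (@rint_le _ _ _ mu _ _ (mFc xi) (rint_norm iF)) => t.
exact: mul_trig_le (norm_cos_le1 _).
Qed.
Let iFs xi : rint mu (fun t => F t * sin (a * xi * t)).
Proof.
apply: (@rint_le _ _ _ mu _ _ (mFs xi) (rint_norm iF)) => t.
exact: mul_trig_le (norm_sin_le1 _).
Qed.
Let Cle xi : `|C xi| <= N.
Proof.
apply: (@Rint_norm_le _ _ _ mu _ _ (mFc xi) (rint_norm iF)) => t.
exact: mul_trig_le (norm_cos_le1 _).
Qed.
Let Sle xi : `|S xi| <= N.
Proof.
apply: (@Rint_norm_le _ _ _ mu _ _ (mFs xi) (rint_norm iF)) => t.
exact: mul_trig_le (norm_sin_le1 _).
Qed.
Let mC : measurable_fun setT C.
Proof.
apply: (@measurable_Rint1 _ _ _ _ R mu (fun z : R * R => F z.2 * cos (a * z.1 * z.2))).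
by meas.
Qed.
Let mS : measurable_fun setT S.
Proof.
apply: (@measurable_Rint1 _ _ _ _ R mu (fun z : R * R => F z.2 * sin (a * z.1 * z.2))).
by meas.
Qed.

(** The real part of e^(i a xi s) times the Fourier transform C - i S of F at xi. *)
Let G xi s := cos (a * xi * s) * C xi + sin (a * xi * s) * S xi.

Let GE xi s : G xi s = \int[mu]_t (F t * cos (a * xi * (s - t))).
Proof.
rewrite /G /C /S -!RintegralZl//; [|exact: iFs|exact: iFc].
rewrite -RintegralD//; [|exact: rintZ (iFc xi)|exact: rintZ (iFs xi)].
by apply: eq_Rintegral => t _; rewrite mulrBr cosB; ring.
Qed.

Let power_spectrum xi : C xi ^+ 2 + S xi ^+ 2 = \int[mu]_s (F s * G xi s).
Proof.
rewrite !expr2 -[C xi * C xi]RintegralZr ?iFc//; first rewrite -[S xi * S xi]RintegralZr//.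
rewrite -RintegralD//.
- by apply: eq_Rintegral => t _; rewrite /G; ring.
- by under eq_fun do rewrite /= mulrC; exact: rintZ (iFc xi).
- by under eq_fun do rewrite /= mulrC; exact: rintZ (iFs xi).
- exact: iFs.
- exact: iFc.
Qed.

(** C^2 + S^2 is a double integral of F(s) F(t) cos(a xi (s - t)), bounded in xi but not yet known
    to be integrable. With the weight the triple integral converges absolutely, and integrating over
    xi first turns the cosine into the Poisson kernel. *)
Lemma poisson_transform eps : 0 < eps ->
  \int[mu]_xi (expR (- eps * `|xi|) * (C xi ^+ 2 + S xi ^+ 2)) =
  \int[mu]_s (F s * \int[mu]_t (F t * poisson a eps (s - t))).
Proof.
move=> e0; have iw := rint_expw e0.
have mw := measurable_expw eps.
have mG : measurable_fun setT (fun z : R * R => G z.1 z.2).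
  by rewrite /G; meas.
transitivity (\int[mu]_xi \int[mu]_s (expR (- eps * `|xi|) * (F s * G xi s))).
  apply: eq_Rintegral => xi _; rewrite power_spectrum RintegralZl//.
  apply: (@rint_le _ _ _ mu _ (fun s => (2 * N) * `|F s|)).
  - apply: measurable_funM; first exact: mF.
    exact: (@measurable_section1 _ _ _ _ _ _ xi mG).
  - by apply: rintZ; exact: rint_norm.
  - move=> s; rewrite normrM mulrC ler_wpM2r// /G; apply: (le_trans (ler_normD _ _)).
    by rewrite mulrDl mul1r lerD// mulrC; apply: (le_trans (mul_trig_le _ _)); rewrite ?norm_cos_le1 ?norm_sin_le1.
rewrite (@tensor_Fubini _ _ _ _ R mu mu (fun z : R * R => expR (- eps * `|z.1|) * (F z.2 * G z.1 z.2))
   (fun xi => expR (- eps * `|xi|)) (fun s => 2 * N * `|F s|))//; last 3 first.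
- have mz : measurable_fun setT (fun z : R * R => expR (- eps * `|z.1|) * F z.2) by meas.
  have := measurable_funM mz mG; apply: eq_measurable_fun => z _ /=; ring.
- by apply: rintZ; exact: rint_norm.
- move=> xi s /=; rewrite normrM ger0_norm ?expR_ge0// ler_wpM2l ?expR_ge0//.
  rewrite normrM mulrC ler_wpM2r// /G; apply: (le_trans (ler_normD _ _)).
  by rewrite mulrDl mul1r lerD// mulrC; apply: (le_trans (mul_trig_le _ _)); rewrite ?norm_cos_le1 ?norm_sin_le1.
apply: eq_Rintegral => s _ /=.
have mcs : measurable_fun setT (fun z : R * R => expR (- eps * `|z.1|) * (F z.2 * cos (a * z.1 * (s - z.2)))).
  by meas.
have bcs x y : `|expR (- eps * `|x|) * (F y * cos (a * x * (s - y)))| <= expR (- eps * `|x|) * `|F y|.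
  by rewrite normrM ger0_norm ?expR_ge0// ler_wpM2l ?expR_ge0//; exact: mul_trig_le (norm_cos_le1 _).
transitivity (\int[mu]_xi (F s * (\int[mu]_t (expR (- eps * `|xi|) * (F t * cos (a * xi * (s - t))))))).
  apply: eq_Rintegral => xi _; rewrite GE mulrCA; congr (_ * _).
  rewrite RintegralZl//; apply: (@rint_le _ _ _ mu _ (fun t => `|F t|)).
  - by meas.
  - exact: rint_norm.
  - by move=> t; exact: mul_trig_le (norm_cos_le1 _).
rewrite RintegralZl//; last first.
  exact: (@tensor_rint_Rint _ _ _ _ R mu mu _ _ _ mcs iw (rint_norm iF) bcs).
congr (_ * _).
rewrite (@tensor_Fubini _ _ _ _ R mu mu _ _ _ mcs iw (rint_norm iF) bcs).
apply: eq_Rintegral => t _ /=.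
under eq_Rintegral do rewrite mulrCA.
rewrite RintegralZl//.
  congr (_ * _); rewrite /poisson -poisson_fourier//; apply: eq_Rintegral => x _.
  by congr (_ * cos _); ring.
apply: (@rint_le _ _ _ mu _ (fun x => expR (- eps * `|x|))) => //; first by meas.
by move=> x; apply: (le_trans (mul_trig_le _ (norm_cos_le1 _))); rewrite ger0_norm ?expR_ge0.
Qed.


Lemma int_poisson eps : 0 < eps -> (\int[mu]_r (poisson a eps r)%:E = c%:E)%E.
Proof.
move=> e0.
have p1 x : 0 <= poisson a 1 x by apply: ltW; exact: poisson_gt0.
have mp := @measurable_poisson R a 1 ltr01.
under eq_integral do rewrite poisson_scale//.
rewrite int_Z//; [|by rewrite invr_ge0 ltW|by apply: (@measurable_compT _ _ _ (poisson a 1) (fun x : R => x / eps) mp); meas].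
have -> : (\int[mu]_x (poisson a 1 (x / eps))%:E = eps%:E * \int[mu]_x (poisson a 1 x)%:E)%E.
  apply: (@ge0_integral_scale R eps (EFin \o poisson a 1)) => //; exact/measurable_EFinP.
by rewrite muleA -EFinM mulVf ?gt_eqF// mul1e int_poisson1.
Qed.

Lemma poisson_le eps r : 0 < eps -> poisson a eps r <= 2 / eps.
Proof.
move=> e0; have h : 0 < eps ^+ 2 + (a * r) ^+ 2 by rewrite ltr_pwDl ?exprn_gt0// sqr_ge0.
rewrite /poisson ler_pdivrMr// [leRHS](_ : _ = 2 * eps + 2 / eps * (a * r) ^+ 2); last first.
  by field; rewrite gt_eqF.
by rewrite lerDl mulr_ge0 ?sqr_ge0// divr_ge0// ltW.
Qed.

Let I := fine (int2 mu F).
Let IE : int2 mu F = I%:E.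
Proof. by rewrite fineK// fin_numElt (lt_le_trans _ (int2_ge0 mu F))//= F2. Qed.

Let iF2 : rint mu (fun t => F t ^+ 2).
Proof.
apply: rintP; first by meas.
by under eq_integral do rewrite ger0_norm ?sqr_ge0//.
Qed.

Section Energy.
Variable eps : R.
Hypothesis e0 : 0 < eps.
Let P := poisson a eps.
Let P0 r : 0 <= P r. Proof. by apply: ltW; exact: poisson_gt0. Qed.
Let mP : measurable_fun setT P. Proof. exact: measurable_poisson. Qed.
Let D s := \int[mu]_t (F t * P (s - t)).
Let A s := \int[mu]_t (F t ^+ 2 * P (s - t)).

Let int_Pr s : (\int[mu]_t (P (s - t))%:E = c%:E)%E.
Proof.
rewrite (@ge0_integral_reflect R s (EFin \o P)) ?int_poisson//.
exact/measurable_EFinP.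
Qed.

Let int_Pl t : (\int[mu]_s (P (s - t))%:E = c%:E)%E.
Proof. by rewrite (int_shift t mP P0) int_poisson. Qed.

Let mPr s : measurable_fun setT (fun t : R => P (s - t)). Proof. by meas. Qed.
Let iPr s : rint mu (fun t => P (s - t)).
Proof.
apply: rintP; first exact: mPr.
by under eq_integral do rewrite ger0_norm//; rewrite int_Pr ltry.
Qed.

Let iFP s : rint mu (fun t => F t * P (s - t)).
Proof.
apply: (@rint_le _ _ _ mu _ (fun t => (2 / eps) * `|F t|)); first by meas.
  exact: rintZ (rint_norm iF).
by move=> t; rewrite normrM mulrC ler_wpM2r// ger0_norm//; exact: poisson_le.
Qed.

Let iF2P s : rint mu (fun t => F t ^+ 2 * P (s - t)).
Proof.
apply: (@rint_le _ _ _ mu _ (fun t => (2 / eps) * F t ^+ 2)); first by meas.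
  exact: rintZ iF2.
move=> t; have h0 : 0 <= F t ^+ 2 * P (s - t) by rewrite mulr_ge0 ?sqr_ge0.
by rewrite (ger0_norm h0) mulrC ler_wpM2r ?sqr_ge0//; exact: poisson_le.
Qed.

Let inner s : (\int[mu]_t ((F s - F t) ^+ 2 * P (s - t))%:E = (c * F s ^+ 2 + A s - 2 * F s * D s)%:E)%E.
Proof.
have i1 : rint mu (fun t => F s ^+ 2 * P (s - t)) by exact: rintZ (iPr s).
have i2 : rint mu (fun t => 2 * F s * (F t * P (s - t))) by exact: rintZ (iFP s).
have i3 := rintD i1 (iF2P s).
have -> : c * F s ^+ 2 + A s - 2 * F s * D s =
    \int[mu]_t ((F s ^+ 2 * P (s - t) + F t ^+ 2 * P (s - t)) - 2 * F s * (F t * P (s - t))).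
  rewrite RintegralB// RintegralD//; last exact: iF2P.
  rewrite (@RintegralZl _ _ _ mu setT _ (F s ^+ 2) measurableT (iPr s)).
  rewrite (@RintegralZl _ _ _ mu setT _ (2 * F s) measurableT (iFP s)).
  by rewrite /Rintegral int_Pr /= mulrC.
rewrite EFin_Rintegral; last exact: rintB.
by apply: eq_integral => t _; congr (_%:E); ring.
Qed.

Let mF2P : measurable_fun setT (fun z : R * R => F z.2 ^+ 2 * P (z.1 - z.2)). Proof. by meas. Qed.
Let mFP : measurable_fun setT (fun z : R * R => F z.2 * P (z.1 - z.2)). Proof. by meas. Qed.

Let mA : measurable_fun setT A.
Proof. exact: (@measurable_Rint1 _ _ _ _ R mu _ mF2P). Qed.
Let mD : measurable_fun setT D.
Proof. exact: (@measurable_Rint1 _ _ _ _ R mu _ mFP). Qed.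
Let A0 s : 0 <= A s.
Proof. by apply: Rintegral_ge0 => t _; rewrite mulr_ge0// sqr_ge0. Qed.

Let int_A : (\int[mu]_s (A s)%:E = (c * I)%:E)%E.
Proof.
under eq_integral do rewrite (EFin_Rintegral (iF2P _)).
rewrite (@fubini_tonelli _ _ _ _ R mu mu (fun z : R * R => (F z.2 ^+ 2 * P (z.1 - z.2))%:E)); last 2 first.
- exact/measurable_EFinP.
- by move=> z; rewrite lee_fin mulr_ge0// sqr_ge0.
transitivity (\int[mu]_t (c * F t ^+ 2)%:E)%E.
  apply: eq_integral => t _ /=; rewrite int_Z ?sqr_ge0//.
    by rewrite int_Pl -EFinM mulrC.
  by meas.
rewrite int_Z; [|exact: ltW|by meas|by move=> x; exact: sqr_ge0].
by have -> : (c * I)%:E = (c%:E * int2 mu F)%E by rewrite IE EFinM.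
Qed.

Let iA : rint mu A.
Proof.
apply: rintP; first exact: mA.
by under eq_integral do rewrite ger0_norm//; rewrite int_A ltry.
Qed.

Let iFD : rint mu (fun s => F s * D s).
Proof.
apply: (@rint_le _ _ _ mu _ (fun t => (2 / eps * N) * `|F t|)); first exact: measurable_funM.
  exact: rintZ (rint_norm iF).
move=> t; rewrite normrM mulrC ler_wpM2r//.
rewrite /N -RintegralZl//; last exact: rint_norm.
apply: Rint_norm_le; [by meas|exact: rintZ (rint_norm iF)|].
by move=> x; rewrite normrM mulrC ler_wpM2r// ger0_norm//; exact: poisson_le.
Qed.

(** Each of the two squares contributes c int F^2, because the kernel has mass c in either variable,
    and the cross term is the expression of [poisson_transform]. The defect in Plancherel's identity
    is thus half of a nonnegative energy. *)
Lemma energyE : (\int[mu]_s \int[mu]_t ((F s - F t) ^+ 2 * P (s - t))%:E =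
  (2 * (c * I - \int[mu]_s (F s * D s)))%:E)%E.
Proof.
under eq_integral do rewrite inner.
have i1 : rint mu (fun s => c * F s ^+ 2) by exact: rintZ iF2.
have i2 : rint mu (fun s => 2 * (F s * D s)) by exact: rintZ iFD.
have i3 := rintD i1 iA.
have -> : 2 * (c * I - \int[mu]_s (F s * D s)) =
    \int[mu]_s ((c * F s ^+ 2 + A s) - 2 * (F s * D s)).
  rewrite RintegralB// RintegralD// !RintegralZl//.
  rewrite (_ : \int[mu]_x A x = c * I); last by rewrite /Rintegral int_A.
  by rewrite (_ : \int[mu]_x F x ^+ 2 = I)//; ring.
rewrite EFin_Rintegral; last exact: rintB.
by apply: eq_integral => s _; congr (_%:E); ring.
Qed.

Let w r := fine (int2 mu (fun s => F s - F (s - r))).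

Lemma int2_diff_le r : (int2 mu (fun s => F s - F (s - r))%R <= (4 * I)%:E)%E.
Proof.
have mFr := measurable_shift r mF.
have mNFr : measurable_fun setT (fun s : R => (-1) * F (s - r)) by meas.
have -> : (fun s => F s - F (s - r)) = (fun s => F s + (-1) * F (s - r)).
  by apply/funext => s; ring.
apply: (le_trans (@int2D_le _ _ _ mu _ _ mF mNFr)).
have -> : int2 mu (fun s : R => (-1) * F (s - r)) = I%:E.
  rewrite -IE -(int2_shift r mF) /int2; apply: eq_integral => s _; congr (_%:E); ring.
by rewrite IE -!EFinM -EFinD lee_fin; lra.
Qed.

Lemma int2_diffE r : int2 mu (fun s => F s - F (s - r)) = (w r)%:E.
Proof.
rewrite fineK// fin_numElt (lt_le_trans _ (int2_ge0 mu _))//=.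
by rewrite (le_lt_trans (int2_diff_le r))// ltry.
Qed.

Lemma modulus_bounds r : 0 <= w r <= 4 * I.
Proof. by rewrite -!lee_fin -int2_diffE int2_ge0 int2_diff_le. Qed.

Lemma measurable_modulus : measurable_fun setT w.
Proof.
apply: (measurableT_comp (@fine_measurable _ setT measurableT)) => //.
apply: (@measurable_int1 _ _ _ _ R mu (fun z : R * R => ((F z.2 - F (z.2 - z.1)) ^+ 2)%:E)).
  by apply/measurable_EFinP; meas.
by move=> z; rewrite lee_fin sqr_ge0.
Qed.

(** With t = s - r, and then r scaled by eps, the kernel becomes the fixed function [poisson a 1],
    and eps survives only in the argument of the squared L^2 modulus of continuity [w]. As [w] is at
    most 4 I and tends to 0 at 0, dominated convergence will apply. *)
Lemma energy_modulus : (\int[mu]_s \int[mu]_t ((F s - F t) ^+ 2 * P (s - t))%:E =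
  \int[mu]_r (poisson a 1 r * w (eps * r))%:E)%E.
Proof.
have mw := measurable_modulus.
transitivity (\int[mu]_s \int[mu]_r ((F s - F (s - r)) ^+ 2 * P r)%:E)%E.
  apply: eq_integral => s _.
  rewrite -(@ge0_integral_reflect R s (fun r => ((F s - F (s - r)) ^+ 2 * P r)%:E)).
  - by apply: eq_integral => t _; rewrite opprB addrCA subrr addr0.
  - by apply/measurable_EFinP; meas.
  - by move=> x; rewrite lee_fin mulr_ge0// sqr_ge0.
rewrite (@fubini_tonelli _ _ _ _ R mu mu (fun z : R * R => ((F z.1 - F (z.1 - z.2)) ^+ 2 * P z.2)%:E)); last 2 first.
- by apply/measurable_EFinP; meas.
- by move=> z; rewrite lee_fin mulr_ge0// sqr_ge0.
transitivity (\int[mu]_r (P r * w r)%:E)%E.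
  apply: eq_integral => r _ /=; under eq_integral do rewrite mulrC.
  by rewrite int_Z -/(int2 _ _) ?int2_diffE//; [by meas|by move=> x; exact: sqr_ge0].
have w0 r : 0 <= w r by case/andP: (modulus_bounds r).
have p1 x : 0 <= poisson a 1 x by apply: ltW; exact: poisson_gt0.
have mp1 := @measurable_poisson R a 1 ltr01.
transitivity (\int[mu]_r (eps^-1 * (poisson a 1 (r / eps) * w (eps * (r / eps))))%:E)%E.
  apply: eq_integral => r _; congr (_%:E); rewrite /P poisson_scale// (_ : eps * (r / eps) = r).
    by ring.
  by field; rewrite gt_eqF.
have mpw : measurable_fun setT (fun r : R => poisson a 1 r * w (eps * r)) by meas.
rewrite int_Z; last 3 first.
- by rewrite invr_ge0 ltW.
- by apply: (@measurable_compT _ _ _ (fun r : R => poisson a 1 r * w (eps * r)) (fun r : R => r / eps) mpw); meas.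
- by move=> x; rewrite mulr_ge0.
rewrite (@ge0_integral_scale R eps (fun r => (poisson a 1 r * w (eps * r))%:E))//; last 2 first.
- exact/measurable_EFinP.
- by move=> x; rewrite lee_fin mulr_ge0.
by rewrite muleA -EFinM mulVf ?gt_eqF// mul1e.
Qed.

End Energy.

(** Along eps = 1/(n + 1) the weighted integrals increase to the left-hand side, by monotone
    convergence, and tend to c int F^2, because the energy tends to 0. *)
Theorem plancherel_real : (\int[mu]_xi (C xi ^+ 2 + S xi ^+ 2)%:E = c%:E * int2 mu F)%E.
Proof.
pose eps (n : nat) : R := n.+1%:R^-1.
have e0 n : 0 < eps n by rewrite invr_gt0.
pose w r := fine (int2 mu (fun s => F s - F (s - r))).
have mQ : measurable_fun setT (fun xi => C xi ^+ 2 + S xi ^+ 2) by meas.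
have Q0 xi : 0 <= C xi ^+ 2 + S xi ^+ 2 by rewrite addr_ge0// sqr_ge0.
have Qle xi : C xi ^+ 2 + S xi ^+ 2 <= 2 * N ^+ 2.
  rewrite mulr_natl mulr2n -(real_normK (num_real (C xi))) -(real_normK (num_real (S xi))).
  by apply: lerD; rewrite ler_sqr ?nnegrE.
have p1 x : 0 <= poisson a 1 x by apply: ltW; exact: poisson_gt0.
have eps0 : eps n @[n --> \oo] --> (0 : R) by exact: cvg_harmonic.
have wnd : (\int[mu]_r (poisson a 1 r * w (eps n * r))%:E)%E @[n --> \oo] --> 0%E.
  apply: (@dominated_kernel_cvg0 R _ _ mu (poisson a 1) (fun n r => w (eps n * r)) (4 * I)) => //.
  - apply: rintP; first exact: measurable_poisson.
    by under eq_integral do rewrite ger0_norm//; rewrite int_poisson1// ltry.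
  - by move=> n; apply: (measurable_compT measurable_modulus); meas.
  - by move=> n r; exact: modulus_bounds.
  - move=> r; apply/cvgrPdist_le => e h.
    have [dl dl0 hdl] := translation_L2 mF F2 h.
    have : eps n * r @[n --> \oo] --> (0 : R).
      by rewrite -(mul0r r); apply: cvgM; [exact: eps0|exact: cvg_cst].
    move=> /cvgrPdist_le /(_ _ dl0); apply: filterS => n; rewrite !sub0r !normrN => hn.
    have := hdl _ hn; rewrite int2_diffE lee_fin ger0_norm//.
    by case/andP: (modulus_bounds (eps n * r)).
have lhs n : (\int[mu]_xi (expR (- eps n * `|xi|) * (C xi ^+ 2 + S xi ^+ 2))%:E =
    (c * I)%:E - (2^-1)%:E * \int[mu]_r (poisson a 1 r * w (eps n * r))%:E)%E.
  rewrite -(@energy_modulus _ (e0 n)) (@energyE _ (e0 n)) -EFinM -EFinB.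
  have hr : rint mu (fun xi => expR (- eps n * `|xi|) * (C xi ^+ 2 + S xi ^+ 2)).
    apply: (@rint_le _ _ _ mu _ (fun xi => 2 * N ^+ 2 * expR (- eps n * `|xi|))).
    - by meas.
    - by apply: rintZ; exact: rint_expw.
    - by move=> xi; rewrite ger0_norm ?mulr_ge0 ?expR_ge0// mulrC ler_wpM2r ?expR_ge0.
  rewrite -(EFin_Rintegral hr) (poisson_transform (e0 n)).
  by congr (_%:E); field.
have l1 : (\int[mu]_xi (expR (- eps n * `|xi|) * (C xi ^+ 2 + S xi ^+ 2))%:E)%E @[n --> \oo] --> (c * I)%:E.
  rewrite (funext lhs).
  rewrite -[X in _ --> X]sube0 -[X in (_ - X)%E](mule0 (2^-1)%:E).
  apply: cvgeB => //; first exact: cvg_cst.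
  by apply: cvgeZl => //.
have l2 : (\int[mu]_xi (expR (- eps n * `|xi|) * (C xi ^+ 2 + S xi ^+ 2))%:E)%E @[n --> \oo] -->
    (\int[mu]_xi (C xi ^+ 2 + S xi ^+ 2)%:E)%E.
  have -> : (\int[mu]_xi (C xi ^+ 2 + S xi ^+ 2)%:E =
     \int[mu]_xi (limn (fun n => (expR (- eps n * `|xi|) * (C xi ^+ 2 + S xi ^+ 2))%:E)))%E.
    apply: eq_integral => xi _; apply/esym/cvg_lim => //; apply: cvg_EFin; first exact: nearW.
    rewrite -[X in _ --> X]mul1r; apply: cvgM; last exact: cvg_cst.
    rewrite -expR0 -[X in expR X](mul0r `|xi|) -oppr0.
    apply: (cvg_comp (fun n => - eps n * `|xi|) expR); last exact: continuous_expR.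
    by apply: cvgM; [apply: cvgN; exact: eps0|exact: cvg_cst].
  apply: (@cvg_monotone_convergence _ _ R mu setT measurableT
    (fun n xi => (expR (- eps n * `|xi|) * (C xi ^+ 2 + S xi ^+ 2))%:E)).
  - by move=> n; apply/measurable_EFinP; meas.
  - by move=> n x _; rewrite lee_fin mulr_ge0 ?expR_ge0.
  - move=> x _ m n mn; rewrite lee_fin ler_wpM2r// ler_expR ler_wpM2r// lerN2.
    by rewrite lef_pV2 ?posrE// ler_nat ltnS.
rewrite IE -EFinM; exact: (cvg_unique _ l2 l1).
Qed.

End Plancherel.

(** * Completeness of real L2 spaces *)

Section RealL2.
Context {R : realType} d (T : measurableType d) (m : {measure set T -> \bar R}).
Implicit Types (f g : T -> R).

Lemma Lfun2P f : f \in Lfun m 2%:E <-> measurable_fun setT f /\ (int2 m f < +oo)%E.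
Proof.
have E : ('N[m]_2%:E[EFin \o f] `^ 2 = int2 m f)%E.
  rewrite powR_Lnorm ?pnatr_eq0// /int2; apply: eq_integral => x _.
  by rewrite -[(EFin \o f) x]/((f x)%:E) abse_EFin poweR_EFin powR_mulrn// real_normK ?num_real.
split.
  move=> h; have mf : measurable_fun setT f by move: h => /andP[]; rewrite inE.
  split => //; have := Lfun2_integrable_sqr h => /integrableP[_].
  by under eq_integral do rewrite gee0_abs ?lee_fin ?sqr_ge0//.
move=> [mf f2]; apply/andP; split; rewrite inE//= /finite_norm.
rewrite ltNge leye_eq; apply/negP => /eqP h.
by move: f2; rewrite -E h poweRyr ?pnatr_eq0// ltxx.
Qed.

Lemma int2_eq0 f : measurable_fun setT f -> int2 m f = 0%E -> {ae m, forall x, f x = 0}.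
Proof.
move=> mf; rewrite /int2.
have := @ae_eq_integral_abs _ _ R m setT measurableT (fun x => (f x ^+ 2)%:E).
move=> [|h _ h0]; first by apply/measurable_EFinP; exact: measurable_funX.
have /h : (\int[m]_x `|(f x ^+ 2)%:E| = 0)%E.
  by under eq_integral do rewrite gee0_abs ?lee_fin ?sqr_ge0//.
move=> [N [mN N0 sN]]; exists N; split => // x /= fx; apply: sN => /= h1.
by apply: fx; have := h1 I => -[] /eqP; rewrite sqrf_eq0 => /eqP.
Qed.

Lemma int2_opp f : int2 m (fun x => - f x) = int2 m f.
Proof. by apply: eq_integral => x _; rewrite sqrrN. Qed.

Lemma int2B_sym f g : int2 m (fun x => f x - g x) = int2 m (fun x => g x - f x).
Proof. by apply: eq_integral => x _; congr (_%:E); ring. Qed.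

Lemma int2_lty_D f g : measurable_fun setT f -> measurable_fun setT g ->
  (int2 m f < +oo)%E -> (int2 m g < +oo)%E -> (int2 m (fun x => f x + g x)%R < +oo)%E.
Proof.
move=> mf mg f2 g2; apply: (le_lt_trans (int2D_le m mf mg)).
by rewrite lte_add_pinfty// lte_mul_pinfty.
Qed.

Lemma ae_finite_int (F : T -> \bar R) : measurable_fun setT F -> (forall x, (0 <= F x)%E) ->
  (\int[m]_x F x < +oo)%E -> {ae m, forall x, (F x < +oo)%E}.
Proof.
move=> mF F0 iF.
have iF' : m.-integrable setT F.
  apply/integrableP; split => //; under eq_integral do rewrite gee0_abs//.
  by [].
have [N [mN N0 sN]] := integrable_ae measurableT iF'.
exists N; split => // x /= h; apply: sN => /= h1; apply: h.
by move: (h1 I); rewrite fin_numElt => /andP[].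
Qed.

(** A subsequence with |u_(s(k+1)) - u_(s(k))|^2 <= 4^(-k) converges almost everywhere; Fatou's
    lemma along it gives convergence of the whole sequence. *)
Theorem L2_complete (u : nat -> T -> R) :
  (forall n, measurable_fun setT (u n)) -> (forall n, (int2 m (u n) < +oo)%E) ->
  (forall eps : R, 0 < eps -> exists N, forall k n, (N <= n <= k)%N ->
     (int2 m (fun x => u k x - u n x)%R <= eps%:E)%E) ->
  exists v, [/\ measurable_fun setT v, (int2 m v < +oo)%E &
    forall eps : R, 0 < eps -> exists N, forall n, (N <= n)%N ->
     (int2 m (fun x => u n x - v x)%R <= eps%:E)%E].
Proof.
move=> mu_ u2 cau.
have p4 k : 0 < (4 ^- k : R) by rewrite invr_gt0 exprn_gt0.
have /choice[N0 hN0] : forall k : nat, exists N, forall j n, (N <= n <= j)%N ->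
     (int2 m (fun x => u j x - u n x)%R <= (4 ^- k)%:E)%E by move=> k; exact: cau.
pose s := fix s k := if k is j.+1 then maxn (s j).+1 (N0 j.+1) else N0 0%N.
have sN k : (N0 k <= s k)%N by case: k => //= k; rewrite leq_maxr.
have sS k : (s k < s k.+1)%N by rewrite /= leq_maxl.
have sk k : (k <= s k)%N.
  by elim: k => // k IH; exact: leq_trans (sS k).
have h1 k : (int2 m (fun x => u (s k.+1) x - u (s k) x)%R <= (4 ^- k)%:E)%E.
  by apply: hN0; rewrite sN (ltnW (sS k)).
pose dd k x := u (s k.+1) x - u (s k) x.
have mdd k : measurable_fun setT (dd k) by exact: measurable_funB.
(* Weighted squares take the place of the sum of the |dd_k|, so that Minkowski's inequality is
   avoided: the integral of B is at most sum_k 2^k 4^(-k) = 2, and |d| <= 2^(-k) + 2^k d^2 recovers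
   absolute convergence. *)
pose B x := (\sum_(0 <= k <oo) (2 ^+ k * dd k x ^+ 2)%:E)%E.
have B0 k x : (0 <= (2 ^+ k * dd k x ^+ 2)%:E)%E.
  by rewrite lee_fin mulr_ge0 ?sqr_ge0// exprn_ge0.
have mBk k : measurable_fun setT (fun x => (2 ^+ k * dd k x ^+ 2)%:E).
  by apply/measurable_EFinP; apply: measurable_funM => //; exact: measurable_funX.
have iB : (\int[m]_x B x <= 2%:E)%E.
  rewrite integral_nneseries//.
  apply: (@le_trans _ _ (\sum_(0 <= k <oo) (geometric 1 (2^-1) k)%:E)%E).
    apply: lee_nneseries => [k _ _|k _]; first exact: integral_ge0.
    rewrite int_Z; [|by rewrite exprn_ge0|exact: measurable_funX|by move=> x; exact: sqr_ge0].
    apply: (@le_trans _ _ ((2 ^+ k)%:E * (4 ^- k)%:E)%E).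
      by apply: lee_wpmul2l; [rewrite lee_fin exprn_ge0|exact: h1].
    rewrite -EFinM lee_fin /= mul1r (_ : 4 = 2 * 2 :> R); last by ring.
    by rewrite exprMn invfM mulrA divff ?mul1r ?exprVn// expf_neq0.
  have g : series (geometric (1 : R) (2^-1)) @ \oo --> (1 : R) / (1 - 2^-1).
    by apply: cvg_geometric_series; rewrite ger0_norm ?invf_lt1// ltr1n.
  rewrite [leRHS](_ : 2%:E = (1 / (1 - 2^-1))%:E :> \bar R); last by congr (_%:E); field.
  have -> : (\sum_(0 <= k <oo) (geometric 1 (2^-1 : R) k)%:E)%E = ((1 : R) / (1 - 2^-1))%:E; last by [].
  apply/cvg_lim => //; under eq_fun do rewrite sumEFin.
  by apply: cvg_EFin; [exact: nearW|exact: g].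
have mB : measurable_fun setT B.
  by apply: ge0_emeasurable_sum => //.
have B0' x : (0 <= B x)%E by apply: nneseries_ge0.
have aeB : {ae m, forall x, (B x < +oo)%E}.
  by apply: ae_finite_int => //; apply: le_lt_trans iB _; rewrite ltry.
(* The upper limit is measurable on the whole space and is the limit wherever B is finite. *)
pose v x := fine (limn_esup (fun k => (u (s k) x)%:E)).
have mv : measurable_fun setT v.
  apply: (measurableT_comp (@fine_measurable _ setT measurableT)) => //.
  by apply: measurable_fun_limn_esup => k; exact/measurable_EFinP.
have cv x : (B x < +oo)%E -> u (s k) x @[k --> \oo] --> v x.
  move=> Bx.
  have Bfin : B x \is a fin_num by rewrite fin_numElt Bx (lt_le_trans _ (B0' x)).
  have : cvgn (series (fun k => dd k x)).
    apply: normed_cvg; apply: (@series_le_cvg R _ (fun k => 2^-1 ^+ k + 2 ^+ k * dd k x ^+ 2)) => //.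
    - by move=> k; exact: normr_ge0.
    - by move=> k; apply: addr_ge0; [rewrite exprn_ge0// invr_ge0|rewrite mulr_ge0 ?sqr_ge0 ?exprn_ge0].
    - move=> k; rewrite exprVn; have p2 : 0 < (2 ^+ k : R) by rewrite exprn_gt0.
      have [h|h] := leP `|dd k x| (2 ^- k).
        by apply: (le_trans h); rewrite lerDl mulr_ge0 ?sqr_ge0// ltW.
      have h' : 1 <= 2 ^+ k * `|dd k x|.
        by rewrite -[leLHS](@divff _ (2 ^+ k)) ?gt_eqF// ler_pM2l// ltW.
      rewrite -(real_normK (num_real (dd k x))) expr2 mulrA.
      apply: (@le_trans _ _ (2 ^+ k * `|dd k x| * `|dd k x|)); last by rewrite lerDr invr_ge0 ltW.
      by rewrite /= -[leLHS]mul1r; apply: ler_wpM2r.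
    - rewrite (_ : series _ = series (geometric 1 (2^-1)) \+ series (fun k => 2 ^+ k * dd k x ^+ 2)); last first.
        by apply/funext => n; rewrite /series /= -big_split; apply: eq_bigr => i _; rewrite /= mul1r.
      apply: is_cvgD; first by apply: is_cvg_geometric_series; rewrite ger0_norm ?invf_lt1// ltr1n.
      apply: nondecreasing_is_cvgn.
        by apply/nondecreasing_seqP => n; rewrite /series /= big_nat_recr//= lerDl; have := B0 n x; rewrite lee_fin.
      exists (fine (B x)) => _ [n _ <-]; rewrite -lee_fin fineK// /series /= -sumEFin.
      by apply: nneseries_lim_ge.
  have -> : series (fun k => dd k x) = (fun n => u (s n) x - u (s 0) x).
    apply/funext => n; rewrite /series /=.
    by rewrite (telescope_sumr (fun k => u (s k) x)).
  move=> /cvg_ex[l hl].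
  have ul : u (s k) x @[k --> \oo] --> l + u (s 0) x.
    rewrite (_ : (fun k => u (s k) x) = (fun k => (u (s k) x - u (s 0) x) + u (s 0) x)).
      by apply: cvgD => //; exact: cvg_cst.
    by apply/funext => k; rewrite subrK.
  have el : (u (s k) x)%:E @[k --> \oo] --> (l + u (s 0) x)%:E.
    by apply: cvg_EFin => //; exact: nearW.
  by rewrite /v (cvg_limn_einf_sup el).2.
have key (eps : R) : 0 < eps -> exists N, forall n, (N <= n)%N ->
     (int2 m (fun x => u n x - v x)%R <= eps%:E)%E.
  move=> e0; have [N hN] := cau _ e0; exists N => n Nn.
  have -> : int2 m (fun x => u n x - v x) =
      (\int[m]_x limn_einf (fun k => ((u n x - u (s k) x) ^+ 2)%:E))%E.
    apply: ge0_ae_eq_integral => //.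
    - by apply/measurable_EFinP; apply: measurable_funX; exact: measurable_funB.
    - rewrite /limn_einf; apply: measurableT_comp => //; apply: measurable_fun_limn_esup => k.
      apply: measurableT_comp => //; apply/measurable_EFinP.
      by apply: measurable_funX; exact: measurable_funB.
    - by move=> x _; rewrite lee_fin sqr_ge0.
    - move=> x _; rewrite limn_einf_lim; apply: lime_ge; first exact: is_cvg_einfs.
      by apply: nearW => k; apply: le_ereal_inf_tmp => _ [j _ <-]; rewrite lee_fin sqr_ge0.
    apply: filterS aeB => x /cv h _.
    apply/esym; apply: (cvg_limn_einf_sup _).1.
    apply: cvg_EFin; first exact: nearW.
    by rewrite expr2; under eq_fun do rewrite /= expr2; apply: cvgM; (apply: cvgB; [exact: cvg_cst|exact: h]).
  apply: (le_trans (fatou _ _ _ _)) => //.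
  - by move=> k; apply/measurable_EFinP; apply: measurable_funX; exact: measurable_funB.
  - by move=> k x _; rewrite lee_fin sqr_ge0.
  rewrite limn_einf_lim; apply: lime_le; first exact: is_cvg_einfs.
  (* The index [maxn k n] is at least k, as the infimum requires, and its image under [s] is at
     least n, as the Cauchy bound requires. *)
  apply: nearW => k; apply: ge_ereal_inf; exists (int2 m (fun x => u n x - u (s (maxn k n)) x)).
    by exists (maxn k n) => //=; exact: leq_maxl.
  by rewrite int2B_sym; apply: hN; rewrite Nn (leq_trans (leq_maxr k n))// sk.
exists v; split => //.
have [N hN] := key _ ltr01.
rewrite (_ : v = (fun x => u N x + - (u N x - v x))); last by apply/funext => x; ring.
apply: int2_lty_D => //; first by apply: measurable_funN; exact: measurable_funB.
by rewrite int2_opp (le_lt_trans (hN N (leqnn N)))// ltry.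
Qed.

End RealL2.

(** * The complex space L2 *)

Section AlmostEverywhere.
Context {R : realType} d (T : measurableType d) (m : {measure set T -> \bar R}).

Lemma aeS (P Q : T -> Prop) : (forall x, P x -> Q x) ->
  {ae m, forall x, P x} -> {ae m, forall x, Q x}.
Proof. exact: filterS. Qed.

Lemma aeS2 (P Q S : T -> Prop) : (forall x, P x -> Q x -> S x) ->
  {ae m, forall x, P x} -> {ae m, forall x, Q x} -> {ae m, forall x, S x}.
Proof. exact: filterS2. Qed.

Lemma ae_forall_nat (P : nat -> T -> Prop) : (forall n, {ae m, forall x, P n x}) ->
  {ae m, forall x, forall n, P n x}.
Proof. by move=> h; apply: ae_foralln. Qed.

End AlmostEverywhere.

Section Intervals.
Context {R : realType}.
Notation mu := (@lebesgue_measure R).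

Lemma int2_indic_itv (a b : R) : (int2 mu (\1_(`[a, b]) : R -> R) < +oo)%E.
Proof.
rewrite /int2.
under eq_integral do rewrite indicE expr2 -natrM mulnb andbb -indicE.
rewrite integral_indic//= ?setIT ?lebesgue_measure_itv//=.
by case: ifP => _; rewrite -?EFinB ltry.
Qed.

(** The primitive of f from -n is continuous and vanishes at rational points, hence on ]-n, n[; by
    Lebesgue differentiation its derivative is f almost everywhere. Cutting f off outside [-n, n]
    makes it integrable, and rational endpoints keep the test family countable. *)
Lemma ae_eq0_itv (f : R -> R) : measurable_fun setT f -> (int2 mu f < +oo)%E ->
  (forall (n : nat) (q : rat), \int[mu]_t (f t * \1_(`[- n%:R, ratr q]) t) = 0) ->
  {ae mu, forall x, f x = 0}.
Proof.
move=> mf f2 h0.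
have mI a b : measurable_fun setT (\1_(`[a, b]%classic) : R -> R) by exact: measurable_indic.
pose fn n t := f t * \1_(`[- n%:R, n%:R]) t.
have ifn n : rint mu (fn n) by apply: rint_mul_L2 => //; exact: int2_indic_itv.
have lfn n : locally_integrable setT (fn n) by apply: open_integrable_locally; [exact: openT|exact: ifn].
suff H n : {ae mu, forall x, - n%:R < x < n%:R -> f x = 0}.
  apply: aeS (ae_forall_nat H) => x hx; apply: (hx (Num.bound `|x|)).
  by rewrite -ltr_norml; exact: archi_boundP.
apply: aeS (lebesgue_differentiation (lfn n)) => x lx /andP[nx xn].
have n0 : - n%:R < n%:R :> R by exact: lt_trans xn.
pose F y := \int[mu]_(t in `[- n%:R, y]) fn n t.
have F0q (q : rat) : ratr q <= n%:R :> R -> F (ratr q) = 0.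
  move=> qn; rewrite /F Rintegral_mkcond -[RHS](h0 n q); apply: eq_Rintegral => t _.
  rewrite patchE /fn !indicE !mem_setE !in_itv/=.
  case: (leP (- n%:R) t) => //= _; last by rewrite mulr0.
  by have [tq|_] := leP t (ratr q); rewrite ?mulr0// (le_trans tq qn) mulr1.
have cF : {within `[- n%:R, n%:R], continuous F}.
  apply: parameterized_integral_continuous; first exact: ltW.
  by apply: integrableS (ifn n).
have F0 y : - n%:R < y < n%:R -> F y = 0.
  move=> /andP[ny yn].
  have cy : {for y, continuous F}.
    by apply: (within_continuous_continuous n0 cF); rewrite in_itv/= ny.
  apply/eqP/negPn/negP => Fy.
  move/cvgrPdist_lt: cy => /(_ `|F y|); rewrite normr_gt0 => /(_ Fy) /nbhs_ballP[e /= e0 he].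
  have /rat_in_itvoo[q] : Num.max (- n%:R) (y - e) < Num.min n%:R (y + e).
    by rewrite lt_min !gt_max; apply/andP; split; apply/andP; split; [exact: n0|lra|apply: (lt_trans ny); rewrite ltrDl|lra].
  rewrite in_itv/= lt_min gt_max => /andP[/andP[nq yq] /andP[qn qy]].
  have /he : ball y e (ratr q : R) by rewrite /ball/= ltr_norml; apply/andP; split; lra.
  by rewrite /= F0q ?subr0 ?ltxx// ltW.
have iN : mu.-integrable `[- n%:R, n%:R] (EFin \o fn n) by apply: integrableS (ifn n).
have [] := @FTC1_lebesgue_pt R (fn n) (BLeft (- n%:R)) x n%:R xn iN _ lx.
  by rewrite /= lte_fin.
move=> _.
rewrite -/F derive1E (@near_eq_derive _ _ _ F (cst 0))//.
  rewrite derive_cst /fn indicE mem_setE /= in_itv/= (ltW nx) (ltW xn) mulr1 => <- //.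
near=> y; rewrite F0//; apply/andP; split; near: y; [exact: lt_nbhsr|exact: lt_nbhsl].
Unshelve. all: by end_near. Qed.

End Intervals.

Section ComplexIntegral.
Context {R : realType} d (T : measurableType d) (m : {measure set T -> \bar R}).
Local Notation C := R[i].
Implicit Types F G : T -> C.

Definition cmeas F := measurable_fun setT (fun x => complex.Re (F x)) /\
  measurable_fun setT (fun x => complex.Im (F x)).
Definition crint F := rint m (fun x => complex.Re (F x)) /\ rint m (fun x => complex.Im (F x)).

Lemma cmeasD F G : cmeas F -> cmeas G -> cmeas (fun x => F x + G x).
Proof.
move=> [f1 f2] [g1 g2]; split.
  rewrite (funext (fun x => ReD (F x) (G x))); exact: measurable_funD.
rewrite (funext (fun x => ImD (F x) (G x))); exact: measurable_funD.
Qed.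

Lemma cmeasM F G : cmeas F -> cmeas G -> cmeas (fun x => F x * G x).
Proof.
move=> [f1 f2] [g1 g2]; split.
  by rewrite (funext (fun x => ReM (F x) (G x))); apply: measurable_funB; exact: measurable_funM.
by rewrite (funext (fun x => ImM (F x) (G x))); apply: measurable_funD; exact: measurable_funM.
Qed.

Lemma cmeasJ F : cmeas F -> cmeas (fun x => conjc (F x)).
Proof.
move=> [f1 f2]; split; first by rewrite (funext (fun x => ReJ (F x))).
by rewrite (funext (fun x => ImJ (F x))); exact: measurable_funN.
Qed.

Lemma cmeas_cst (c : C) : cmeas (fun _ => c).
Proof. by split; exact: measurable_cst. Qed.

Lemma cmeas_real (f : T -> R) : measurable_fun setT f -> cmeas (fun x => (f x)%:C).
Proof. by move=> mf; split => //=; exact: measurable_cst. Qed.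

Lemma measurable_sqn F : cmeas F -> measurable_fun setT (fun x => sqn (F x)).
Proof. by move=> [f1 f2]; apply: measurable_funD; exact: measurable_funX. Qed.

Lemma crint_cmeas F : crint F -> cmeas F.
Proof. by move=> [/rint_meas f1 /rint_meas f2]. Qed.

Lemma crintZ c F : crint F -> crint (fun x => c * F x).
Proof.
move=> [f1 f2]; split.
  by rewrite (funext (fun x => ReM c (F x))); apply: rintB; exact: rintZ.
by rewrite (funext (fun x => ImM c (F x))); apply: rintD; exact: rintZ.
Qed.

Lemma crint_le F (g : T -> R) : cmeas F -> rint m g -> (forall x, sqn (F x) <= g x ^+ 2) ->
  (forall x, 0 <= g x) -> crint F.
Proof.
move=> [f1 f2] ig h g0; split; apply: rint_le ig _ => // x.
  by rewrite -(@ler_pXn2r _ 2)// ?nnegrE// real_normK ?num_real// (le_trans (sqr_Re_le _)).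
by rewrite -(@ler_pXn2r _ 2)// ?nnegrE// real_normK ?num_real// (le_trans (sqr_Im_le _)).
Qed.

Lemma cintegralD F G : crint F -> crint G ->
  cintegral m (fun x => F x + G x) = cintegral m F + cintegral m G.
Proof.
move=> [f1 f2] [g1 g2]; apply: complex_eq; rewrite ?ReD ?ImD/= -RintegralD//;
  by apply: eq_Rintegral => x _; rewrite ?ReD ?ImD.
Qed.

Lemma cintegralZ c F : crint F -> cintegral m (fun x => c * F x) = c * cintegral m F.
Proof.
move=> [f1 f2]; have Z a f : rint m f -> a * \int[m]_x f x = \int[m]_x (a * f x).
  by move=> h; rewrite RintegralZl.
apply: complex_eq; rewrite ?ReM ?ImM /cintegral [LHS]/= [RHS]/= !Z//.
  by rewrite -RintegralB//; [apply: eq_Rintegral => x _; rewrite ReM|exact: rintZ|exact: rintZ].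
by rewrite -RintegralD//; [apply: eq_Rintegral => x _; rewrite ImM|exact: rintZ|exact: rintZ].
Qed.

Lemma cintegralJ F : crint F -> cintegral m (fun x => conjc (F x)) = conjc (cintegral m F).
Proof.
move=> [f1 f2]; apply: complex_eq; rewrite ?ReJ ?ImJ/=.
  by apply: eq_Rintegral => x _; rewrite ReJ.
rewrite -mulN1r -RintegralZl//; apply: eq_Rintegral => x _; by rewrite ImJ mulN1r.
Qed.

Lemma cintegral_real (f : T -> R) : cintegral m (fun x => (f x)%:C) = (\int[m]_x f x)%:C.
Proof. by apply: complex_eq; rewrite //= /Rintegral integral0. Qed.

Lemma Rintegral_ae (f g : T -> R) : measurable_fun setT f -> measurable_fun setT g ->
  {ae m, forall x, f x = g x} -> \int[m]_x f x = \int[m]_x g x.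
Proof.
move=> mf mg fg; rewrite /Rintegral; congr fine.
apply: ae_eq_integral => //; [exact/measurable_EFinP|exact/measurable_EFinP|].
by apply: aeS fg => x -> .
Qed.

Lemma cintegral_ae F G : cmeas F -> cmeas G -> {ae m, forall x, F x = G x} ->
  cintegral m F = cintegral m G.
Proof.
move=> [f1 f2] [g1 g2] h.
by apply: complex_eq => /=; apply: Rintegral_ae => //; apply: aeS h => x ->.
Qed.

Definition csqn F : \bar R := (\int[m]_x (sqn (F x))%:E)%E.

Definition cL2 F := cmeas F /\ (csqn F < +oo)%E.

Lemma csqnE F : cmeas F ->
  csqn F = (int2 m (fun x => complex.Re (F x)) + int2 m (fun x => complex.Im (F x)))%E.
Proof.
move=> [f1 f2]; rewrite -int_D; [by []|exact: measurable_funX|exact: measurable_funX|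
  by move=> x; exact: sqr_ge0|by move=> x; exact: sqr_ge0].
Qed.

Lemma csqn_ge0 F : (0 <= csqn F)%E.
Proof. by apply: int_ge0 => x; exact: sqn_ge0. Qed.

Lemma cL2_int2 F : cL2 F <-> [/\ cmeas F, (int2 m (fun x => complex.Re (F x)) < +oo)%E
   & (int2 m (fun x => complex.Im (F x)) < +oo)%E].
Proof.
split=> [[mF]|[mF h1 h2]]; last first.
  by split => //; rewrite csqnE// lte_add_pinfty.
rewrite csqnE// => h; split => //; apply: le_lt_trans h.
  by rewrite leeDl// int2_ge0.
by rewrite leeDr// int2_ge0.
Qed.

Lemma cL2_rint F : cL2 F -> rint m (fun x => sqn (F x)).
Proof.
move=> [mF F2]; apply: rintP; first exact: measurable_sqn.
by under eq_integral do rewrite ger0_norm ?sqn_ge0//.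
Qed.

Lemma cL2D F G : cL2 F -> cL2 G -> cL2 (fun x => F x + G x).
Proof.
move=> hF hG; split; first exact: cmeasD hF.1 hG.1.
have h : rint m (fun x => 2 * sqn (F x) + 2 * sqn (G x)).
  by apply: rintD; apply: rintZ; exact: cL2_rint.
apply: le_lt_trans (rint_lty h); apply: int_le.
- by apply: measurable_sqn; exact: cmeasD hF.1 hG.1.
- by apply: measurableT_comp => //; exact: rint_meas h.
- by move=> x; exact: sqn_ge0.
- by move=> x; apply: le_trans (ler_norm _); exact: sqnD_le.
Qed.

Lemma csqnZ c F : cmeas F -> csqn (fun x => c * F x) = ((sqn c)%:E * csqn F)%E.
Proof.
move=> mF; rewrite /csqn -int_Z; [|exact: sqn_ge0|exact: measurable_sqn|by move=> x; exact: sqn_ge0].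
by apply: eq_integral => x _; rewrite sqnM.
Qed.

Lemma cL2Z c F : cL2 F -> cL2 (fun x => c * F x).
Proof.
move=> [mF F2]; split; first by apply: cmeasM => //; exact: cmeas_cst.
by rewrite csqnZ// lte_mul_pinfty// lee_fin sqn_ge0.
Qed.

Lemma cL2_mul F G : cL2 F -> cL2 G -> crint (fun x => F x * conjc (G x)).
Proof.
move=> hF hG; apply: (@crint_le _ (fun x => sqn (F x) + sqn (G x))).
- by apply: cmeasM; [exact: hF.1|apply: cmeasJ; exact: hG.1].
- by apply: rintD; exact: cL2_rint.
- move=> x; rewrite sqnM sqnJ; have := sqn_ge0 (F x); have := sqn_ge0 (G x); nra.
- by move=> x; rewrite addr_ge0 ?sqn_ge0.
Qed.

Lemma csqn_eq0 F : cmeas F -> csqn F = 0%E -> {ae m, forall x, F x = 0}.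
Proof.
move=> mF; rewrite csqnE// => /eqP; rewrite padde_eq0 ?int2_ge0// => /andP[/eqP h1 /eqP h2].
apply: aeS2 (int2_eq0 mF.1 h1) (int2_eq0 mF.2 h2) => x e1 e2.
by apply: complex_eq; rewrite ?e1 ?e2.
Qed.

End ComplexIntegral.

Section L2Space.
Context {R : realType}.
Notation mu := (@lebesgue_measure R).
Local Notation C := R[i].
Implicit Types f g : R -> C.

Lemma vecsL2P f : vecs L2 f <-> cL2 mu f.
Proof.
rewrite cL2_int2 /=; split.
  by move=> [/Lfun2P[f1 f2] /Lfun2P[g1 g2]].
by move=> [[f1 f2] g1 g2]; split; apply/Lfun2P.
Qed.

Lemma L2_lin c f g : vecs L2 f -> vecs L2 g -> vecs L2 (c *: f + g).
Proof.
move=> /vecsL2P hf /vecsL2P hg; apply/vecsL2P.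
exact: cL2D (cL2Z c hf) hg.
Qed.

Lemma L2_0 : vecs L2 (0 : R -> C).
Proof.
apply/vecsL2P; split; first by split; exact: measurable_cst.
by rewrite /csqn; under eq_integral do rewrite sqn0; rewrite integral0 ltry.
Qed.

Lemma L2_B f g : vecs L2 f -> vecs L2 g -> vecs L2 (f - g).
Proof. by move=> hf hg; rewrite addrC -scaleN1r; exact: L2_lin. Qed.

Lemma L2_ipl c f g k : vecs L2 f -> vecs L2 g -> vecs L2 k ->
  ip L2 (c *: f + g) k = c * ip L2 f k + ip L2 g k.
Proof.
move=> /vecsL2P hf /vecsL2P hg /vecsL2P hk.
have h1 := cL2_mul hf hk; have h2 := cL2_mul hg hk.
rewrite /ip/= -cintegralZ// -cintegralD//; last exact: crintZ.
by congr cintegral; apply/funext => x; rewrite -[(c *: f + g) x]/(c * f x + g x); ring.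
Qed.

Lemma L2_ipC f g : vecs L2 f -> vecs L2 g -> ip L2 g f = conjc (ip L2 f g).
Proof.
move=> /vecsL2P hf /vecsL2P hg.
rewrite -[ip L2 f g]/(cintegral mu (fun t => f t * conjc (g t))) -cintegralJ; last exact: cL2_mul.
rewrite -[ip L2 g f]/(cintegral mu (fun t => g t * conjc (f t))).
by congr cintegral; apply/funext => x; rewrite rmorphM /= conjcK mulrC.
Qed.

Lemma L2_ipE f : ip L2 f f = (\int[mu]_t sqn (f t))%:C.
Proof.
rewrite -cintegral_real /ip/=; congr cintegral; apply/funext => x; exact: sqnE.
Qed.

Lemma L2_nsq f : vecs L2 f -> (nsq L2 f)%:E = csqn mu f.
Proof. by move=> /vecsL2P hf; rewrite /nsq L2_ipE /= EFin_Rintegral//; exact: cL2_rint. Qed.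

Lemma L2_nsq_ge0 f : 0 <= nsq L2 f.
Proof. by rewrite /nsq L2_ipE; apply: Rintegral_ge0 => x _; exact: sqn_ge0. Qed.

Lemma L2_nsq_eq0 f : vecs L2 f -> nsq L2 f = 0 -> {ae mu, forall t, f t = 0}.
Proof.
move=> hf h; have [mf _] := (vecsL2P f).1 hf.
by apply: csqn_eq0 => //; rewrite -L2_nsq// h.
Qed.

Lemma L2_ip_ae0 f g : vecs L2 f -> vecs L2 g -> {ae mu, forall t, f t = 0} -> ip L2 f g = 0.
Proof.
move=> /vecsL2P hf /vecsL2P hg h.
have -> : (0 : C) = cintegral mu (fun _ => (0 : R)%:C).
  by rewrite cintegral_real /Rintegral integral0.
apply: cintegral_ae.
- by have /crint_cmeas := cL2_mul hf hg.
- exact: cmeas_cst.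
- by apply: aeS h => t ->; rewrite mul0r.
Qed.

Lemma L2_complete_complex (u : nat -> R -> C) : (forall n, vecs L2 (u n)) ->
  (forall eps : R, 0 < eps -> exists N, forall m n, (N <= n <= m)%N -> nsq L2 (u m - u n) <= eps) ->
  exists2 f, vecs L2 f &
    forall eps : R, 0 < eps -> exists N, forall n, (N <= n)%N -> nsq L2 (u n - f) <= eps.
Proof.
move=> hu cau.
have hu' n := (cL2_int2 _ _).1 ((vecsL2P _).1 (hu n)).
have [v1 [mv1 v12 cv1]] : exists v, [/\ measurable_fun setT v, (int2 mu v < +oo)%E &
    forall eps : R, 0 < eps -> exists N, forall n, (N <= n)%N ->
     (int2 mu (fun x => complex.Re (u n x) - v x)%R <= eps%:E)%E].
  apply: L2_complete; [by move=> n; have [[]] := hu' n|by move=> n; have [] := hu' n|].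
  move=> eps /cau[N hN]; exists N => k n /hN; rewrite -lee_fin L2_nsq; last exact: L2_B.
  apply: le_trans; rewrite csqnE; last by have [] := (vecsL2P _).1 (L2_B (hu k) (hu n)).
  apply: le_trans (leeDl _ (int2_ge0 _ _)).
  by rewrite /int2; under [leRHS]eq_integral do rewrite -[(_ - _) _]/(u k _ - u n _) ReD ReN.
have [v2 [mv2 v22 cv2]] : exists v, [/\ measurable_fun setT v, (int2 mu v < +oo)%E &
    forall eps : R, 0 < eps -> exists N, forall n, (N <= n)%N ->
     (int2 mu (fun x => complex.Im (u n x) - v x)%R <= eps%:E)%E].
  apply: L2_complete; [by move=> n; have [[]] := hu' n|by move=> n; have [] := hu' n|].
  move=> eps /cau[N hN]; exists N => k n /hN; rewrite -lee_fin L2_nsq; last exact: L2_B.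
  apply: le_trans; rewrite csqnE; last by have [] := (vecsL2P _).1 (L2_B (hu k) (hu n)).
  apply: le_trans (leeDr _ (int2_ge0 _ _)).
  by rewrite /int2; under [leRHS]eq_integral do rewrite -[(_ - _) _]/(u k _ - u n _) ImD ImN.
pose v x := v1 x +i* v2 x.
have hv : vecs L2 v by apply/vecsL2P/cL2_int2; split.
exists v => // eps e0; have e2 : 0 < eps / 2 by rewrite divr_gt0.
have [N1 h1] := cv1 _ e2; have [N2 h2] := cv2 _ e2.
exists (maxn N1 N2) => n; rewrite geq_max => /andP[n1 n2].
rewrite -lee_fin L2_nsq ?csqnE; last exact: L2_B.
  rewrite [eps]splitr EFinD; apply: leeD.
    apply: le_trans (h1 _ n1); rewrite /int2.
    by under eq_integral do rewrite -[(_ - _) _]/(u n _ - v _) ReD ReN.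
  apply: le_trans (h2 _ n2); rewrite /int2.
  by under eq_integral do rewrite -[(_ - _) _]/(u n _ - v _) ImD ImN.
by have [] := (vecsL2P _).1 (L2_B (hu n) hv).
Qed.

Lemma L2_total : exists b : nat -> R -> C, (forall n, vecs L2 (b n)) /\
  forall f, vecs L2 f -> (forall n, ip L2 f (b n) = 0) -> {ae mu, forall t, f t = 0}.
Proof.
pose I (p : nat * rat) : R -> C := fun t => ((\1_(`[- p.1%:R, ratr p.2]) t : R))%:C.
have hI p : vecs L2 (I p).
  apply/vecsL2P/cL2_int2; split => /=.
  - by apply: cmeas_real; exact: measurable_indic.
  - exact: int2_indic_itv.
  - by rewrite /int2 expr0n/= integral0 ltry.
exists (fun n => if unpickle n is Some p then I p else 0); split.
  by move=> n; case: unpickle => [p|]; [exact: hI|exact: L2_0].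
move=> f /vecsL2P hf h.
have h' n q : ip L2 f (I (n, q)) = 0 by have := h (pickle (n, q)); rewrite pickleK.
have [mf f1 f2] := (cL2_int2 _ _).1 hf.
have g1 : {ae mu, forall t, complex.Re (f t) = 0}.
  apply: ae_eq0_itv mf.1 f1 _ => n q.
  have /(congr1 (@complex.Re R)) := h' n q; rewrite /ip/= => <-.
  by apply: eq_Rintegral => t _; rewrite ReM /=; ring.
have g2 : {ae mu, forall t, complex.Im (f t) = 0}.
  apply: ae_eq0_itv mf.2 f2 _ => n q.
  have /(congr1 (@complex.Im R)) := h' n q; rewrite /ip/= => <-.
  by apply: eq_Rintegral => t _; rewrite ImM /=; ring.
apply: aeS2 g1 g2 => x e1 e2; exact: complex_eq.
Qed.

End L2Space.

(** * Moyal's identity *)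

Section Plane.
Context {R : realType}.
Notation mu := (@lebesgue_measure R).
Local Notation C := R[i].

Lemma int_plane (f : R * R -> R) : measurable_fun setT f -> (forall z, 0 <= f z) ->
  (\int[plane_measure]_z (f z)%:E = \int[mu]_x \int[mu]_y (f (x, y))%:E)%E.
Proof.
move=> mf f0.
have mf' : measurable_fun setT (EFin \o f) by exact/measurable_EFinP.
have f0' : forall z, (0 <= (EFin \o f) z)%E by move=> z; rewrite lee_fin.
exact: (@fubini_tonelli1 _ _ _ _ R mu mu _ mf' f0').
Qed.

Lemma int_swap (f : R * R -> R) : measurable_fun setT f -> (forall z, 0 <= f z) ->
  (\int[mu]_x \int[mu]_y (f (x, y))%:E = \int[mu]_y \int[mu]_x (f (x, y))%:E)%E.
Proof.
move=> mf f0.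
have mf' : measurable_fun setT (EFin \o f) by exact/measurable_EFinP.
have f0' : forall z, (0 <= (EFin \o f) z)%E by move=> z; rewrite lee_fin.
exact: (@fubini_tonelli _ _ _ _ R mu mu _ mf' f0').
Qed.

Lemma cmeas_Rint d (T : measurableType d) (F : T * R -> C) : cmeas F ->
  cmeas (fun x => cintegral mu (fun t => F (x, t))).
Proof.
move=> [f1 f2]; split => /=.
  by have := measurable_Rint1 mu f1.
by have := measurable_Rint1 mu f2.
Qed.

Lemma cmeas_comp d (T : measurableType d) (f : R -> C) (g : T -> R) : cmeas f ->
  measurable_fun setT g -> cmeas (fun x => f (g x)).
Proof.
move=> [f1 f2] mg; split; first exact: (measurable_compT f1 mg).
exact: (measurable_compT f2 mg).
Qed.

Definition cis (a : R) : C := cos a +i* sin a.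

Lemma sqn_cis a : sqn (cis a) = 1.
Proof. by rewrite /sqn /= cos2Dsin2. Qed.

Lemma cmeas_cis d (T : measurableType d) (g : T -> R) : measurable_fun setT g ->
  cmeas (fun x => cis (g x)).
Proof. by move=> mg; split; rewrite /=; meas. Qed.

(** For P = U + i V the squared modulus of the transform is (C U + S V)^2 + (C V - S U)^2. Cosine
    transforms are even and sine transforms odd in xi, so adding the value at -xi removes the cross
    terms; hence the doubling and the final division by 2. *)
Theorem plancherel_complex a (P : R -> C) : 0 < a -> crint mu P -> (csqn mu P < +oo)%E ->
  (\int[mu]_xi (sqn (cintegral mu (fun t => (P t * conjc (cis (a * xi * t)))%R)))%:E =
   (2 * pi / a)%:E * csqn mu P)%E.
Proof.
move=> a0 iP P2; have mP := crint_cmeas iP.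
have [iU iV] := iP.
have [_ U2 V2] := (cL2_int2 _ _).1 (conj mP P2).
pose U t := complex.Re (P t); pose V t := complex.Im (P t).
have mU : measurable_fun setT U := mP.1.
have mV : measurable_fun setT V := mP.2.
pose CC F xi : R := \int[mu]_t (F t * cos (a * xi * t)).
pose SS F xi : R := \int[mu]_t (F t * sin (a * xi * t)).
have iC F xi : rint mu F -> rint mu (fun t => F t * cos (a * xi * t)).
  move=> iF; have mF := rint_meas iF.
  apply: (@rint_le _ _ _ mu _ _ _ (rint_norm iF)); first meas.
  by move=> t; exact/mul_trig_le/norm_cos_le1.
have iS F xi : rint mu F -> rint mu (fun t => F t * sin (a * xi * t)).
  move=> iF; have mF := rint_meas iF.
  apply: (@rint_le _ _ _ mu _ _ _ (rint_norm iF)); first meas.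
  by move=> t; exact/mul_trig_le/norm_sin_le1.
have E xi : sqn (cintegral mu (fun t => P t * conjc (cis (a * xi * t)))) =
    (CC U xi + SS V xi) ^+ 2 + (CC V xi - SS U xi) ^+ 2.
  rewrite /sqn; congr (_ ^+ 2 + _ ^+ 2); rewrite /cintegral /=.
    rewrite /CC /SS -RintegralD//; [|exact: iC|exact: iS].
    by apply: eq_Rintegral => t _; rewrite ReM /=; ring.
  rewrite /CC /SS -RintegralB//; [|exact: iC|exact: iS].
  by apply: eq_Rintegral => t _; rewrite ImM /=; ring.
have CN F xi : CC F (0 - xi) = CC F xi.
  by apply: eq_Rintegral => t _; rewrite sub0r mulrN mulNr cosN.
have SN F xi : rint mu F -> SS F (0 - xi) = - SS F xi.
  move=> iF; have -> : - SS F xi = \int[mu]_t ((-1) * (F t * sin (a * xi * t))).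
    by rewrite RintegralZl ?mulN1r//; exact: iS.
  by apply: eq_Rintegral => t _; rewrite sub0r (_ : a * - xi * t = - (a * xi * t)) ?sinN; ring.
have mCC F : measurable_fun setT F -> measurable_fun setT (CC F).
  move=> mF.
  have h : measurable_fun setT (fun p : R * R => F p.2 * cos (a * p.1 * p.2)) by meas.
  by have := measurable_Rint1 mu h.
have mSS F : measurable_fun setT F -> measurable_fun setT (SS F).
  move=> mF.
  have h : measurable_fun setT (fun p : R * R => F p.2 * sin (a * p.1 * p.2)) by meas.
  by have := measurable_Rint1 mu h.
pose Q xi := (CC U xi + SS V xi) ^+ 2 + (CC V xi - SS U xi) ^+ 2.
have mQ : measurable_fun setT Q.
  have h1 := mCC _ mU; have h2 := mCC _ mV; have h3 := mSS _ mU; have h4 := mSS _ mV.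
  by rewrite /Q; meas.
have Q0 xi : 0 <= Q xi by rewrite /Q addr_ge0 ?sqr_ge0.
under eq_integral do rewrite E -/(Q _).
have key : (\int[mu]_xi (Q xi)%:E + \int[mu]_xi (Q xi)%:E =
    2%:E * ((2 * pi / a)%:E * csqn mu P))%E.
  rewrite -{2}(@ge0_integral_reflect R 0 (EFin \o Q)); last 2 first.
  - exact/measurable_EFinP.
  - by move=> x; rewrite lee_fin.
  rewrite -int_D//; last 1 first.
    by apply: (measurable_compT mQ); meas.
  have -> : (\int[mu]_x (Q x + Q (0 - x))%:E = \int[mu]_x
     (2 * ((CC U x ^+ 2 + SS U x ^+ 2) + (CC V x ^+ 2 + SS V x ^+ 2)))%:E)%E.
    by apply: eq_integral => x _; rewrite /Q !CN !SN//; congr (_%:E); ring.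
  have h1 := mCC _ mU; have h2 := mCC _ mV; have h3 := mSS _ mU; have h4 := mSS _ mV.
  have sq0 (x y : R) : 0 <= x ^+ 2 + y ^+ 2 by rewrite addr_ge0 ?sqr_ge0.
  rewrite int_Z//; [|by meas|by move=> x; rewrite addr_ge0].
  rewrite int_D//; [|by meas|by meas].
  rewrite (plancherel_real a0 iU U2) (plancherel_real a0 iV V2) csqnE//.
  rewrite (ge0_muleDr _ (int2_ge0 _ _) (int2_ge0 _ _)).
  by [].
have : (2%:E * (\int[mu]_xi (Q xi)%:E) = 2%:E * ((2 * pi / a)%:E * csqn mu P))%E.
  by rewrite -key -[2%:E]/((1 + 1)%:E) EFinD ge0_muleDl// ?mul1e.
move=> /(congr1 (fun x => (2^-1)%:E * x)%E).
by rewrite muleA [in RHS]muleA -EFinM mulVf// !mul1e.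
Qed.

Lemma measurable_fst1 : measurable_fun setT (fun p : (R * R) * R => p.1.1).
Proof. exact: (measurableT_comp measurable_fst measurable_fst). Qed.

Lemma measurable_fst2 : measurable_fun setT (fun p : (R * R) * R => p.1.2).
Proof. exact: (measurableT_comp measurable_snd measurable_fst). Qed.

Section Moyal.
Variables (h : R) (gam : R -> C).
Hypothesis h0 : 0 < h.
Hypothesis hgam : vecs L2 gam.

Lemma tfshiftE z : tfshift h z gam = (fun t => cis (2 * pi * z.2 * t / h) * gam (t - z.1)).
Proof. by []. Qed.

Let mgam : cmeas gam. Proof. by have [] := (vecsL2P gam).1 hgam. Qed.

Lemma cmeas_tfshift z : cmeas (tfshift h z gam).
Proof.
rewrite tfshiftE; apply: cmeasM; first by apply: cmeas_cis; meas.
by apply: (cmeas_comp mgam); meas.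
Qed.

Lemma csqn_tfshift z : csqn mu (tfshift h z gam) = csqn mu gam.
Proof.
rewrite /csqn tfshiftE; under eq_integral do rewrite sqnM sqn_cis mul1r.
rewrite (@int_shift R (fun t => sqn (gam t)))//; first exact: measurable_sqn.
by move=> t; exact: sqn_ge0.
Qed.

Lemma vecs_tfshift z : vecs L2 (tfshift h z gam).
Proof.
apply/vecsL2P; split; first exact: cmeas_tfshift.
by rewrite csqn_tfshift; have [] := (vecsL2P gam).1 hgam.
Qed.

Lemma cmeas_gabor f : vecs L2 f -> cmeas (fun z => ip L2 f (tfshift h z gam)).
Proof.
move=> /vecsL2P[mf _].
pose F (p : (R * R) * R) := f p.2 * conjc (cis (2 * pi * p.1.2 * p.2 / h) * gam (p.2 - p.1.1)).
apply: (@cmeas_Rint _ _ F).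
have m1 := measurable_fst1; have m2 := measurable_fst2.
apply: cmeasM; first by apply: (cmeas_comp mf); meas.
apply: cmeasJ; apply: cmeasM; first by apply: cmeas_cis; meas.
by apply: (cmeas_comp mgam); meas.
Qed.

(** For fixed x this is Plancherel in the second variable for P_x(t) = f(t) conj(gam(t - x)), with a
    = 2 pi / h, whose constant 2 pi / a is h. By Tonelli the integral of |P_x|^2 over x and t is
    |f|^2 |gam|^2. *)
Theorem moyal f : vecs L2 f ->
  (csqn plane_measure (fun z => ip L2 f (tfshift h z gam)) = h%:E * (csqn mu f * csqn mu gam))%E.
Proof.
move=> hf; have [mf f2] := (vecsL2P f).1 hf.
have [_ gam2] := (vecsL2P gam).1 hgam.
rewrite /csqn int_plane; [|exact/measurable_sqn/cmeas_gabor|by move=> z; exact: sqn_ge0].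
pose P x t := f t * conjc (gam (t - x)).
have hshift x : cL2 mu (fun t => gam (t - x)).
  split; first by apply: (cmeas_comp mgam); meas.
  rewrite /csqn (@int_shift R (fun t => sqn (gam t)))//; first exact: measurable_sqn.
  by move=> t; exact: sqn_ge0.
have iP x : crint mu (P x) by apply: cL2_mul => //; exact/vecsL2P.
have mP2 : measurable_fun setT (fun p : R * R => sqn (P p.1 p.2)).
  apply: measurable_sqn; apply: cmeasM; first by apply: (cmeas_comp mf); meas.
  by apply: cmeasJ; apply: (cmeas_comp mgam); meas.
have totP : (\int[mu]_x csqn mu (P x) = csqn mu f * csqn mu gam)%E.
  rewrite /csqn (int_swap (f := fun p => sqn (P p.1 p.2)))//; last by move=> z; exact: sqn_ge0.
  have ms := measurable_sqn mf; have mg := measurable_sqn mgam.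
  rewrite muleC -ge0_integralZl//=; last 3 first.
  - exact/measurable_EFinP.
  - by move=> x _; rewrite lee_fin sqn_ge0.
  - exact: csqn_ge0.
  apply: eq_integral => t _.
  under eq_integral do rewrite sqnM sqnJ.
  rewrite int_Z; [|exact: sqn_ge0| |by move=> x; exact: sqn_ge0].
    rewrite muleC; congr (_ * _)%E.
    rewrite (@ge0_integral_reflect R t (fun s => (sqn (gam s))%:E))//; first exact/measurable_EFinP.
    by move=> s; rewrite lee_fin sqn_ge0.
  by apply: (measurable_compT mg); meas.
have mcP : measurable_fun setT (fun x => csqn mu (P x)).
  have mP3 : measurable_fun setT (fun p : R * R => (sqn (P p.1 p.2))%:E) by exact/measurable_EFinP.
  have h1 : forall p : R * R, (0 <= (sqn (P p.1 p.2))%:E)%E by move=> p; rewrite lee_fin sqn_ge0.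
  by have := measurable_int1 mu mP3 h1.
(* P_x is integrable for every x, as a product of L^2 functions, but is known to be square
   integrable only for almost every x. *)
have aeP : {ae mu, forall x, (csqn mu (P x) < +oo)%E}.
  apply: ae_finite_int.
  - exact: mcP.
  - by move=> x; exact: csqn_ge0.
  - by rewrite totP lte_mul_pinfty ?csqn_ge0// ge0_fin_numE ?csqn_ge0.
rewrite -totP -ge0_integralZl//=; last 2 first.
- by move=> x _; exact: csqn_ge0.
- by rewrite lee_fin ltW.
have a0 : 0 < 2 * pi / h by rewrite divr_gt0// mulr_gt0// pi_gt0.
have ah : 2 * pi / (2 * pi / h) = h.
  have pi0 : pi != 0 :> R by rewrite gt_eqF// pi_gt0.
  by rewrite invf_div mulrCA divff ?mulr1 ?mulf_neq0.
apply: ge0_ae_eq_integral => //.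
- have mg2 : measurable_fun setT (fun p : R * R => (sqn (ip L2 f (tfshift h p gam)))%:E).
    by apply/measurable_EFinP/measurable_sqn/cmeas_gabor.
  have h1 : forall p : R * R, (0 <= (sqn (ip L2 f (tfshift h p gam)))%:E)%E by move=> p; rewrite lee_fin sqn_ge0.
  by have := measurable_int1 mu mg2 h1.
- by apply: emeasurable_funM; [exact: measurable_cst|exact: mcP].
- by move=> x _; apply: int_ge0 => y; exact: sqn_ge0.
- by move=> x _; rewrite mule_ge0 ?csqn_ge0// lee_fin ltW.
apply: aeS aeP => x Px _; rewrite -[in RHS]ah -(plancherel_complex a0 (iP x) Px).
apply: eq_integral => xi _; congr ((sqn (cintegral mu _))%:E); apply/funext => t.
rewrite tfshiftE /P /= !rmorphM /=.
rewrite (_ : 2 * pi * xi * t / h = 2 * pi / h * xi * t); first by ring.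
by field; rewrite gt_eqF.
Qed.

End Moyal.



(** The decomposition f = (f + |f|) - |f| carries a change of variable from nonnegative functions to
    integrable ones. *)
Lemma Rint_change (phi : R -> R) (c : R) : 0 <= c -> measurable_fun setT phi ->
  (forall f : R -> R, measurable_fun setT f -> (forall t, 0 <= f t) ->
    (\int[mu]_t (f (phi t))%:E = c%:E * \int[mu]_t (f t)%:E)%E) ->
  forall f, rint mu f -> rint mu (fun t => f (phi t)) /\ \int[mu]_t f (phi t) = c * \int[mu]_t f t.
Proof.
move=> c0 mphi h f fi; have mf := rint_meas fi.
have ri g : rint mu g -> rint mu (fun t => g (phi t)).
  move=> gi; have mg := rint_meas gi; apply: (@rintP _ _ _ mu); first meas.
  rewrite (h (fun t => `|g t|))//; last by apply: measurableT_comp.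
  by rewrite lte_mul_pinfty//; exact: rint_lty gi.
split; first exact: ri.
have key g : rint mu g -> (forall t, 0 <= g t) -> \int[mu]_t g (phi t) = c * \int[mu]_t g t.
  move=> gi g0; apply: EFin_inj; rewrite EFin_Rintegral; last exact: ri.
  by rewrite h//; [rewrite EFinM EFin_Rintegral|exact: rint_meas gi].
have fn := rint_norm fi; have fp := rintD fi fn.
have dec g : rint mu g -> rint mu (fun t => `|g t|) -> rint mu (fun t => g t + `|g t|) ->
    \int[mu]_t g t = \int[mu]_t (g t + `|g t|) - \int[mu]_t `|g t|.
  by move=> g1 g2 g3; rewrite -RintegralB//; apply: eq_Rintegral => t _; rewrite addrK.
rewrite dec; [|exact: ri|exact: (ri _ fn)|exact: (ri _ fp)].
rewrite [in RHS]dec// mulrBr -key// -?key// => t.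
by rewrite -lerBlDr sub0r lerNl -normrN; exact: ler_norm.
Qed.

Lemma cint_change (phi : R -> R) (c : R) : 0 <= c -> measurable_fun setT phi ->
  (forall f : R -> R, measurable_fun setT f -> (forall t, 0 <= f t) ->
    (\int[mu]_t (f (phi t))%:E = c%:E * \int[mu]_t (f t)%:E)%E) ->
  forall F : R -> C, crint mu F -> crint mu (fun t => F (phi t)) /\
  cintegral mu (fun t => F (phi t)) = c%:C * cintegral mu F.
Proof.
move=> c0 mphi h F [f1 f2].
have [r1 e1] := Rint_change c0 mphi h f1; have [r2 e2] := Rint_change c0 mphi h f2.
by split => //; apply: complex_eq; rewrite ?ReZ ?ImZ /=.
Qed.

Lemma cint_affine (F : R -> C) (s b : R) : 0 < s -> crint mu F ->
  crint mu (fun t => F ((t - b) / s)) /\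
  cintegral mu (fun t => F ((t - b) / s)) = s%:C * cintegral mu F.
Proof.
move=> s0 iF; apply: (@cint_change (fun t => (t - b) / s) s) => //; [exact: ltW|meas|].
move=> f mf f0; rewrite (@int_shift R (fun t => f (t / s)))//; last meas.
by rewrite (@ge0_integral_scale R s (EFin \o f))//; exact/measurable_EFinP.
Qed.

End Plane.

(** * The reproducing kernel Hilbert space *)

Section Dilation.
Context {R : realType}.
Notation mu := (@lebesgue_measure R).
Local Notation C := R[i].
Variables (h : R) (g : R -> C).
Hypothesis h0 : 0 < h.
Hypothesis hg : vecs L2 g.

Lemma sqr_dil_factor : (h `^ (- 4^-1)) ^+ 2 = (Num.sqrt h)^-1.
Proof.
rewrite -powR_mulrn ?powR_ge0// -powRrM -powR12_sqrt; last exact: ltW.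
by rewrite -powRN; congr (_ `^ _); field.
Qed.

Lemma sqn_dil t : sqn (dil h g t) = (Num.sqrt h)^-1 * sqn (g (t / Num.sqrt h)).
Proof. by rewrite sqnM sqn_real sqr_dil_factor. Qed.

Lemma cmeas_dil : cmeas (dil h g).
Proof.
have [mg _] := (vecsL2P g).1 hg.
by apply: cmeasM; [exact: cmeas_cst|apply: (cmeas_comp mg); meas].
Qed.

Lemma csqn_dil : csqn mu (dil h g) = csqn mu g.
Proof.
have [mg _] := (vecsL2P g).1 hg; have ms := measurable_sqn mg.
have s0 : 0 < Num.sqrt h by rewrite sqrtr_gt0.
rewrite /csqn; under eq_integral do rewrite sqn_dil.
rewrite int_Z; [|by rewrite invr_ge0 ltW| |by move=> x; exact: sqn_ge0]; last first.
  by apply: (measurable_compT ms); meas.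
rewrite (@ge0_integral_scale R _ (fun t => (sqn (g t))%:E))//; last 2 first.
- exact/measurable_EFinP.
- by move=> x; rewrite lee_fin sqn_ge0.
by rewrite muleA -EFinM mulVf ?gt_eqF// mul1e.
Qed.

Lemma vecs_dil : vecs L2 (dil h g).
Proof.
apply/vecsL2P; split; first exact: cmeas_dil.
by rewrite csqn_dil; have [] := (vecsL2P g).1 hg.
Qed.

Lemma nsq_dil : nsq L2 (dil h g) = nsq L2 g.
Proof. by apply: EFin_inj; rewrite !L2_nsq ?csqn_dil//; exact: vecs_dil. Qed.

End Dilation.

Section Cis.
Context {R : realType}.
Implicit Types a b : R.

Lemma cisD a b : cis (a + b) = cis a * cis b.
Proof. by apply: complex_eq; rewrite /= ?cosD ?sinD; ring. Qed.

Lemma conj_cis a : conjc (cis a) = cis (- a).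
Proof. by rewrite /cis cosN sinN. Qed.

Lemma conjc_real a : conjc (a%:C) = a%:C.
Proof. by apply: complex_eq; rewrite /= ?oppr0. Qed.

End Cis.

Section RKHS.
Context {R : realType}.
Notation mu := (@lebesgue_measure R).
Local Notation C := R[i].
Variables (h : R) (g : R -> C).
Hypothesis h0 : 0 < h.
Hypothesis hg : vecs L2 g.
Hypothesis g1 : nsq L2 g = 1.
Implicit Types f : R -> C.
Notation V := (stft h g).
Notation H := (rkhs h g).
Notation k := (rkernel h g).
Notation gam := (dil h g).

Let hgam : vecs L2 gam := vecs_dil h0 hg.
Let vt z : vecs L2 (tfshift h z gam) := vecs_tfshift h hgam z.

Lemma cmeas_stft f : vecs L2 f -> cmeas (V f).
Proof. exact: cmeas_gabor. Qed.

Lemma moyal_stft f : vecs L2 f -> csqn plane_measure (V f) = (h * nsq L2 f)%:E.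
Proof.
move=> hf; rewrite (moyal h0 hgam hf) -(L2_nsq hf) -(L2_nsq hgam).
by rewrite nsq_dil// g1 mule1.
Qed.

Lemma stft_lin c f f' : vecs L2 f -> vecs L2 f' -> V (c *: f + f') = c *: V f + V f'.
Proof. by move=> hf hf'; apply/funext => z; apply: L2_ipl => //; exact: vt. Qed.

Lemma stft0 : V 0 = 0.
Proof.
have := stft_lin 1 (@L2_0 R) (@L2_0 R).
by rewrite !scale1r addr0 -{1}[V 0]addr0 => /addrI.
Qed.

Lemma stft_eq f f' : vecs L2 f -> vecs L2 f' -> V f = V f' -> {ae mu, forall t, (f - f') t = 0}.
Proof.
move=> hf hf' e; have hB := L2_B hf hf'.
apply: L2_nsq_eq0 => //; apply/eqP; have := moyal_stft hB.
have -> : V (f - f') = 0.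
  by rewrite addrC -scaleN1r stft_lin// e scaleN1r addNr.
rewrite /csqn; under eq_integral do rewrite sqn0.
by rewrite integral0 => -[] /esym/eqP; rewrite mulf_eq0 gt_eqF.
Qed.

Lemma stft_ae0 f : vecs L2 f -> {ae mu, forall t, f t = 0} -> V f = 0.
Proof. by move=> hf f0; apply/funext => z; apply: L2_ip_ae0 => //; exact: vt. Qed.

Lemma stft_preimP f : vecs L2 f -> vecs L2 (stft_preim h g (V f)) /\ V (stft_preim h g (V f)) = V f.
Proof.
move=> hf; rewrite /stft_preim.
by have := @xgetPex _ 0 [set f' | vecs L2 f' /\ V f' = V f] (ex_intro _ f (conj hf erefl)).
Qed.

Lemma L2_ip_eq f f' u : vecs L2 f -> vecs L2 f' -> vecs L2 u -> V f = V f' -> ip L2 f u = ip L2 f' u.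
Proof.
move=> hf hf' hu e; apply/eqP; rewrite -subr_eq0; apply/eqP.
rewrite -(L2_ip_ae0 (L2_B hf hf') hu (stft_eq hf hf' e)).
by rewrite (_ : f - f' = (-1) *: f' + f) ?L2_ipl ?mulN1r// 1?addrC// scaleN1r addrC.
Qed.

(** The inner product is defined through chosen preimages. By Moyal's identity they differ from [f]
    and [f'] on null sets only, so the choice is immaterial. *)
Lemma rkhs_ip f f' : vecs L2 f -> vecs L2 f' -> ip H (V f) (V f') = ip L2 f f'.
Proof.
move=> hf hf'; have [h1 e1] := stft_preimP hf; have [h2 e2] := stft_preimP hf'.
rewrite -[LHS]/(ip L2 (stft_preim h g (V f)) (stft_preim h g (V f'))).
rewrite (L2_ip_eq h1 hf h2 e1) L2_ipC// (L2_ip_eq h2 hf' hf e2) [RHS]L2_ipC//.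
Qed.

Lemma rkhs_vecs f : vecs L2 f -> vecs H (V f).
Proof. by move=> hf; exists f. Qed.

Lemma rkhs_nsq f : vecs L2 f -> nsq H (V f) = nsq L2 f.
Proof. by move=> hf; rewrite /nsq rkhs_ip. Qed.

Lemma stft_B f f' : vecs L2 f -> vecs L2 f' -> V (f - f') = V f - V f'.
Proof. by move=> hf hf'; rewrite addrC -scaleN1r stft_lin// scaleN1r addrC. Qed.

(** Everything is transported from L^2. Definiteness, which fails there for functions, holds here
    because a function that is 0 almost everywhere has transform 0 at every point. *)
Lemma rkhs_hilbert : is_hilbert H.
Proof.
split.
- by rewrite -stft0; exact: (rkhs_vecs (@L2_0 R)).
- move=> c _ _ [f hf <-] [f' hf' <-]; rewrite -stft_lin//.
  by apply: rkhs_vecs; exact: L2_lin.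
- move=> c _ _ _ [f hf <-] [f' hf' <-] [u hu <-]; rewrite -stft_lin// !rkhs_ip//.
    exact: L2_ipl.
  exact: L2_lin.
- by move=> _ _ [f hf <-] [f' hf' <-]; rewrite !rkhs_ip// L2_ipC.
- by move=> _ [f hf <-]; rewrite rkhs_nsq//; exact: L2_nsq_ge0.
- move=> _ [f hf <-]; rewrite rkhs_nsq// => /(L2_nsq_eq0 hf); exact: stft_ae0.
- move=> u hu cau; have /choice[f hf] : forall n, exists f, vecs L2 f /\ V f = u n.
    by move=> n; have [f ? ?] := hu n; exists f.
  have [F hF cF] : exists2 F, vecs L2 F &
      forall eps : R, 0 < eps -> exists N, forall n, (N <= n)%N -> nsq L2 (f n - F) <= eps.
    apply: L2_complete_complex; first by move=> n; have [] := hf n.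
    move=> eps /cau[N hN]; exists N => m n /hN.
    have [h1 <-] := hf m; have [h2 <-] := hf n.
    by rewrite -stft_B// rkhs_nsq//; exact: L2_B.
  exists (V F); first exact: rkhs_vecs.
  move=> eps /cF[N hN]; exists N => n /hN.
  by have [h1 <-] := hf n; rewrite -stft_B// rkhs_nsq//; exact: L2_B.
- have [b [hb tb]] := @L2_total R.
  exists (fun n => V (b n)); first by move=> n; exact: rkhs_vecs.
  move=> _ [f hf <-] hb0; apply: stft_ae0 => //; apply: tb => // n.
  by have := hb0 n; rewrite rkhs_ip.
Qed.

Lemma rkernelE z : k z = V (tfshift h z gam).
Proof. by []. Qed.

Lemma rkernel_vecs z : vecs H (k z).
Proof. by rewrite rkernelE; apply: rkhs_vecs; exact: vt. Qed.

Lemma reproducing F z : vecs H F -> ip H F (k z) = F z.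
Proof. by move=> [f hf <-]; rewrite rkernelE rkhs_ip//; exact: vt. Qed.

Lemma nsq_rkernel z : nsq H (k z) = 1.
Proof.
rewrite rkernelE rkhs_nsq; last exact: vt.
apply: EFin_inj; rewrite L2_nsq; last exact: vt.
by rewrite csqn_tfshift// -L2_nsq// nsq_dil// g1.
Qed.

Lemma cmeas_rkhs F : vecs H F -> cmeas F.
Proof. by move=> [f hf <-]; exact: cmeas_stft. Qed.

Lemma csqn_rkhs F : vecs H F -> csqn plane_measure F = (h * nsq H F)%:E.
Proof. by move=> [f hf <-]; rewrite moyal_stft// rkhs_nsq. Qed.

(** Point evaluations have norm at most 1 because the kernels are normalized; this makes the form of
    T finite for a symbol in L^1. *)
Lemma sqn_rkhs_le F z : vecs H F -> sqn (F z) <= nsq H F.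
Proof.
move=> hF; rewrite -reproducing// -[leRHS]mulr1 -(nsq_rkernel z).
exact: (cauchy_schwarz rkhs_hilbert hF (rkernel_vecs z)).
Qed.

(* The squared ambiguity function of g: |k_z(w)|^2 is its dilation by sqrt h, *)
(* translated to z. *)
Definition ambig (zeta : R * R) : R := sqn (ip L2 g (tfshift 1 zeta g)).

Lemma measurable_ambig : measurable_fun setT ambig.
Proof. by apply: measurable_sqn; exact: cmeas_gabor. Qed.

Lemma ambig_ge0 z : 0 <= ambig z. Proof. exact: sqn_ge0. Qed.

Lemma int_ambig : (\int[plane_measure]_z (ambig z)%:E = 1)%E.
Proof.
have := @moyal R 1 g ltr01 hg g hg.
by rewrite -L2_nsq// g1 !mule1.
Qed.

(** After the substitution t = z.1 + sqrt(h) t' the phases combine to that of the ambiguity function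
    and a factor independent of t', which drops out of the modulus; the factors h^(-1/4) of the two
    dilations cancel the Jacobian. *)
Lemma sqn_rkernel z w : sqn (k z w) =
  ambig ((w.1 - z.1) / Num.sqrt h, (w.2 - z.2) / Num.sqrt h).
Proof.
have s0 : 0 < Num.sqrt h by rewrite sqrtr_gt0.
have sh : Num.sqrt h ^+ 2 = h by rewrite sqr_sqrtr// ltW.
pose x := (w.1 - z.1) / Num.sqrt h; pose y := (w.2 - z.2) / Num.sqrt h.
pose F t : C := g t * conjc (tfshift 1 (x, y) g t).
have iF : crint mu F.
  by apply: cL2_mul; apply/vecsL2P => //; exact: vecs_tfshift.
pose c : C := cis (2 * pi * (z.2 - w.2) * z.1 / h) * ((Num.sqrt h)^-1)%:C.
have E t : tfshift h z gam t * conjc (tfshift h w gam t) = c * F ((t - z.1) / Num.sqrt h).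
  have cE : ((Num.sqrt h)^-1)%:C = (h `^ (- 4^-1))%:C * (h `^ (- 4^-1))%:C :> C.
    by rewrite -rmorphM /= -expr2 sqr_dil_factor.
  have cM (a b : C) : conjc (a * b) = conjc a * conjc b by rewrite rmorphM.
  rewrite /c cE /F !tfshiftE /dil !cM !conj_cis conjc_real [(x, y).1]/= [(x, y).2]/=.
  rewrite (_ : (t - z.1) / Num.sqrt h - x = (t - w.1) / Num.sqrt h); last by rewrite /x; field; rewrite gt_eqF.
  have -> : cis (2 * pi * z.2 * t / h) * ((h `^ (- 4^-1))%:C * g ((t - z.1) / Num.sqrt h)) *
    (cis (- (2 * pi * w.2 * t / h)) * ((h `^ (- 4^-1))%:C * (g ((t - w.1) / Num.sqrt h))^*)) =
    (cis (2 * pi * z.2 * t / h) * cis (- (2 * pi * w.2 * t / h))) *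
    ((h `^ (- 4^-1))%:C * (h `^ (- 4^-1))%:C * g ((t - z.1) / Num.sqrt h) * (g ((t - w.1) / Num.sqrt h))^*) by ring.
  rewrite [RHS](_ : _ = (cis (2 * pi * (z.2 - w.2) * z.1 / h) * cis (- (2 * pi * y * ((t - z.1) / Num.sqrt h) / 1))) *
    ((h `^ (- 4^-1))%:C * (h `^ (- 4^-1))%:C * g ((t - z.1) / Num.sqrt h) * (g ((t - w.1) / Num.sqrt h))^*)); last by ring.
  rewrite -!cisD; congr (cis _ * _); rewrite /y.
  rewrite (_ : 2 * pi * ((w.2 - z.2) / Num.sqrt h) * ((t - z.1) / Num.sqrt h) / 1 =
     2 * pi * (w.2 - z.2) * (t - z.1) / (Num.sqrt h ^+ 2)); last by field; rewrite gt_eqF.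
  by rewrite sh; field; rewrite gt_eqF.
rewrite -[k z w]/(cintegral mu (fun t => tfshift h z gam t * conjc (tfshift h w gam t))).
rewrite (funext E).
have [r1 e1] := cint_affine z.1 s0 iF.
rewrite cintegralZ// e1 !sqnM sqn_cis mul1r !sqn_real mulrA -exprMn mulVf ?gt_eqF// expr1n mul1r.
by [].
Qed.

End RKHS.

(** * Diagonalization of the Toeplitz operator *)

Section HilbertExtra.
Context {R : realType} {V : lmodType R[i]} (H : ipspace V).
Hypothesis hH : is_hilbert H.

Lemma ip_inj u v : vecs H u -> vecs H v -> (forall w, vecs H w -> ip H u w = ip H v w) -> u = v.
Proof.
move=> hu hv h; apply/eqP; rewrite -subr_eq0; apply/eqP/(hil_def hH); first exact: vecsB.
by rewrite /nsq (ipBl hH)//; [rewrite h ?subrr//|]; exact: vecsB.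
Qed.

End HilbertExtra.

Section RintSum.
Context {R : realType} d (T : measurableType d) (m : {measure set T -> \bar R}).

Lemma RintD (f1 f2 : T -> R) : rint m f1 -> rint m f2 ->
  \int[m]_x (f1 x + f2 x) = \int[m]_x f1 x + \int[m]_x f2 x.
Proof. by move=> h1 h2; rewrite RintegralD. Qed.

Lemma RintB (f1 f2 : T -> R) : rint m f1 -> rint m f2 ->
  \int[m]_x (f1 x - f2 x) = \int[m]_x f1 x - \int[m]_x f2 x.
Proof. by move=> h1 h2; rewrite RintegralB. Qed.

Lemma RintZ c (f : T -> R) : rint m f -> \int[m]_x (c * f x) = c * \int[m]_x f x.
Proof. by move=> h; rewrite RintegralZl. Qed.

Lemma rint_mul01 (f v : T -> R) : rint m f -> measurable_fun setT v -> (forall x, 0 <= v x <= 1) ->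
  rint m (fun x => f x * v x).
Proof.
move=> fi mv v01; apply: (@rint_le _ _ _ m _ (fun x => `|f x|)).
- by apply: measurable_funM => //; exact: rint_meas fi.
- exact: rint_norm.
- move=> x; have /andP[v0 v1] := v01 x; rewrite normrM (ger0_norm v0) -[leRHS]mulr1.
  by apply: ler_wpM2l.
Qed.

Lemma rint0 : rint m (fun _ => 0).
Proof. by apply: rintP => //; under eq_integral do rewrite normr0; rewrite integral0 ltry. Qed.

Lemma rint_sum (f : nat -> T -> R) n : (forall i, rint m (f i)) ->
  rint m (fun x => \sum_(i < n) f i x) /\
  \int[m]_x (\sum_(i < n) f i x) = \sum_(i < n) \int[m]_x f i x.
Proof.
move=> hf; elim: n => [|n [IH1 IH2]].
  rewrite big_ord0 (funext (fun x => big_ord0 _ _ _ _)); split; first exact: rint0.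
  by rewrite /Rintegral integral0.
rewrite big_ord_recr /= -IH2.
have -> : (fun x => \sum_(i < n.+1) f i x) = (fun x => \sum_(i < n) f i x + f n x).
  by apply/funext => x; rewrite big_ord_recr.
by split; [exact: rintD|rewrite RintegralD//; exact: hf].
Qed.

(** Dominated convergence applied to |f| (w0 - w n), for f of either sign. It serves for w n a
    partial sum of a series of nonnegative functions, hence the bound by the limit [w0]. *)
Lemma weighted_cvg (f : T -> R) (w : nat -> T -> R) (w0 : T -> R) (B : R) :
  0 <= B -> rint m f -> (forall n, measurable_fun setT (w n)) -> measurable_fun setT w0 ->
  (forall n z, 0 <= w n z <= w0 z) -> (forall z, w0 z <= B) ->
  (forall z, w n z @[n --> \oo] --> w0 z) ->
  \int[m]_z (f z * w n z) @[n --> \oo] --> \int[m]_z (f z * w0 z).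
Proof.
move=> B0' fi mw mw0 ww wB cw; have mf := rint_meas fi.
have B0 z : 0 <= w0 z by have /andP[h1 h2] := ww 0%N z; exact: le_trans h2.
have ri (v : T -> R) : measurable_fun setT v -> (forall z, 0 <= v z <= B) -> rint m (fun z => f z * v z).
  move=> mv v0; apply: (@rint_le _ _ _ m _ (fun z => B * `|f z|)).
  - exact: measurable_funM.
  - by apply: rintZ; exact: rint_norm.
  - move=> z; have /andP[v1 v2] := v0 z; rewrite normrM mulrC ger0_norm//.
    by apply: ler_wpM2r.
have rw n : rint m (fun z => f z * w n z).
  by apply: ri => // z; have /andP[-> h2] := ww n z; exact: le_trans (wB z).
have rw0 : rint m (fun z => f z * w0 z) by apply: ri => // z; rewrite B0 wB.
have dk := @dominated_kernel_cvg0 R _ _ m (fun z => `|f z|) (fun n z => w0 z - w n z) B.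
have {}dk : (\int[m]_z (`|f z| * (w0 z - w n z))%:E)%E @[n --> \oo] --> 0%E.
  apply: dk.
  - exact: rint_norm.
  - by [].
  - by move=> n; exact: measurable_funB.
  - move=> n z; have /andP[w1 w2] := ww n z; rewrite subr_ge0 w2 /=.
    by apply: le_trans (wB z); rewrite lerBlDr lerDl.
  - move=> z; rewrite -(subrr (w0 z)); apply: cvgB; [exact: cvg_cst|exact: cw].
apply/cvgrPdist_le => eps e0.
move/fine_cvgP: dk => [dk1 /cvgrPdist_le/(_ _ e0) dk2].
near=> n.
have rk : rint m (fun z => `|f z| * (w0 z - w n z)).
  have -> : (fun z => `|f z| * (w0 z - w n z)) = (fun z => `|f z * w0 z| - `|f z * w n z|).
    apply/funext => z; rewrite !normrM mulrBr !(ger0_norm (B0 z)).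
    by have /andP[w1 _] := ww n z; rewrite (ger0_norm w1).
  by apply: rintB; exact: rint_norm.
rewrite -RintegralB; [|by []|exact: rw0|exact: rw].
apply: (@le_trans _ _ (\int[m]_z (`|f z| * (w0 z - w n z)))).
  apply: Rint_norm_le => //.
  - by apply: measurable_funB; apply: measurable_funM.
  - move=> z; have /andP[_ h2] := ww n z.
    by rewrite -mulrBr normrM [X in _ * X]ger0_norm ?subr_ge0.
have : `|0 - fine (\int[m]_z (`|f z| * (w0 z - w n z))%:E)%E| <= eps by near: n.
rewrite sub0r normrN; apply: le_trans; exact: ler_norm.
Unshelve. all: by end_near. Qed.

End RintSum.

Section Toeplitz.
Context {R : realType}.
Notation mu := (@lebesgue_measure R).
Local Notation C := R[i].
Variables (h : R) (g : R -> C).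
Hypothesis h0 : 0 < h.
Hypothesis hg : vecs L2 g.
Hypothesis g1 : nsq L2 g = 1.
Notation H := (rkhs h g).
Notation k := (rkernel h g).
Notation pm := (@plane_measure R).
Variables (sigma s : R * R -> R).
Hypothesis msig : measurable_fun setT sigma.
Hypothesis sig_ae : {ae pm, forall z, sigma z = s z}.
Hypothesis is_ : rint pm s.
Hypothesis s0 : forall z, 0 <= s z.

Let hH := rkhs_hilbert h0 hg g1.
Let ms : measurable_fun setT s := rint_meas is_.
Let hi : 0 < h^-1. Proof. by rewrite invr_gt0. Qed.

(* The form <T_h(sigma) F, U>, after the reproducing property and with sigma *)
(* replaced by a function s that is nonnegative everywhere. *)
Definition tform (F U : R * R -> C) : C :=
  (h^-1)%:C * cintegral pm (fun z => (s z)%:C * F z * conjc (U z)).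

Lemma tform_crint F U : vecs H F -> vecs H U -> crint pm (fun z => (s z)%:C * F z * conjc (U z)).
Proof.
move=> hF hU; have [mF mU] := (cmeas_rkhs h0 hg hF, cmeas_rkhs h0 hg hU).
have n0 W : vecs H W -> 0 <= nsq H W by exact: hil_ge0.
apply: (@crint_le _ _ _ pm _ (fun z => (nsq H F + nsq H U) * s z)).
- by do 2!(apply: cmeasM; last by [|apply: cmeasJ]); apply: cmeas_real.
- exact: rintZ.
- move=> z; rewrite !sqnM sqnJ sqn_real exprMn -mulrA.
  have hs := sqr_ge0 (s z); have a1 := sqn_rkhs_le h0 hg g1 z hF; have a2 := sqn_rkhs_le h0 hg g1 z hU.
  rewrite [leRHS]mulrC; apply: ler_wpM2l => //.
  have b1 := sqn_ge0 (F z); have b2 := sqn_ge0 (U z).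
  apply: (@le_trans _ _ (nsq H F * nsq H U)); first by apply: ler_pM.
  by have := n0 _ hF; have := n0 _ hU; nra.
- by move=> z; rewrite mulr_ge0// addr_ge0// n0.
Qed.

Lemma tformC F U : vecs H F -> vecs H U -> tform U F = conjc (tform F U).
Proof.
move=> hF hU; rewrite /tform.
have cM (a b : C) : conjc (a * b) = conjc a * conjc b by rewrite rmorphM.
rewrite cM conjc_real -cintegralJ; last exact: tform_crint.
congr (_ * cintegral _ _); apply/funext => z.
by rewrite !cM conjc_real conjcK; ring.
Qed.

Lemma tform_lin c F G U : vecs H F -> vecs H G -> vecs H U ->
  tform (c *: F + G) U = c * tform F U + tform G U.
Proof.
move=> hF hG hU; rewrite /tform mulrCA -mulrDr; congr (_ * _).
rewrite -cintegralZ; last exact: tform_crint.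
rewrite -cintegralD; [|apply: crintZ; exact: tform_crint|exact: tform_crint].
by congr cintegral; apply/funext => z; rewrite -[(c *: F + G) z]/(c * F z + G z); ring.
Qed.

Lemma tform_diag F : tform F F = (h^-1 * \int[pm]_z (s z * sqn (F z)))%:C.
Proof.
rewrite /tform rmorphM /= -cintegral_real; congr (_ * cintegral _ _); apply/funext => z.
by rewrite rmorphM /= -sqnE mulrA.
Qed.

Lemma Rint_le_const F U (f : R * R -> R) : vecs H F -> vecs H U -> measurable_fun setT f ->
  (forall z, f z ^+ 2 <= sqn ((s z)%:C * F z * conjc (U z))) ->
  (\int[pm]_z f z) ^+ 2 <= (\int[pm]_z s z) ^+ 2 * (nsq H F * nsq H U).
Proof.
move=> hF hU mf hf.
have n0 W : vecs H W -> 0 <= nsq H W by exact: hil_ge0.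
have nFU : 0 <= nsq H F * nsq H U by rewrite mulr_ge0// n0.
pose B := Num.sqrt (nsq H F * nsq H U).
have B2 : B ^+ 2 = nsq H F * nsq H U by rewrite sqr_sqrtr.
have B0 : 0 <= B by exact: sqrtr_ge0.
have le : `|\int[pm]_z f z| <= \int[pm]_z (B * s z).
  apply: Rint_norm_le => //; first exact: rintZ.
  move=> z; rewrite -(@ler_pXn2r _ 2)// ?nnegrE ?mulr_ge0// real_normK ?num_real//.
  apply: le_trans (hf z) _; rewrite !sqnM sqnJ sqn_real exprMn B2 -mulrA mulrC.
  apply: ler_wpM2r; first exact: sqr_ge0.
  by apply: ler_pM; rewrite ?sqn_ge0//; exact: sqn_rkhs_le.
rewrite -(real_normK (num_real (\int[pm]_z f z))) -B2 -exprMn mulrC -RintegralZl//.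
by rewrite ler_pXn2r// ?nnegrE// Rintegral_ge0// => z _; rewrite mulr_ge0.
Qed.

(** The factor 2 comes from bounding the real and imaginary parts of the integral separately. The
    constant is grouped so as to exhibit a bounded functional of U. *)
Lemma sqn_tform_le F U : vecs H F -> vecs H U ->
  sqn (tform F U) <= (2 * h^-1 ^+ 2 * (\int[pm]_z s z) ^+ 2 * nsq H F) * nsq H U.
Proof.
move=> hF hU; rewrite /tform sqnM sqn_real.
have [f1 f2] := crint_cmeas (tform_crint hF hU).
have h1 := Rint_le_const hF hU f1 (fun z => sqr_Re_le _).
have h2 := Rint_le_const hF hU f2 (fun z => sqr_Im_le _).
have hh : 0 <= h^-1 ^+ 2 by exact: sqr_ge0.
rewrite [leRHS](_ : _ = h^-1 ^+ 2 * (2 * ((\int[pm]_z s z) ^+ 2 * (nsq H F * nsq H U)))); last by ring.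
apply: ler_wpM2l => //; rewrite /sqn /=; lra.
Qed.

Lemma toeplitz_form F U : vecs H F -> vecs H U ->
  (h^-1)%:C * cintegral pm (fun z => (sigma z)%:C * ip H F (k z) * ip H (k z) U) = tform F U.
Proof.
move=> hF hU; congr (_ * _).
have E : (fun z => (sigma z)%:C * ip H F (k z) * ip H (k z) U) =
    (fun z => (sigma z)%:C * F z * conjc (U z)).
  apply/funext => z; rewrite reproducing//.
  by rewrite (hil_ipC hH hU (rkernel_vecs h0 hg z)) reproducing.
rewrite E; apply: cintegral_ae.
- have [mF mU] := (cmeas_rkhs h0 hg hF, cmeas_rkhs h0 hg hU).
  by do 2!(apply: cmeasM; last by [|apply: cmeasJ]); apply: cmeas_real.
- exact: crint_cmeas (tform_crint hF hU).
- by apply: aeS sig_ae => z ->.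
Qed.

(** [toeplitz] picks a vector that represents the weak integral; Riesz representation of the
    conjugate-linear functional U -> [tform F U] shows that there is one. *)
Lemma toeplitzP F : vecs H F -> vecs H (toeplitz h g sigma F) /\
  forall U, vecs H U -> ip H (toeplitz h g sigma F) U = tform F U.
Proof.
move=> hF.
suff [G hG eG] : exists2 G, vecs H G & forall U, vecs H U -> ip H G U = tform F U.
  have := @xgetPex _ 0 [set G | vecs H G /\ forall U, vecs H U -> ip H G U =
      (h^-1)%:C * cintegral pm (fun z => (sigma z)%:C * ip H F (k z) * ip H (k z) U)].
  move=> /(_ (ex_intro _ G (conj hG (fun U hU => etrans (eG U hU) (esym (toeplitz_form hF hU))))))[h1 h2].
  by split => // U hU; rewrite h2// toeplitz_form.
apply: (riesz_representation hH (K := 2 * h^-1 ^+ 2 * (\int[pm]_z s z) ^+ 2 * nsq H F)).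
- by rewrite mulr_ge0 ?(hil_ge0 hH)// mulr_ge0 ?sqr_ge0// mulr_ge0 ?sqr_ge0.
- move=> a u v hu hv.
  rewrite tformC//; last exact: hil_lin.
  rewrite tform_lin// (tformC hu hF) (tformC hv hF) rmorphD rmorphM /=; congr (_ * _ + _); rewrite conjcK.
  
- by move=> u hu; exact: sqn_tform_le.
Qed.

Variable T : (R * R -> C) -> (R * R -> C).
Hypothesis TP : forall F, vecs H F -> vecs H (T F) /\
  forall U, vecs H U -> ip H (T F) U = tform F U.

Lemma toeplitz_vecs F : vecs H F -> vecs H (T F). Proof. by move=> /TP[]. Qed.

Lemma toeplitz_ip F U : vecs H F -> vecs H U -> ip H (T F) U = tform F U.
Proof. by move=> /TP[_]; exact. Qed.

Lemma toeplitz_lin c F G : vecs H F -> vecs H G -> T (c *: F + G) = c *: T F + T G.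
Proof.
move=> hF hG; have h1 := hil_lin hH c hF hG.
have h2 := hil_lin hH c (toeplitz_vecs hF) (toeplitz_vecs hG).
apply: (ip_inj hH (toeplitz_vecs h1) h2) => W hW.
rewrite (hil_ipl hH)//; [|exact: toeplitz_vecs|exact: toeplitz_vecs].
by rewrite (toeplitz_ip h1 hW) (toeplitz_ip hF hW) (toeplitz_ip hG hW) tform_lin.
Qed.

Lemma toeplitz_sym F G : vecs H F -> vecs H G -> ip H (T F) G = ip H F (T G).
Proof.
move=> hF hG; rewrite (hil_ipC hH (toeplitz_vecs hG) hF) (toeplitz_ip hF hG) (toeplitz_ip hG hF).
by rewrite -tformC.
Qed.

Lemma toeplitz_quad F : vecs H F ->
  complex.Re (ip H (T F) F) = h^-1 * \int[pm]_z (s z * sqn (F z)).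
Proof. by move=> hF; rewrite (toeplitz_ip hF hF) tform_diag. Qed.

Lemma rint_weight F : vecs H F -> rint pm (fun z => s z * sqn (F z)).
Proof.
move=> hF; apply: (@rint_le _ _ _ pm _ (fun z => nsq H F * s z)).
- by apply: measurable_funM => //; apply: measurable_sqn; exact: (cmeas_rkhs h0 hg hF).
- exact: rintZ.
- move=> z; rewrite ger0_norm ?mulr_ge0 ?sqn_ge0// mulrC; apply: ler_wpM2r => //.
  exact: sqn_rkhs_le.
Qed.

Lemma toeplitz_quad_le F : vecs H F ->
  0 <= complex.Re (ip H (T F) F) <= (h^-1 * \int[pm]_z s z) * nsq H F.
Proof.
move=> hF; rewrite toeplitz_quad//; apply/andP; split.
  by rewrite mulr_ge0 ?(ltW hi)// Rintegral_ge0// => z _; rewrite mulr_ge0 ?sqn_ge0.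
rewrite -mulrA; apply: ler_wpM2l; first exact: ltW.
rewrite mulrC -RintegralZl//; apply: le_Rintegral => //.
- exact: rint_weight.
- exact: rintZ.
- by move=> z _; rewrite mulrC; apply: ler_wpM2r => //; exact: sqn_rkhs_le.
Qed.

Lemma sqn_onb_le e z n : is_onb H e -> \sum_(j < n) sqn (e j z) <= 1.
Proof.
move=> he; have oe := onb_onsys he; have ve j : vecs H (e j) by case: he.
have := bessel hH oe n (rkernel_vecs h0 hg z); rewrite nsq_rkernel//.
apply: le_trans; apply: ler_sum => j _.
by rewrite (hil_ipC hH (ve j) (rkernel_vecs h0 hg z)) sqnJ reproducing.
Qed.

(** T is Hilbert-Schmidt: with M = h^(-1) int s one has |T b_j|^2 <= M <T b_j, b_j>, and sum_j <T
    b_j, b_j> = h^(-1) int s sum_j |b_j|^2 <= M, because Bessel's inequality for k_z gives sum_j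
    |b_j(z)|^2 <= 1. *)
Lemma toeplitz_spectral : exists e, exists l : nat -> R, is_onb H e /\
  forall n, T (e n) = (l n)%:C *: e n.
Proof.
apply: (spectral_theorem hH toeplitz_vecs toeplitz_lin toeplitz_sym).
  by move=> u /toeplitz_quad_le/andP[].
have [b hb] := onb_exists hH; exists b => //.
have vb j : vecs H (b j) by case: hb.
pose M := h^-1 * \int[pm]_z s z.
have M0 : 0 <= M by rewrite mulr_ge0 ?(ltW hi)// Rintegral_ge0.
exists (M * M) => n.
apply: (@le_trans _ _ (\sum_(j < n) M * (h^-1 * \int[pm]_z (s z * sqn (b j z))))).
  apply: ler_sum => j _; rewrite -toeplitz_quad//.
  apply: (@nsq_T_le _ _ _ hH _ toeplitz_vecs toeplitz_lin toeplitz_sym _ (vecs H)) => //.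
  - by move=> u /toeplitz_quad_le/andP[].
  - exact: toeplitz_vecs.
  - by move=> u /toeplitz_quad_le/andP[].
rewrite -mulr_sumr; apply: ler_wpM2l => //; rewrite -mulr_sumr; apply: ler_wpM2l; first exact: ltW.
have [r1 <-] := @rint_sum _ _ _ pm (fun j z => s z * sqn (b j z)) n (fun j => rint_weight (vb j)).
apply: le_Rintegral => //.
by move=> z _; rewrite -mulr_sumr -[leRHS]mulr1; apply: ler_wpM2l => //; exact: sqn_onb_le.
Qed.

(** The value <T e_n, e_n> of the quadratic form: the eigenvalue when e_n is a unit vector, and 0
    when e_n = 0, where the spectral theorem leaves it open. *)
Definition eigval (e : nat -> R * R -> C) n : R := h^-1 * \int[pm]_z (s z * sqn (e n z)).

Lemma toeplitz_diag : exists2 e, is_onb H e & has_diag H e T (eigval e).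
Proof.
have [e [l [he el]]] := toeplitz_spectral; exists e => //.
have ve j : vecs H (e j) by case: he.
move=> u hu; split; first exact: toeplitz_vecs.
move=> n; rewrite toeplitz_sym// el (ipZr hH)// conjc_real.
have [_ /(_ n) hn _ _] := he; case: hn => [e1|->]; last by rewrite (ip0r hH)// !mulr0.
congr (_%:C * _); rewrite /eigval -toeplitz_quad// el (ipZl hH)// e1 mulr1.
by [].
Qed.

Section Eigen.
Variable e : nat -> R * R -> C.
Hypothesis he : is_onb H e.
Hypothesis hd : has_diag H e T (eigval e).

Let ve j : vecs H (e j). Proof. by case: he. Qed.
Let a n z : R := sqn (e n z).
Let lam := eigval e.
Let M := h^-1 * \int[pm]_z s z.
Let M0 : 0 <= M. Proof. by rewrite mulr_ge0 ?(ltW hi)// Rintegral_ge0. Qed.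
Let A N z : R := \sum_(n < N) a n z.

Let ma n : measurable_fun setT (a n).
Proof. by apply: measurable_sqn; exact: (cmeas_rkhs h0 hg (ve n)). Qed.

Lemma eigval_ge0 n : 0 <= lam n.
Proof. by rewrite mulr_ge0 ?(ltW hi)// Rintegral_ge0// => z _; rewrite mulr_ge0 ?sqn_ge0. Qed.

Lemma onb_le1 n z : a n z <= 1.
Proof.
apply: le_trans (sqn_onb_le z n.+1 he); rewrite big_ord_recr /= lerDr.
by apply: sumr_ge0 => i _; exact: sqn_ge0.
Qed.

Lemma eigval_le n : lam n <= M.
Proof.
apply: ler_wpM2l; first exact: ltW.
apply: le_Rintegral => //; first exact: rint_weight.
by move=> z _; rewrite -[leRHS]mulr1; apply: ler_wpM2l => //; exact: onb_le1.
Qed.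

Lemma eigval_eq0 n : e n = 0 -> lam n = 0.
Proof.
move=> e0; rewrite /lam /eigval e0.
by under eq_Rintegral do rewrite sqn0 mulr0; rewrite /Rintegral integral0 mulr0.
Qed.

Lemma partial_onb_cvg z : A N z @[N --> \oo] --> (1 : R).
Proof.
have := parseval hH he (rkernel_vecs h0 hg z); rewrite nsq_rkernel//.
rewrite (_ : (fun n => _) = A^~ z)//; apply/funext => n; apply: eq_bigr => j _.
by rewrite (hil_ipC hH (ve j) (rkernel_vecs h0 hg z)) sqnJ reproducing.
Qed.

Lemma partial_onb_le N z : 0 <= A N z <= 1.
Proof.
by rewrite sqn_onb_le// andbT; apply: sumr_ge0 => i _; exact: sqn_ge0.
Qed.

Lemma measurable_partial_onb N : measurable_fun setT (A N).
Proof. by apply: measurable_sum => n. Qed.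

Lemma onb_rint n : rint pm (a n).
Proof.
apply: cL2_rint; split; first exact: (cmeas_rkhs h0 hg (ve n)).
by rewrite (csqn_rkhs h0 hg g1)// ltry.
Qed.

Lemma onb_Rint n : \int[pm]_z a n z = h * nsq H (e n).
Proof. by apply: EFin_inj; rewrite EFin_Rintegral -?(csqn_rkhs h0 hg g1)//; exact: onb_rint. Qed.

(* The Berezin transform <T k_w, k_w>. *)
Definition berezin (w : R * R) : R := h^-1 * \int[pm]_z (s z * sqn (k w z)).

Lemma berezin_le w : berezin w <= M.
Proof.
have hk := rkernel_vecs h0 hg w; have /andP[_] := toeplitz_quad_le hk.
by rewrite toeplitz_quad// nsq_rkernel// mulr1.
Qed.

Lemma berezin_series_cvg w : \sum_(n < N) lam n * a n w @[N --> \oo] --> berezin w.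
Proof.
have hk := rkernel_vecs h0 hg w.
have := has_diag_quad hH he hd hk; rewrite toeplitz_quad// -/(berezin w).
rewrite (_ : (fun n => _) = (fun N => \sum_(n < N) lam n * a n w))//.
apply/funext => n; apply: eq_bigr => j _.
by rewrite (hil_ipC hH (ve j) hk) sqnJ reproducing.
Qed.

Lemma berezin_partial N w : 0 <= \sum_(n < N) lam n * a n w <= berezin w.
Proof.
have t0 n : 0 <= lam n * a n w by rewrite mulr_ge0 ?sqn_ge0 ?eigval_ge0.
apply/andP; split; first by apply: sumr_ge0 => i _.
have nd : nondecreasing_seq (fun N => \sum_(n < N) lam n * a n w).
  by apply/nondecreasing_seqP => n; rewrite big_ord_recr lerDl.
have c := berezin_series_cvg (w := w).
rewrite -(cvg_lim (@Rhausdorff R) c).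
by apply: nondecreasing_cvgn_le => //; apply/cvg_ex; exists (berezin w).
Qed.

Lemma measurable_berezin : measurable_fun setT berezin.
Proof.
apply: (@measurable_fun_cvg _ _ _ _ (fun N w => \sum_(n < N) lam n * a n w)).
  move=> N; apply: measurable_sum => n; apply: measurable_funM => //.
by move=> w _; exact: berezin_series_cvg.
Qed.

Lemma sum_eigval_cvg : h * (\sum_(n < N) lam n) @[N --> \oo] --> \int[pm]_z s z.
Proof.
have E N : h * (\sum_(n < N) lam n) = \int[pm]_z (s z * A N z).
  have [r1 e1] := @rint_sum _ _ _ pm (fun j z => s z * a j z) N (fun j => rint_weight (ve j)).
  rewrite mulr_sumr; transitivity (\sum_(i < N) \int[pm]_z (s z * a i z)).
    by apply: eq_bigr => i _; rewrite mulrA divff ?mul1r// gt_eqF.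
  by rewrite -e1; apply: eq_Rintegral => z _; rewrite mulr_sumr.
rewrite (funext E) (_ : \int[pm]_z s z = \int[pm]_z (s z * (fun _ => 1) z)); last first.
  by apply: eq_Rintegral => z _; rewrite mulr1.
apply: (@weighted_cvg _ _ _ pm s A (fun _ => 1) 1) => //.
- exact: measurable_partial_onb.
- exact: partial_onb_le.
- exact: partial_onb_cvg.
Qed.

(** One has h l_n^2 = l_n int s |e_n|^2, and sum_n l_n |e_n(z)|^2 increases to <T k_z, k_z>. *)
Lemma sum_eigval2_cvg : h * (\sum_(n < N) lam n ^+ 2) @[N --> \oo] --> \int[pm]_z (s z * berezin z).
Proof.
pose w N z := \sum_(n < N) lam n * a n z.
have mw N : measurable_fun setT (w N).
  by apply: measurable_sum => n; apply: measurable_funM.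
have E N : h * (\sum_(n < N) lam n ^+ 2) = \int[pm]_z (s z * w N z).
  have ri j : rint pm (fun z => lam j * (s z * a j z)) by apply: rintZ; exact: rint_weight.
  have [r1 e1] := rint_sum N ri.
  rewrite mulr_sumr; transitivity (\sum_(i < N) \int[pm]_z (lam i * (s z * a i z))).
    apply: eq_bigr => i _; rewrite RintegralZl//; last exact: rint_weight.
    by rewrite expr2 mulrCA; congr (_ * _); rewrite mulrA divff ?mul1r// gt_eqF.
  rewrite -e1; apply: eq_Rintegral => z _; rewrite mulr_sumr.
  by apply: eq_bigr => i _; rewrite mulrCA.
rewrite (funext E).
apply: (@weighted_cvg _ _ _ pm s w berezin M) => //.
- exact: measurable_berezin.
- by move=> n z; exact: berezin_partial.
- exact: berezin_le.
- by move=> z; exact: berezin_series_cvg.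
Qed.

(** The diagonal entries satisfy |l_n psi(l_n)| <= K l_n, where K bounds psi on the eigenvalues, and
    sum_n l_n = h^(-1) int s is finite. *)
Lemma toeplitz_trace (psi psi0 : R -> R) : continuous psi0 -> (forall t, 0 <= t -> psi0 t = psi t) ->
  trace_class H (T \o fcalc H psi T) /\
  exists2 tau : R, trace H (T \o fcalc H psi T) = tau%:C &
    h * (\sum_(n < N) (lam n * psi0 (lam n))) @[N --> \oo] --> h * tau.
Proof.
move=> cpsi psiE.
have hF := fcalc_has_diag hH he hd eigval_ge0 eigval_le eigval_eq0 cpsi psiE.
have hA := has_diag_comp hd hF.
have [K K0 hK] := psi_bounded eigval_ge0 eigval_le cpsi psiE.
pose m n := eigval e n * psi (eigval e n).
have mK n : `|m n| <= K * lam n.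
  rewrite normrM (ger0_norm (eigval_ge0 n)) mulrC.
  by apply: ler_wpM2r; [exact: eigval_ge0|exact: hK].
have mM n : `|m n| <= K * M by apply: le_trans (mK n) _; apply: ler_wpM2l => //; exact: eigval_le.
have em n : e n = 0 -> m n = 0 by move=> /eigval_eq0; rewrite /m /lam => ->; rewrite mul0r.
have cl : series (fun n => K * lam n) @ \oo --> K * (h^-1 * \int[pm]_z s z).
  rewrite (_ : series _ = (fun N => K * (h^-1 * (h * \sum_(n < N) lam n)))).
    by apply: cvgM; [exact: cvg_cst|apply: cvgM; [exact: cvg_cst|exact: sum_eigval_cvg]].
  by apply/funext => N; rewrite /series /= big_mkord (mulrA h^-1) mulVf ?gt_eqF// mul1r mulr_sumr.
have cabs : cvgn (series (fun n => `|m n|)).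
  apply: (@series_le_cvg R _ (fun n => K * lam n)) => //.
  - by move=> n; rewrite mulr_ge0// eigval_ge0.
  - by apply/cvg_ex; eexists; exact: cl.
have cm : cvgn (series m) by exact: normed_cvg.
have [s1 hs1] := (cvg_ex _).1 cabs; have [tau htau] := (cvg_ex _).1 cm.
have [h1 h2] := diag_trace hH he hA mM em hs1 htau.
split => //; exists tau => //.
rewrite (_ : (fun N => _) = (fun N => h * series m N)).
  by apply: cvgM; [exact: cvg_cst|exact: htau].
apply/funext => N; rewrite /series /= big_mkord; congr (_ * _); apply: eq_bigr => i _.
by rewrite psiE// eigval_ge0.
Qed.

Hypothesis is2 : rint pm (fun z => s z ^+ 2).

Let rint_a (f : R * R -> R) n : rint pm f -> rint pm (fun z => f z * a n z).
Proof.
have h1 z : 0 <= a n z <= 1 by rewrite onb_le1 andbT sqn_ge0.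
by move=> fi; exact: (@rint_mul01 _ _ _ pm f (a n) fi (ma n) h1).
Qed.

(** For a zero vector e_n the mass of |e_n|^2 is 0 instead of h; the condition [f 0 = 0] makes both
    sides vanish there. *)
Lemma Rint_eigval (f : R -> R) n : f 0 = 0 -> \int[pm]_z (f (lam n) * a n z) = h * f (lam n).
Proof.
move=> f0; rewrite RintegralZl//; last exact: onb_rint.
rewrite onb_Rint mulrCA; congr (_ * _).
have [_ /(_ n) hn _ _] := he; case: hn => [e1|e0]; first by rewrite /nsq e1 /= mulr1.
by rewrite eigval_eq0// f0 mul0r.
Qed.

Variables (phi : R -> R) (K b eps D : R).
Hypothesis mphi : measurable_fun setT phi.
Hypothesis phi0 : phi 0 = 0.
Hypothesis phiK : forall t, 0 <= t -> `|phi t| <= K * (t + t ^+ 2).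
Hypothesis phi_key : forall x t, 0 <= x -> 0 <= t ->
  `|phi x - phi t - b * (x - t)| <= eps * (x + t + x ^+ 2 + t ^+ 2) + D * (x - t) ^+ 2.

Lemma rint_phi : rint pm (fun z => phi (s z)).
Proof.
apply: (@rint_le _ _ _ pm _ (fun z => K * (s z + s z ^+ 2))).
- exact: (measurable_compT mphi ms).
- by apply: rintZ; exact: rintD.
- by move=> z; exact: phiK.
Qed.

(** For a unit vector e_n, a_n / h is a probability density under which s has mean l_n. Integrating
    [phi_key] with x = l_n and t = s(z) against a_n removes the term in [b], and the square becomes
    h times a variance, int s^2 a_n - h l_n^2. *)
Lemma eigval_estimate n :
  `|h * phi (lam n) - \int[pm]_z (phi (s z) * a n z)| <=
  eps * (2 * (h * lam n) + h * lam n ^+ 2 + \int[pm]_z (s z ^+ 2 * a n z)) +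
  D * (\int[pm]_z (s z ^+ 2 * a n z) - h * lam n ^+ 2).
Proof.
have Es : \int[pm]_z (s z * a n z) = h * lam n by rewrite mulrA divff ?mul1r// gt_eqF.
have El : \int[pm]_z (lam n * a n z) = h * lam n by rewrite (Rint_eigval (f := id)).
have El2 : \int[pm]_z (lam n ^+ 2 * a n z) = h * lam n ^+ 2.
  by rewrite (Rint_eigval (f := fun x => x ^+ 2))// expr0n.
have Ep : \int[pm]_z (phi (lam n) * a n z) = h * phi (lam n) by rewrite Rint_eigval.
have Els : \int[pm]_z (lam n * (s z * a n z)) = h * lam n ^+ 2.
  by rewrite RintegralZl ?Es; [rewrite mulrCA expr2|by []|exact: rint_weight].
have r0 := onb_rint n.
have r1 := rint_weight (ve n).
have r2 := rint_a n is2.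
have r3 := rint_a n rint_phi.
have rc c := rintZ c r0.
pose E z := phi (lam n) * a n z - phi (s z) * a n z - b * (lam n * a n z - s z * a n z).
pose B z := eps * (lam n * a n z + s z * a n z + lam n ^+ 2 * a n z + s z ^+ 2 * a n z) +
   D * (lam n ^+ 2 * a n z - 2 * (lam n * (s z * a n z)) + s z ^+ 2 * a n z).
have rE : rint pm E.
  by apply: rintB; [apply: rintB|apply: rintZ; apply: rintB].
have rB : rint pm B.
  by apply: rintD; apply: rintZ; [do 3!apply: rintD => //|
     apply: rintD => //; apply: rintB => //; do 2!apply: rintZ].
have -> : h * phi (lam n) - \int[pm]_z (phi (s z) * a n z) = \int[pm]_z E z.
  have w1 := rintB (rc (phi (lam n))) r3; have w2 := rintB (rc (lam n)) r1.
  rewrite /E (RintB w1 (rintZ b w2)) (RintB (rc (phi (lam n))) r3) (RintZ b w2) (RintB (rc (lam n)) r1).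
  by rewrite Ep El Es subrr mulr0 subr0.
have -> : eps * (2 * (h * lam n) + h * lam n ^+ 2 + \int[pm]_z (s z ^+ 2 * a n z)) +
  D * (\int[pm]_z (s z ^+ 2 * a n z) - h * lam n ^+ 2) = \int[pm]_z B z.
  have q1 := rintD (rc (lam n)) r1; have q2 := rintD q1 (rc (lam n ^+ 2)); have q3 := rintD q2 r2.
  have q4 := rintZ 2 (rintZ (lam n) r1); have q5 := rintB (rc (lam n ^+ 2)) q4; have q6 := rintD q5 r2.
  rewrite /B (RintD (rintZ eps q3) (rintZ D q6)) (RintZ eps q3) (RintZ D q6) (RintD q2 r2).
  rewrite (RintD q1 (rc _)) (RintD (rc _) r1) (RintD q5 r2) (RintB (rc _) q4) (RintZ 2 (rintZ _ r1)).
  by rewrite Els El Es El2; ring.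
apply: Rint_norm_le => //; first exact: rint_meas rE.
move=> z; have := phi_key (eigval_ge0 n) (s0 z); have a0 : 0 <= a n z by exact: sqn_ge0.
have -> : E z = (phi (lam n) - phi (s z) - b * (lam n - s z)) * a n z by rewrite /E; ring.
have -> : B z = (eps * (lam n + s z + lam n ^+ 2 + s z ^+ 2) + D * (lam n - s z) ^+ 2) * a n z.
  by rewrite /B; ring.
by rewrite normrM (ger0_norm a0) => H1; apply: ler_wpM2r.
Qed.

Lemma partial_Rint_cvg (f : R * R -> R) : rint pm f ->
  \sum_(n < N) \int[pm]_z (f z * a n z) @[N --> \oo] --> \int[pm]_z f z.
Proof.
move=> fi.
have E N : \sum_(n < N) \int[pm]_z (f z * a n z) = \int[pm]_z (f z * A N z).
  have [r1 <-] := rint_sum N (fun n => rint_a n fi).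
  by apply: eq_Rintegral => z _; rewrite mulr_sumr.
rewrite (funext E) (_ : \int[pm]_z f z = \int[pm]_z (f z * (fun _ => 1) z)); last first.
  by apply: eq_Rintegral => z _; rewrite mulr1.
apply: (@weighted_cvg _ _ _ pm f A (fun _ => 1) 1) => //.
- exact: measurable_partial_onb.
- exact: partial_onb_le.
- exact: partial_onb_cvg.
Qed.

(** The estimates are summed over n < N before passing to the limit. The variances add up to int s^2
    A_N - h sum_n l_n^2, with A_N the sum of the a_n, and the Berezin transform enters through
    [sum_eigval2_cvg]. *)
Theorem toeplitz_estimate (tau : R) : h * (\sum_(n < N) phi (lam n)) @[N --> \oo] --> tau ->
  `|tau - \int[pm]_z phi (s z)| <=
  eps * (2 * (\int[pm]_z s z) + \int[pm]_z (s z * berezin z) + \int[pm]_z (s z ^+ 2)) +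
  D * (\int[pm]_z (s z ^+ 2) - \int[pm]_z (s z * berezin z)).
Proof.
move=> ct.
have c1 := sum_eigval_cvg; have c2 := sum_eigval2_cvg.
have c3 := partial_Rint_cvg is2; have c4 := partial_Rint_cvg rint_phi.
set J := \int[pm]_z (s z * berezin z) in c2 *.
pose Y N := eps * (2 * (h * (\sum_(n < N) lam n)) + h * (\sum_(n < N) lam n ^+ 2) +
     \sum_(n < N) \int[pm]_z (s z ^+ 2 * a n z)) +
  D * (\sum_(n < N) \int[pm]_z (s z ^+ 2 * a n z) - h * (\sum_(n < N) lam n ^+ 2)).
pose X N := `|h * (\sum_(n < N) phi (lam n)) - \sum_(n < N) \int[pm]_z (phi (s z) * a n z)|.
have cX : X @ \oo --> `|tau - \int[pm]_z phi (s z)| by apply: cvg_norm; exact: cvgB.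
have cY : Y @ \oo --> eps * (2 * (\int[pm]_z s z) + J + \int[pm]_z (s z ^+ 2)) +
    D * (\int[pm]_z (s z ^+ 2) - J).
  apply: cvgD; apply: cvgM; [exact: cvg_cst| |exact: cvg_cst|exact: cvgB].
  by apply: cvgD => //; apply: cvgD => //; apply: cvgM => //; exact: cvg_cst.
apply: (ler_cvg_to cX cY); apply: nearW => N.
rewrite /X /Y !mulr_sumr -!sumrB -!big_split /= !mulr_sumr -big_split /=.
apply: le_trans (ler_norm_sum _ _ _) _; apply: ler_sum => i _.
exact: eigval_estimate.
Qed.

End Eigen.


End Toeplitz.

(** * The Berezin transform as an approximate identity *)

Lemma measurable_comp2 {R : realType} d (T : measurableType d) (f : R * R -> R) (u v : T -> R) :
  measurable_fun setT f -> measurable_fun setT u -> measurable_fun setT v ->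
  measurable_fun setT (fun z => f (u z, v z)).
Proof. by move=> mf mu mv; apply: (measurableT_comp mf); exact: measurable_fun_pair. Qed.

Section PlaneIntegrals.
Context {R : realType}.
Notation mu := (@lebesgue_measure R).
Notation pm := (@plane_measure R).

Local Notation T0 := (g_sigma_algebraType (R.-ocitv.-measurable)).

Lemma plane_sigma_finite : sigma_finite setT (mu \x mu)%E.
Proof.
have mI n : measurable (`[- n%:R, n%:R]%classic : set T0) by exact: measurable_itv.
exists (fun n => `[- n%:R, n%:R]%classic `*` `[- n%:R, n%:R]%classic).
  apply/esym/seteqP; split => // -[x y] _.
  exists (Num.bound (Num.max `|x| `|y|)) => //.
  have : Num.max `|x| `|y| < (Num.bound (Num.max `|x| `|y|))%:R by apply: archi_boundP; rewrite le_max normr_ge0.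
  by rewrite gt_max => /andP[/ltW hx /ltW hy]; split; rewrite /= in_itv/= -ler_norml.
move=> n; split; first exact: measurableX.
rewrite product_measure1E//= lebesgue_measure_itv/=.
by case: ifP => _; rewrite -?EFinB ?mule0 ?ltry// -EFinM ltry.
Qed.

(* Only products of finite measures are canonically sigma-finite. *)
Definition plane_sf : {sigma_finite_measure set (T0 * T0)%type -> \bar R} :=
  HB.pack_for {sigma_finite_measure set (T0 * T0)%type -> \bar R} (mu \x mu)%E
   (Measure_isSigmaFinite.Build _ _ _ (mu \x mu)%E plane_sigma_finite).

Lemma plane_swap (f : (R * R) * (R * R) -> R) : measurable_fun setT f -> (forall z, 0 <= f z) ->
  (\int[pm]_z \int[pm]_w (f (z, w))%:E = \int[pm]_w \int[pm]_z (f (z, w))%:E)%E.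
Proof.
move=> mf f0.
have mf' : measurable_fun setT (EFin \o f) by exact/measurable_EFinP.
have f0' : forall z, (0 <= (EFin \o f) z)%E by move=> z; rewrite lee_fin.
have := @fubini_tonelli _ _ _ _ R plane_sf plane_sf _ mf' f0'.
by [].
Qed.

Lemma measurable_plane_int (f : (R * R) * (R * R) -> R) : measurable_fun setT f ->
  (forall z, 0 <= f z) -> measurable_fun setT (fun z => (\int[pm]_w (f (z, w))%:E)%E).
Proof.
move=> mf f0.
have mf' : measurable_fun setT (EFin \o f) by exact/measurable_EFinP.
have f0' : forall z, (0 <= (EFin \o f) z)%E by move=> z; rewrite lee_fin.
have := @measurable_int1 _ _ _ _ R plane_sf _ mf' f0'.
by [].
Qed.

Lemma int_affine1 (f : R -> R) (b c : R) : 0 < c -> measurable_fun setT f -> (forall t, 0 <= f t) ->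
  (\int[mu]_t (f ((t - b) / c))%:E = c%:E * \int[mu]_t (f t)%:E)%E.
Proof.
move=> c0 mf f0; rewrite (@int_shift R (fun t => f (t / c)))//; last meas.
rewrite (@ge0_integral_scale R c (EFin \o f))//; exact/measurable_EFinP.
Qed.

Lemma int_plane_affine (f : R * R -> R) (b : R * R) (c : R) : 0 < c ->
  measurable_fun setT f -> (forall z, 0 <= f z) ->
  (\int[pm]_z (f ((z.1 - b.1) / c, (z.2 - b.2) / c))%:E = (c ^+ 2)%:E * \int[pm]_z (f z)%:E)%E.
Proof.
move=> c0 mf f0; have mfa : measurable_fun setT (fun z : R * R => f ((z.1 - b.1) / c, (z.2 - b.2) / c)).
  by apply: (measurable_comp2 mf); meas.
rewrite (int_plane mfa)// (int_plane mf)//=.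
have E x : (\int[mu]_y (f ((x - b.1) / c, (y - b.2) / c))%:E =
    c%:E * \int[mu]_y (f ((x - b.1) / c, y))%:E)%E.
  by apply: (@int_affine1 (fun y => f ((x - b.1) / c, y))) => //; exact: measurable_section1.
under eq_integral do rewrite E.
have mG : measurable_fun setT (fun x => (\int[mu]_y (f (x, y))%:E)%E).
  have mf' : measurable_fun setT (EFin \o f) by exact/measurable_EFinP.
  have f0' : forall z, (0 <= (EFin \o f) z)%E by move=> z; rewrite lee_fin.
  exact: (@measurable_int1 _ _ _ _ R mu _ mf' f0').
have G0 x : (0 <= \int[mu]_y (f (x, y))%:E)%E by apply: int_ge0.
rewrite ge0_integralZl//=; last 2 first.
- apply: (measurableT_comp mG); meas.
- by rewrite lee_fin ltW.
rewrite (@ge0_integral_shift R b.1 (fun x => (\int[mu]_y (f (x / c, y))%:E)%E))//; last first.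
  by apply: (measurableT_comp mG); meas.
rewrite (@ge0_integral_scale R c (fun x => (\int[mu]_y (f (x, y))%:E)%E))//.
by rewrite muleA -EFinM expr2.
Qed.

Lemma int_plane_shift (f : R * R -> R) (r : R * R) :
  measurable_fun setT f -> (forall z, 0 <= f z) ->
  (\int[pm]_z (f (z.1 + r.1, z.2 + r.2)%R)%:E = \int[pm]_z (f z)%:E)%E.
Proof.
move=> mf f0; have := @int_plane_affine f (- r.1, - r.2) 1 ltr01 mf f0.
rewrite expr1n mul1e /= => <-; apply: eq_integral => z _.
by rewrite !opprK !divr1.
Qed.

Lemma measurable_plane_shift (f : R * R -> R) (r : R * R) : measurable_fun setT f ->
  measurable_fun setT (fun z : R * R => f (z.1 + r.1, z.2 + r.2)).
Proof. by move=> mf; apply: (measurable_comp2 mf); meas. Qed.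

End PlaneIntegrals.

Section PlaneModulus.
Context {R : realType}.
Notation mu := (@lebesgue_measure R).
Notation pm := (@plane_measure R).
Implicit Types f : R * R -> R.

Lemma int2_plane f : measurable_fun setT f ->
  (int2 pm f = \int[mu]_x int2 mu (fun y => f (x, y)))%E.
Proof.
move=> mf; rewrite /int2 (int_plane (f := fun z => f z ^+ 2))//; first exact: measurable_funX.
by move=> z; exact: sqr_ge0.
Qed.

Lemma int2_plane_swap f : measurable_fun setT f ->
  int2 pm (fun z => f (z.2, z.1)) = int2 pm f.
Proof.
move=> mf; have mf' : measurable_fun setT (fun z : R * R => f (z.2, z.1)).
  by apply: (measurable_comp2 mf); meas.
rewrite (int2_plane mf') (int2_plane mf) /int2 /=.
have mf2 : measurable_fun setT (fun z => f z ^+ 2) by exact: measurable_funX.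
exact: (esym (int_swap mf2 (fun z => sqr_ge0 (f z)))).
Qed.

Lemma int2_plane_shift f (r : R * R) : measurable_fun setT f ->
  int2 pm (fun z => f (z.1 + r.1, z.2 + r.2)) = int2 pm f.
Proof.
move=> mf; apply: (@int_plane_shift R (fun z => f z ^+ 2)); first exact: measurable_funX.
by move=> z; exact: sqr_ge0.
Qed.

(** Translation in one coordinate reduces to [translation_L2] on almost every line x = const, with 4
    int f(x, t)^2 dt as dominating function of x. *)
Lemma modulus2_cvg f (y : nat -> R) : measurable_fun setT f -> (int2 pm f < +oo)%E ->
  y n @[n --> \oo] --> (0 : R) ->
  int2 pm (fun z => f z - f (z.1, z.2 + y n)) @[n --> \oo] --> 0%E.
Proof.
move=> mf f2 y0.
have ms n : measurable_fun setT (fun z : R * R => f (z.1, z.2 + y n)).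
  by apply: (measurable_comp2 mf); meas.
have md n : measurable_fun setT (fun z : R * R => f z - f (z.1, z.2 + y n)) by exact: measurable_funB.
pose G n x := int2 mu (fun t => f (x, t) - f (x, t + y n)).
have -> : (fun n => int2 pm (fun z => f z - f (z.1, z.2 + y n))) = (fun n => \int[mu]_x G n x)%E.
  by apply/funext => n; rewrite int2_plane.
have m1 x : measurable_fun setT (fun t => f (x, t)) by exact: measurable_section1.
have mG n : measurable_fun setT (G n).
  have mf' : measurable_fun setT (fun z : R * R => ((f z - f (z.1, z.2 + y n)) ^+ 2)%:E).
    by apply/measurable_EFinP; exact: measurable_funX.
  have f0' : forall z : R * R, (0 <= ((f z - f (z.1, z.2 + y n)) ^+ 2)%:E)%E.
    by move=> z; rewrite lee_fin sqr_ge0.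
  exact: (@measurable_int1 _ _ _ _ R mu _ mf' f0').
pose g x := int2 mu (fun t => f (x, t)).
have mg : measurable_fun setT g.
  have mf' : measurable_fun setT (fun z : R * R => ((f z) ^+ 2)%:E).
    by apply/measurable_EFinP; exact: measurable_funX.
  have f0' : forall z : R * R, (0 <= ((f z) ^+ 2)%:E)%E.
    by move=> z; rewrite lee_fin sqr_ge0.
  exact: (@measurable_int1 _ _ _ _ R mu _ mf' f0').
have g0 x : (0 <= g x)%E by exact: int2_ge0.
have ig : (\int[mu]_x g x < +oo)%E by rewrite -int2_plane.
have Gle n x : (G n x <= 4%:E * g x)%E.
  have mx := m1 x.
  have mN : measurable_fun setT (fun t : R => - f (x, t + y n)).
    by apply: measurable_funN; apply: (measurable_compT mx); meas.
  apply: (le_trans (int2D_le mu mx mN)).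
  rewrite int2_opp.
  have -> : int2 mu (fun t => f (x, t + y n)) = g x.
    rewrite /g -(@int2_shift R (fun t => f (x, t)) (- y n) mx) /int2.
    by apply: eq_integral => t _; rewrite opprK.
  by rewrite -/(g x) -ge0_muleDl// -EFinD -natrD.
have cG x : (g x < +oo)%E -> G n x @[n --> \oo] --> 0%E.
  move=> gx.
  have Gfin n : G n x \is a fin_num.
    rewrite ge0_fin_numE ?int2_ge0//; apply: le_lt_trans (Gle n x) _.
    by rewrite lte_mul_pinfty.
  apply/fine_cvgP; split; first exact: nearW.
  apply/cvgrPdist_le => eps e0.
  have [dl d0 hd] := translation_L2 (m1 x) gx e0.
  move/cvgrPdist_le: y0 => /(_ _ d0) [N _ hN].
  exists N => // n /hN /=; rewrite sub0r normrN => yn.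
  rewrite sub0r normrN ger0_norm ?fine_ge0 ?int2_ge0// -lee_fin fineK//.
  have := hd (- y n); rewrite normrN => /(_ yn).
  by rewrite /G; under eq_fun do rewrite opprK.
have ifg : mu.-integrable setT (fun x => 4%:E * g x)%E.
  apply: integrableZl => //; apply/integrableP; split => //.
  by under eq_integral do rewrite gee0_abs//.
have [] := @dominated_convergence _ _ R mu setT measurableT G (fun _ => 0%E) (fun x => 4%:E * g x)%E.
- exact: mG.
- exact: measurable_cst.
- have [N [mN N0 sN]] : {ae mu, forall x, (g x < +oo)%E}.
    by apply: ae_finite_int; [exact: mg|exact: g0|exact: ig].
  by exists N; split => // x /= hx; apply: sN => /= gx; apply: hx => _; exact: cG.
- exact: ifg.
- by apply: aeW => x n _; rewrite gee0_abs ?int2_ge0.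
by move=> _ _; rewrite integral0.
Qed.

End PlaneModulus.

Section BerezinLimit.
Context {R : realType}.
Notation mu := (@lebesgue_measure R).
Notation pm := (@plane_measure R).
Local Notation C := R[i].
Variables (s : R * R -> R).
Hypothesis s0 : forall z, 0 <= s z.
Hypothesis is_ : rint pm s.
Hypothesis is2 : rint pm (fun z => s z ^+ 2).

Let ms : measurable_fun setT s := rint_meas is_.
Let I2 := \int[pm]_z (s z ^+ 2).
Let ts (r : R * R) (z : R * R) := s (z.1 + r.1, z.2 + r.2).
Let mts r : measurable_fun setT (ts r) := measurable_plane_shift r ms.
Let Om r := int2 pm (fun z => s z - ts r z).

Let I2E : int2 pm s = I2%:E. Proof. by rewrite /I2 EFin_Rintegral. Qed.

Let tsE r : int2 pm (ts r) = I2%:E. Proof. by rewrite -I2E; exact: int2_plane_shift. Qed.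

Lemma Om_le r : (Om r <= (4 * I2)%:E)%E.
Proof.
have mN : measurable_fun setT (fun z => - ts r z) by exact: measurable_funN.
apply: (le_trans (int2D_le pm ms mN)); rewrite int2_opp tsE I2E -!EFinM -EFinD lee_fin; lra.
Qed.

Definition modulus r : R := fine (Om r).

Lemma modulusE r : Om r = (modulus r)%:E.
Proof.
rewrite fineK// ge0_fin_numE ?int2_ge0//; apply: le_lt_trans (Om_le r) _.
by rewrite ltry.
Qed.

Lemma modulus_ge0 r : 0 <= modulus r <= 4 * I2.
Proof. by rewrite -!lee_fin -modulusE int2_ge0 Om_le. Qed.

(** The translation is performed one coordinate at a time. Exchanging the variables reduces the
    first coordinate to the second, and translation invariance of the integral removes the first
    shift from the second step. *)
Lemma modulus_cvg (r : nat -> R * R) : (r n).1 @[n --> \oo] --> (0 : R) ->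
  (r n).2 @[n --> \oo] --> (0 : R) -> modulus (r n) @[n --> \oo] --> (0 : R).
Proof.
move=> r1 r2.
have s2 : (int2 pm s < +oo)%E by rewrite I2E ltry.
pose s' z := s (z.2, z.1).
have ms' : measurable_fun setT s' by apply: (measurable_comp2 ms); meas.
have s2' : (int2 pm s' < +oo)%E by rewrite int2_plane_swap.
have c1 := modulus2_cvg ms' s2' r1; have c2 := modulus2_cvg ms s2 r2.
have le n : (Om (r n) <= 2%:E * int2 pm (fun z => (s' z - s' (z.1, z.2 + (r n).1))%R) +
     2%:E * int2 pm (fun z => (s z - s (z.1, z.2 + (r n).2))%R))%E.
  set x := (r n).1; set y := (r n).2.
  have mx : measurable_fun setT (fun z : R * R => s (z.1 + x, z.2)).
    by apply: (measurable_comp2 ms); meas.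
  have my : measurable_fun setT (fun z : R * R => s (z.1, z.2 + y)).
    by apply: (measurable_comp2 ms); meas.
  have mxy : measurable_fun setT (fun z : R * R => s (z.1 + x, z.2 + y)).
    by apply: (measurable_comp2 ms); meas.
  have m1 : measurable_fun setT (fun z : R * R => s z - s (z.1 + x, z.2)) by exact: measurable_funB.
  have m2 : measurable_fun setT (fun z : R * R => s (z.1 + x, z.2) - s (z.1 + x, z.2 + y)).
    exact: measurable_funB.
  have m3 : measurable_fun setT (fun z : R * R => s z - s (z.1, z.2 + y)) by exact: measurable_funB.
  have E1 : int2 pm (fun z => s' z - s' (z.1, z.2 + x)) = int2 pm (fun z => s z - s (z.1 + x, z.2)).
    by rewrite -(int2_plane_swap m1) /=; congr int2; apply/funext => -[].
  have E2 : int2 pm (fun z => s (z.1 + x, z.2) - s (z.1 + x, z.2 + y)) =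
      int2 pm (fun z => s z - s (z.1, z.2 + y)).
    by rewrite -(int2_plane_shift (x, 0) m3) /=; congr int2; apply/funext => z; rewrite addr0.
  have E3 : Om (r n) = int2 pm (fun z => (s z - s (z.1 + x, z.2)) + (s (z.1 + x, z.2) - s (z.1 + x, z.2 + y))).
    by rewrite /Om /ts; congr int2; apply/funext => z; rewrite addrA subrK.
  by rewrite E3 E1 -E2; exact: int2D_le.
have c3 : (2%:E * int2 pm (fun z => (s' z - s' (z.1, z.2 + (r n).1))%R) +
     2%:E * int2 pm (fun z => (s z - s (z.1, z.2 + (r n).2))%R))%E @[n --> \oo] --> 0%E.
  rewrite -[X in _ --> X](_ : (2%:E * 0 + 2%:E * 0 = 0)%E); last by rewrite mule0 adde0.
  by apply: cvgeD; [rewrite mule0|apply: cvgeZl|apply: cvgeZl].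
have : Om (r n) @[n --> \oo] --> 0%E.
  apply: (@squeeze_cvge _ _ _ _ (fun _ => 0%E) _ _ _ _ _ c3); [|exact: cvg_cst].
  by apply: nearW => n; rewrite int2_ge0 le.
by move=> /fine_cvgP[].
Qed.

Variables (h : R) (g : R -> C).
Hypothesis h0 : 0 < h.
Hypothesis hg : vecs L2 g.
Hypothesis g1 : nsq L2 g = 1.
Let q := Num.sqrt h.
Let sc (z : R * R) : R * R := (q * z.1, q * z.2).

(** By [sqn_rkernel], the substitution z -> w + sqrt(h) z has Jacobian h, which cancels the factor
    1/h: the transform averages translates of s against the probability density [ambig g]. *)
Lemma berezin_conv w : (berezin h g s w)%:E =
  (\int[pm]_z (ambig g z * ts w (sc z))%:E)%E.
Proof.
have q0 : 0 < q by rewrite sqrtr_gt0.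
have q2 : q ^+ 2 = h by rewrite sqr_sqrtr// ltW.
have iw := rint_weight h0 hg g1 is_ s0 (rkernel_vecs h0 hg w).
rewrite /berezin EFinM (EFin_Rintegral iw).
pose f z := ambig g z * ts w (sc z).
have mf : measurable_fun setT f.
  have msc : measurable_fun setT (fun z : R * R => s (q * z.1 + w.1, q * z.2 + w.2)).
    by apply: (measurable_comp2 ms); meas.
  by apply: measurable_funM; [exact: measurable_ambig|exact: msc].
have f0 z : 0 <= f z by apply: mulr_ge0; [exact: ambig_ge0|exact: s0].
have := int_plane_affine w q0 mf f0; rewrite q2 => e.
rewrite (_ : (\int[pm]_z (s z * sqn (rkernel h g w z))%:E)%E = (h%:E * \int[pm]_z (f z)%:E)%E).
  by rewrite muleA -EFinM mulVf ?gt_eqF// mul1e.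
rewrite -e; apply: eq_integral => z _; rewrite (sqn_rkernel h0 hg) /f mulrC; congr ((_ * _)%:E).
rewrite /ts /sc /=; congr s; case: z => z1 z2 /=.
by rewrite !(mulrC q) !divfK ?gt_eqF// !subrK.
Qed.

Let c z := I2 - modulus (sc z) / 2.

(** Polarization, as s and its translate have the same L^2 norm. *)
Lemma correlation r : (\int[pm]_w (s w * ts r w)%:E)%E = (I2 - modulus r / 2)%:E.
Proof.
have i1 : rint pm (fun w => s w * ts r w).
  have s2 : (int2 pm s < +oo)%E by rewrite I2E ltry.
  have t2 : (int2 pm (ts r) < +oo)%E by rewrite tsE ltry.
  by apply: (@rint_mul_L2 _ _ _ pm s (ts r)); [exact: ms|exact: mts|exact: s2|exact: t2].
have mt2 : measurable_fun setT (fun w : R * R => ts r w ^+ 2).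
  by apply: measurable_funX; exact: mts.
have it : rint pm (fun w => ts r w ^+ 2).
  apply: (@rintP _ _ _ pm); first exact: mt2.
  by under eq_integral do rewrite ger0_norm ?sqr_ge0//; rewrite -[X in (X < _)%E]/(int2 pm (ts r)) tsE ltry.
have EI : \int[pm]_w (ts r w ^+ 2) = I2 by rewrite /Rintegral -[X in fine X]/(int2 pm (ts r)) tsE.
rewrite -EFin_Rintegral//; congr (_%:E).
have Em : modulus r = \int[pm]_w ((s w ^+ 2 + ts r w ^+ 2) - 2 * (s w * ts r w)).
  by rewrite /modulus /Om /int2 -[LHS]/(\int[pm]_w ((s w - ts r w) ^+ 2));
    apply: eq_Rintegral => w _; ring.
rewrite Em (RintB (rintD is2 it) (rintZ 2 i1)) (RintD is2 it) (RintZ 2 i1) EI -/I2.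
by field.
Qed.

Lemma measurable_modulus_scaled : measurable_fun setT (fun z => modulus (sc z)).
Proof.
apply: (measurableT_comp (@fine_measurable _ setT measurableT)) => //.
pose F (p : (R * R) * (R * R)) := (s p.2 - s (p.2.1 + q * p.1.1, p.2.2 + q * p.1.2)) ^+ 2.
have m11 : measurable_fun setT (fun p : (R * R) * (R * R) => p.1.1).
  exact: (measurableT_comp measurable_fst measurable_fst).
have m12 : measurable_fun setT (fun p : (R * R) * (R * R) => p.1.2).
  exact: (measurableT_comp measurable_snd measurable_fst).
have m21 : measurable_fun setT (fun p : (R * R) * (R * R) => p.2.1).
  exact: (measurableT_comp measurable_fst measurable_snd).
have m22 : measurable_fun setT (fun p : (R * R) * (R * R) => p.2.2).
  exact: (measurableT_comp measurable_snd measurable_snd).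
have mF : measurable_fun setT F.
  apply: measurable_funX; apply: measurable_funB.
    exact: (measurableT_comp ms measurable_snd).
  by apply: (measurable_comp2 ms); meas.
have F0 p : 0 <= F p by exact: sqr_ge0.
exact: (measurable_plane_int mF F0).
Qed.

(** Tonelli turns int s B(s) into the average, with density [ambig g], of the correlations of s with
    its translates by sqrt(h) z, and polarization writes each of these as I2 - modulus / 2. The gap
    in the trace estimate is therefore an averaged modulus of continuity. *)
Lemma berezin_gap : (\int[pm]_z (ambig g z * modulus (sc z))%:E)%E =
  (2 * (I2 - \int[pm]_z (s z * berezin h g s z)))%:E.
Proof.
have ia : rint pm (ambig g).
  apply: (@rintP _ _ _ pm); first exact: measurable_ambig.
  under eq_integral do rewrite ger0_norm ?ambig_ge0//.
  by rewrite int_ambig// ltry.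
have Ia : \int[pm]_z ambig g z = 1 by rewrite /Rintegral int_ambig.
have mm := measurable_modulus_scaled.
have im : rint pm (fun z => ambig g z * modulus (sc z)).
  apply: (@rint_le _ _ _ pm _ (fun z => (4 * I2) * ambig g z)).
  - by apply: measurable_funM => //; exact: measurable_ambig.
  - exact: rintZ.
  - move=> z; have /andP[a1 a2] := modulus_ge0 (sc z).
    rewrite ger0_norm ?mulr_ge0 ?ambig_ge0// mulrC; apply: ler_wpM2r => //; exact: ambig_ge0.
have b0 w : 0 <= berezin h g s w.
  apply: mulr_ge0; first by rewrite invr_ge0 ltW.
  by apply: Rintegral_ge0 => z _; rewrite mulr_ge0 ?sqn_ge0.
have m11 : measurable_fun setT (fun p : (R * R) * (R * R) => p.1.1).
  exact: (measurableT_comp measurable_fst measurable_fst).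
have m12 : measurable_fun setT (fun p : (R * R) * (R * R) => p.1.2).
  exact: (measurableT_comp measurable_snd measurable_fst).
have m21 : measurable_fun setT (fun p : (R * R) * (R * R) => p.2.1).
  exact: (measurableT_comp measurable_fst measurable_snd).
have m22 : measurable_fun setT (fun p : (R * R) * (R * R) => p.2.2).
  exact: (measurableT_comp measurable_snd measurable_snd).
have m3 : measurable_fun setT (fun p : (R * R) * (R * R) => s (q * p.2.1 + p.1.1, q * p.2.2 + p.1.2)).
  by apply: (measurable_comp2 ms); meas.
pose G (p : (R * R) * (R * R)) := ambig g p.2 * ts p.1 (sc p.2).
have mG : measurable_fun setT G.
  apply: measurable_funM; first exact: (measurableT_comp (measurable_ambig hg) measurable_snd).
  exact: m3.
have G0 p : 0 <= G p by apply: mulr_ge0; [exact: ambig_ge0|exact: s0].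
have mb : measurable_fun setT (berezin h g s).
  have -> : berezin h g s = fine \o (fun w => \int[pm]_z (G (w, z))%:E)%E.
    by apply/funext => w; rewrite /= -berezin_conv.
  exact: (measurableT_comp (@fine_measurable _ setT measurableT) (measurable_plane_int mG G0)).
have key : (\int[pm]_w (s w * berezin h g s w)%:E = \int[pm]_z (ambig g z * c z)%:E)%E.
  pose F (p : (R * R) * (R * R)) := s p.1 * G p.
  have F0 p : 0 <= F p by rewrite mulr_ge0.
  have tsc w z : ts w (sc z) = ts (sc z) w by rewrite /ts /= (addrC w.1) (addrC w.2).
  have mF : measurable_fun setT F.
    by apply: measurable_funM => //; exact: (measurableT_comp ms measurable_fst).
  transitivity (\int[pm]_w \int[pm]_z (F (w, z))%:E)%E.
    apply: eq_integral => w _; rewrite EFinM berezin_conv -int_Z//.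
      by have := measurable_section1 w mG.
    by move=> z; exact: (G0 (w, z)).
  rewrite (plane_swap mF F0); apply: eq_integral => z _.
  rewrite EFinM /c -correlation -int_Z//; [|exact: ambig_ge0|by apply: measurable_funM => //; exact: mts|].
    by apply: eq_integral => w _; rewrite /F /G /= tsc; congr (_%:E); ring.
  by move=> w; apply: mulr_ge0; exact: s0.
have cE : (fun z => ambig g z * c z) = (fun z => I2 * ambig g z - 2^-1 * (ambig g z * modulus (sc z))).
  by apply/funext => z; rewrite /c; field.
have ic : rint pm (fun z => ambig g z * c z).
  by rewrite cE; apply: rintB; apply: rintZ.
have isb : rint pm (fun z => s z * berezin h g s z).
  apply: (@rintP _ _ _ pm); first by apply: measurable_funM.
  have sb0 z : `|s z * berezin h g s z| = s z * berezin h g s z.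
    by rewrite ger0_norm// mulr_ge0.
  under eq_integral do rewrite sb0.
  by rewrite key -EFin_Rintegral// ltry.
rewrite -EFin_Rintegral//; congr (_%:E).
have -> : \int[pm]_z (s z * berezin h g s z) = \int[pm]_z (ambig g z * c z).
  by apply: EFin_inj; rewrite !EFin_Rintegral.
rewrite cE (RintB (rintZ I2 ia) (rintZ 2^-1 im)) (RintZ I2 ia) (RintZ 2^-1 im) Ia.
by field.
Qed.

End BerezinLimit.

Section BerezinCvg.
Context {R : realType}.
Notation pm := (@plane_measure R).
Variables (s : R * R -> R) (g : R -> R[i]).
Hypothesis s0 : forall z, 0 <= s z.
Hypothesis is_ : rint pm s.
Hypothesis is2 : rint pm (fun z => s z ^+ 2).
Hypothesis hg : vecs L2 g.
Hypothesis g1 : nsq L2 g = 1.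

Theorem berezin_cvg : (fun h => \int[pm]_z (s z * berezin h g s z)) @ (0 : R)^'+ -->
  \int[pm]_z (s z ^+ 2).
Proof.
(* Sequences h = u n are used because dominated convergence is a statement about sequences. *)
apply/cvg_at_rightP => u [u0 uc].
pose sc n (z : R * R) := (Num.sqrt (u n) * z.1, Num.sqrt (u n) * z.2).
have qc : Num.sqrt (u n) @[n --> \oo] --> (0 : R).
  rewrite -[X in _ --> X]sqrtr0.
  by apply: continuous_cvg => //; exact: sqrt_continuous.
have ia : rint pm (ambig g).
  apply: (@rintP _ _ _ pm); first exact: measurable_ambig.
  under eq_integral do rewrite ger0_norm ?ambig_ge0//.
  by rewrite int_ambig// ltry.
have scc (t : R) : Num.sqrt (u n) * t @[n --> \oo] --> (0 : R).
  by rewrite -[X in _ --> X](mul0r t); apply: cvgM => //; exact: cvg_cst.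
have c : (\int[pm]_z (ambig g z * modulus s (sc n z))%:E)%E @[n --> \oo] --> 0%E.
  apply: (@dominated_kernel_cvg0 R _ _ pm (ambig g) (fun n z => modulus s (sc n z))
    (4 * \int[pm]_z (s z ^+ 2))).
  - exact: ia.
  - exact: ambig_ge0.
  - by move=> n; exact: (measurable_modulus_scaled is_ (u n)).
  - by move=> n z; exact: modulus_ge0.
  - by move=> z; apply: (modulus_cvg is_ is2); exact: scc.
move: c; rewrite (funext (fun n => berezin_gap s0 is_ is2 (u0 n) hg g1)).
move=> /fine_cvgP[_ c].
have {}c : 2 * (\int[pm]_z (s z ^+ 2) - \int[pm]_z (s z * berezin (u n) g s z)) @[n --> \oo] --> (0 : R).
  exact: c.
have -> : (fun n => \int[pm]_z (s z * berezin (u n) g s z)) =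
    (fun n => \int[pm]_z (s z ^+ 2) -
      2^-1 * (2 * (\int[pm]_z (s z ^+ 2) - \int[pm]_z (s z * berezin (u n) g s z)))).
  by apply/funext => n; rewrite mulrA mulVf// mul1r subKr.
rewrite -[X in _ --> X]subr0 -[X in _ - X](mulr0 (2^-1 : R)).
by apply: cvgB; [exact: cvg_cst|apply: cvgM; [exact: cvg_cst|exact: c]].
Qed.

End BerezinCvg.

(** * The limit *)

Section NullSets.
Context {R : realType} d (T : measurableType d) (m : {measure set T -> \bar R}).
Import HBNNSimple.

(** The integral of a nonnegative function is a supremum over simple functions below it. Replacing
    such a simple function by 0 on N keeps its integral, and the result lies below [g]
    everywhere. *)
Lemma le_nnintegral_null (f g : T -> \bar R) (N : set T) : measurable N -> m N = 0%E ->
  (forall x, (0 <= f x)%E) -> (forall x, (0 <= g x)%E) -> (forall x, ~ N x -> f x = g x) ->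
  (\int[m]_x f x <= \int[m]_x g x)%E.
Proof.
move=> mN N0 f0 g0 fg.
rewrite (@ge0_integralTE _ _ _ _ f)// (@ge0_integralTE _ _ _ _ g)//.
apply: ge_ereal_sup => _ [h /= hf <-]; apply: le_ereal_sup_tmp.
exists (sintegral m (proj_nnsfun h (measurableC mN))).
  exists (proj_nnsfun h (measurableC mN)) => //= x.
  rewrite mindicE; have [xN|xN] := boolP (x \in ~` N).
    by rewrite mulr1 -fg; [exact: hf|move: xN; rewrite inE].
  by rewrite mulr0.
rewrite -!integralT_nnsfun le_eqVlt; apply/orP; left; apply/eqP; apply: ae_eq_integral => //.
- by apply/measurable_EFinP.
- by apply/measurable_EFinP.
exists N; split => // x /= hx; apply: contrapT => Nx; apply: hx => _.
by rewrite mindicE mem_set// mulr1.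
Qed.

Lemma nnintegral_null (f g : T -> \bar R) (N : set T) : measurable N -> m N = 0%E ->
  (forall x, (0 <= f x)%E) -> (forall x, (0 <= g x)%E) -> (forall x, ~ N x -> f x = g x) ->
  (\int[m]_x f x = \int[m]_x g x)%E.
Proof.
move=> mN N0 f0 g0 fg; apply/eqP; rewrite eq_le; apply/andP; split.
  exact: (le_nnintegral_null mN).
by apply: (le_nnintegral_null mN) => // x /fg.
Qed.

(* No measurability of [f] or [g] is assumed on [N]. *)
Lemma Rintegral_null (f g : T -> R) (N : set T) : measurable N -> m N = 0%E ->
  (forall x, ~ N x -> f x = g x) -> \int[m]_x f x = \int[m]_x g x.
Proof.
move=> mN N0 fg; rewrite /Rintegral integralE [in RHS]integralE; congr (fine (_ - _)%E).
  by apply: (nnintegral_null mN) => // x Nx; rewrite !funeposE fg.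
by apply: (nnintegral_null mN) => // x Nx; rewrite !funenegE fg.
Qed.

Lemma ae_null (P : T -> Prop) (N : set T) : measurable N -> {ae m, forall x, P x} ->
  (forall x, P x -> ~ N x) -> m N = 0%E.
Proof.
move=> mN [M [mM M0 sM]] h; apply: (subset_measure0 mN mM) => // x Nx.
by apply: sM => /= /h.
Qed.

End NullSets.

(** * The scalar inequality for t psi(t) *)

Section ScalarInequality.
Context {R : realType}.

(** By symmetry t <= x. For x <= B + 1 and x - t small, x r(x) - t r(t) = x (r(x) - r(t)) + (x - t)
    r(t): uniform continuity bounds the first term, and the second is handled by r(0) = 0 for small
    t and by Young's inequality otherwise. Where x - t is bounded below, D absorbs all bounded
    quantities; where an argument is large, sublinearity gives eps times its square. *)
Lemma sublinear_ineq (r : R -> R) (eps : R) : continuous r -> r 0 = 0 -> 0 < eps ->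
  (exists B : R, forall t, B <= t -> `|r t| <= eps * t) ->
  exists2 D : R, 0 <= D & forall x t, 0 <= x -> 0 <= t ->
    `|x * r x - t * r t| <= 2 * eps * (x + t + x ^+ 2 + t ^+ 2) + D * (x - t) ^+ 2.
Proof.
move=> cr r0 e0 [B0 hB0].
pose B := Num.max B0 1.
have B1 : 1 <= B by rewrite le_max lexx orbT.
have hB t : B <= t -> `|r t| <= eps * t.
  by move=> h; apply: hB0; apply: le_trans h; rewrite le_max lexx.
have [M M0 hM] : exists2 M : R, 0 <= M & forall t, 0 <= t <= B + 1 -> `|r t| <= M.
  have [c _ hc] : exists2 c, c \in `[0, B + 1]%R & forall t, t \in `[0, B + 1]%R -> `|r t| <= `|r c|.
    apply: (@EVT_max R (fun x => `|r x|)) => //; first by lra.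
    by apply: continuous_subspaceT => x; apply: cvg_norm; exact: cr.
  by exists `|r c| => // t ht; apply: hc; rewrite in_itv.
have [dl d0 hd] := uniform_continuity (B + 1) cr e0.
(* D1 is the constant in Young's inequality y M <= eps dl + D1 y^2; D2 serves x <= B + 1 with x - t
   > dl, and D3 serves x > B + 1 with t < B, where x - t > 1. *)
pose D1 := M ^+ 2 / (4 * (eps * dl)).
pose D2 := 2 * M * (B + 1) / dl ^+ 2.
pose D3 := B * M.
have D10 : 0 <= D1 by rewrite divr_ge0 ?sqr_ge0// mulr_ge0// mulr_ge0// ltW.
have D20 : 0 <= D2 by rewrite divr_ge0 ?sqr_ge0// mulr_ge0 ?mulr_ge0//; lra.
have D30 : 0 <= D3 by rewrite mulr_ge0//; lra.
exists (D1 + D2 + D3); first by rewrite !addr_ge0.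
suff H x t : 0 <= t -> t <= x ->
    `|x * r x - t * r t| <= 2 * eps * (x + t + x ^+ 2 + t ^+ 2) + (D1 + D2 + D3) * (x - t) ^+ 2.
  move=> x t x0 t0; have [tx|xt] := leP t x; first exact: H.
  have := H t x x0 (ltW xt); rewrite distrC.
  by rewrite (_ : (t - x) ^+ 2 = (x - t) ^+ 2) ?(addrC t x); [lra|ring].
move=> t0 tx; have x0 : 0 <= x by exact: le_trans tx.
have v0 : 0 <= (x - t) ^+ 2 by exact: sqr_ge0.
have x2 : 0 <= x ^+ 2 by exact: sqr_ge0.
have t2 : 0 <= t ^+ 2 by exact: sqr_ge0.
have ex : 0 <= eps * x by rewrite mulr_ge0// ltW.
have et : 0 <= eps * t by rewrite mulr_ge0// ltW.
have ex2 : 0 <= eps * x ^+ 2 by rewrite mulr_ge0// ltW.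
have et2 : 0 <= eps * t ^+ 2 by rewrite mulr_ge0// ltW.
have w1 : 0 <= D1 * (x - t) ^+ 2 by exact: mulr_ge0.
have w2 : 0 <= D2 * (x - t) ^+ 2 by exact: mulr_ge0.
have w3 : 0 <= D3 * (x - t) ^+ 2 by exact: mulr_ge0.
rewrite !mulrDl !mulrDr.
have [xB|Bx] := leP x (B + 1).
  have hx : 0 <= x <= B + 1 by rewrite x0.
  have ht : 0 <= t <= B + 1 by rewrite t0 (le_trans tx).
  have [xt|xt] := leP (x - t) dl.
    have h1 : `|x * (r x - r t)| <= x * eps.
      by rewrite normrM (ger0_norm x0); apply: ler_wpM2l => //; apply: hd => //; rewrite ger0_norm// subr_ge0.
    have h2 : `|(x - t) * r t| <= eps * (x + t) + D1 * (x - t) ^+ 2.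
      rewrite normrM ger0_norm ?subr_ge0//.
      have [td|td] := leP t dl.
        have h3 : `|r t| <= eps.
          rewrite -[r t]subr0 -r0; apply: hd => //; last by rewrite subr0 ger0_norm.
          by apply/andP; split; lra.
        have := ler_wpM2l (_ : 0 <= x - t) h3; rewrite subr_ge0 tx => /(_ isT).
        by rewrite mulrDr; nra.
      have h3 := hM _ ht.
      have h4 : (x - t) * `|r t| <= (x - t) * M by apply: ler_wpM2l => //; rewrite subr_ge0.
      apply: (le_trans h4).
      have ed : 0 < eps * dl by rewrite mulr_gt0.
      have h5 : (x - t) * M <= eps * dl + D1 * (x - t) ^+ 2.
        rewrite /D1; set y := x - t; set e := eps * dl in ed *.
        have -> : e + M ^+ 2 / (4 * e) * y ^+ 2 = y * M + (2 * e - M * y) ^+ 2 / (4 * e).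
          by field; rewrite gt_eqF.
        by rewrite lerDl divr_ge0 ?sqr_ge0//; lra.
      apply: (le_trans h5); rewrite lerD2r mulrDr.
      by have := ler_wpM2l (ltW e0) (ltW td); lra.
    have -> : x * r x - t * r t = x * (r x - r t) + (x - t) * r t by ring.
    apply: (le_trans (ler_normD _ _)); move: h2; rewrite mulrDr; lra.
  have h1 : `|x * r x| <= (B + 1) * M by rewrite normrM (ger0_norm x0) ler_pM// hM.
  have h2 : `|t * r t| <= (B + 1) * M.
    by rewrite normrM (ger0_norm t0) ler_pM// ?hM//; case/andP: ht.
  have h3 : 2 * M * (B + 1) <= D2 * (x - t) ^+ 2.
    have q1 : 1 <= (x - t) ^+ 2 / dl ^+ 2.
      by rewrite ler_pdivlMr ?exprn_gt0// mul1r ler_pXn2r// ?nnegrE; lra.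
    have -> : D2 * (x - t) ^+ 2 = 2 * M * (B + 1) * ((x - t) ^+ 2 / dl ^+ 2) by rewrite /D2; ring.
    by rewrite -[leLHS]mulr1; apply: ler_wpM2l => //; rewrite mulr_ge0 ?mulr_ge0//; lra.
  apply: (le_trans (ler_normB _ _)); lra.
have h1 : `|x * r x| <= eps * x ^+ 2.
  rewrite normrM (ger0_norm x0) expr2 mulrCA; apply: ler_wpM2l => //; apply: hB; lra.
have [Bt|tB] := leP B t.
  have h2 : `|t * r t| <= eps * t ^+ 2.
    by rewrite normrM (ger0_norm t0) expr2 mulrCA; apply: ler_wpM2l => //; apply: hB.
  apply: (le_trans (ler_normB _ _)); lra.
have h2 : `|t * r t| <= D3 * (x - t) ^+ 2.
  apply: (@le_trans _ _ D3).
    rewrite normrM (ger0_norm t0) /D3; apply: ler_pM => //; first exact: ltW.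
    by apply: hM; apply/andP; split; lra.
  by rewrite -[leLHS]mulr1; apply: ler_wpM2l => //; rewrite expr_ge1//; lra.
apply: (le_trans (ler_normB _ _)); lra.
Qed.

End ScalarInequality.

Section Symbol.
Context {R : realType}.
Variables (psi0 : R -> R) (c : R).
Hypothesis cpsi : continuous psi0.
Hypothesis lpsi : psi0 t / t @[t --> +oo] --> c.

(** In psi0(t) = psi0(0) + c t + r(t) the function r vanishes at 0 and r(t) / t tends to 0 at
    infinity, so [sublinear_ineq] applies to it; the quadratic part c (x + t) (x - t) is split by
    Young's inequality into (eps/4) (x + t)^2 and (c^2/eps) (x - t)^2. *)
Lemma symbol_ineq (eps : R) : 0 < eps -> exists2 D : R, 0 <= D & forall x t, 0 <= x -> 0 <= t ->
  `|x * psi0 x - t * psi0 t - psi0 0 * (x - t)| <=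
    eps * (x + t + x ^+ 2 + t ^+ 2) + D * (x - t) ^+ 2.
Proof.
move=> e0; pose r t := psi0 t - c * t - psi0 0.
have e4 : 0 < eps / 4 by rewrite divr_gt0.
have e8 : 0 < eps / 8 by rewrite divr_gt0.
have cr : continuous r.
  move=> t; apply: cvgB; last exact: cvg_cst.
  by apply: cvgB; [exact: cpsi|apply: cvgM; [exact: cvg_cst|exact: cvg_id]].
have [D' D'0 hD'] : exists2 D : R, 0 <= D & forall x t, 0 <= x -> 0 <= t ->
    `|x * r x - t * r t| <= 2 * (eps / 4) * (x + t + x ^+ 2 + t ^+ 2) + D * (x - t) ^+ 2.
  apply: sublinear_ineq => //; first by rewrite /r mulr0 subr0 subrr.
  move/cvgrPdist_le: lpsi => /(_ _ e8) [M [_ hM]].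
  (* Beyond the first threshold |psi0(t) - c t| <= eps t / 8, beyond the second |psi0(0)| <= eps t /
     8; together they give eps t / 4. *)
  exists (Num.max (Num.max M 0 + 1) (8 * `|psi0 0| / eps)) => t; rewrite ge_max => /andP[t1 t2].
  have t0 : 0 < t by apply: lt_le_trans t1; rewrite ltr_pwDr// le_max lexx orbT.
  have Mt : M < t by apply: lt_le_trans t1; rewrite (@le_lt_trans _ _ (Num.max M 0))// ?ltrDl// le_max lexx.
  have h1 := hM _ Mt.
  have h2 : `|psi0 t - c * t| <= eps / 8 * t.
    rewrite distrC; have -> : c * t - psi0 t = (c - psi0 t / t) * t by field; rewrite gt_eqF.
    by rewrite normrM (gtr0_norm t0); apply: ler_wpM2r => //; exact: ltW.
  have h3 : `|psi0 0| <= eps / 8 * t.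
    by move: t2; rewrite ler_pdivrMr//; lra.
  by apply: (le_trans (ler_normB _ _)); lra.
exists (D' + c ^+ 2 / eps); first by rewrite addr_ge0// divr_ge0 ?sqr_ge0// ltW.
move=> x t x0 t0.
have -> : x * psi0 x - t * psi0 t - psi0 0 * (x - t) = c * ((x + t) * (x - t)) + (x * r x - t * r t).
  by rewrite /r; ring.
apply: (le_trans (ler_normD _ _)).
have h1 := hD' _ _ x0 t0.
have h2 : `|c * ((x + t) * (x - t))| <= eps / 4 * (x + t) ^+ 2 + c ^+ 2 / eps * (x - t) ^+ 2.
  set u := x + t; set v := x - t.
  have p : 0 <= (eps * u - 2 * (c * v)) ^+ 2 / (4 * eps) by rewrite divr_ge0 ?sqr_ge0//; lra.
  have q : 0 <= (eps * u + 2 * (c * v)) ^+ 2 / (4 * eps) by rewrite divr_ge0 ?sqr_ge0//; lra.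
  rewrite ler_norml; apply/andP; split.
    rewrite -subr_ge0 opprK; move: q; congr (_ <= _); field; by rewrite gt_eqF.
  rewrite -subr_ge0; move: p; congr (_ <= _); field; by rewrite gt_eqF.
have h3 : (x + t) ^+ 2 <= 2 * (x ^+ 2 + t ^+ 2) by have := sqr_ge0 (x - t); nra.
have h4 : eps / 4 * (x + t) ^+ 2 <= eps / 4 * (2 * (x ^+ 2 + t ^+ 2)).
  by apply: ler_wpM2l => //; exact: ltW.
have h5 : 0 <= eps / 2 * (x + t) by rewrite mulr_ge0 ?addr_ge0//; lra.
by rewrite [X in _ <= _ + X]mulrDl; lra.
Qed.

(** This is [symbol_ineq] with one argument equal to 0; it makes phi(s) integrable when s and s^2
    are. *)
Lemma symbol_growth : exists K : R, forall t, 0 <= t -> `|t * psi0 t| <= K * (t + t ^+ 2).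
Proof.
have [D D0 hD] := symbol_ineq ltr01; exists (`|psi0 0| + 1 + D) => t t0.
have := hD _ _ t0 (lexx 0); rewrite mul0r !subr0 expr0n /= !addr0 => h.
have t2 : 0 <= t ^+ 2 by exact: sqr_ge0.
have h1 : `|psi0 0 * t| = `|psi0 0| * t by rewrite normrM (ger0_norm t0).
have h2 := ler_normD (t * psi0 t - psi0 0 * t) (psi0 0 * t); rewrite subrK h1 in h2.
have h3 : 0 <= `|psi0 0| * t ^+ 2 by exact: mulr_ge0.
have h4 : 0 <= D * t by exact: mulr_ge0.
by rewrite !mulrDr !mulrDl; lra.
Qed.

End Symbol.


Section Main.
Context {R : realType}.
Notation pm := (@plane_measure R).
Variables (g : R -> R[i]) (sigma : R * R -> R) (psi : R -> R) (c : R).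
Hypothesis g_L2 : vecs L2 g.
Hypothesis g_unit : hnorm L2 g = 1.
Hypothesis sigma_L1 : sigma \in Lfun pm 1%:E.
Hypothesis sigma_L2 : sigma \in Lfun pm 2%:E.
Hypothesis sigma_ge0 : {ae pm, forall z, 0 <= sigma z}.
Hypothesis psi_cont : {within [set t : R | 0 <= t], continuous psi}.
Hypothesis psi_lim : psi t / t @[t --> +oo] --> c.

(** The values of [psi] on the negative axis are arbitrary; its extension from the half-line by the
    constant psi(0) is continuous on R. Likewise the positive part [s] is a representative of
    [sigma] that is nonnegative at every point. *)
Let psi0 t := psi (Num.max t 0).
Let s z := Num.max (sigma z) 0.
Let phi t := t * psi0 t.

Let g1 : nsq L2 g = 1.
Proof.
have h : Num.sqrt (nsq L2 g) = 1 by exact: g_unit.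
by rewrite -[LHS]sqr_sqrtr ?L2_nsq_ge0// h expr1n.
Qed.

Lemma extension_continuous : continuous psi0.
Proof.
move=> t; apply/cvgrPdist_lt => e e0.
have A : [set t : R | 0 <= t] (Num.max t 0) by rewrite /= le_max lexx orbT.
have /cvgrPdist_lt/(_ _ e0) := (subspace_continuousP _ _).1 psi_cont _ A.
move=> /nbhs_ballP[d /= d0 hd]; apply/nbhs_ballP; exists d => // y /= ty.
apply: hd; last by rewrite /= le_max lexx orbT.
move: ty; rewrite /ball /=; apply: le_lt_trans.
by case: (leP t 0) => h1; case: (leP y 0) => h2; rewrite ?subrr ?normr0 ?normr_ge0// ler_norml;
  case: (lerP 0 (t - y)) => h3; rewrite ?(ger0_norm h3) ?(ltr0_norm h3); apply/andP; split; lra.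
Qed.

Lemma extensionE t : 0 <= t -> psi0 t = psi t.
Proof. by move=> t0; rewrite /psi0; congr psi; apply/max_idPl. Qed.

Lemma extension_lim : psi0 t / t @[t --> +oo] --> c.
Proof.
move: psi_lim; apply: cvg_trans; apply: near_eq_cvg; exists 0; split => // t t0.
by rewrite extensionE// ltW.
Qed.

Let msigma : measurable_fun setT sigma.
Proof. by have /Lfun1_integrable/rint_meas := sigma_L1. Qed.

Let is_ : rint pm s.
Proof.
have /Lfun1_integrable h := sigma_L1; apply: (@rint_le _ _ _ pm _ (fun z => `|sigma z|)).
- by apply: measurable_maxr.
- exact: rint_norm.
- by move=> z; rewrite /s; case: (leP (sigma z) 0) => h0; rewrite ?normr0.
Qed.

Let is2 : rint pm (fun z => s z ^+ 2).
Proof.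
have h := Lfun2_integrable_sqr sigma_L2; apply: (@rint_le _ _ _ pm _ (fun z => sigma z ^+ 2)).
- by apply: measurable_funX; apply: measurable_maxr.
- exact: h.
- by move=> z; rewrite /s; case: (leP (sigma z) 0) => h0; rewrite ?expr0n ?normr0 ?sqr_ge0// ger0_norm ?sqr_ge0.
Qed.

Let s0 z : 0 <= s z. Proof. by rewrite /s le_max lexx orbT. Qed.

Let sig_ae : {ae pm, forall z, sigma z = s z}.
Proof. by apply: aeS sigma_ge0 => z h; apply/esym/max_idPl. Qed.

(** On the null set where sigma < 0 nothing is known about psi(sigma), not even measurability; hence
    the recourse to [Rintegral_null]. *)
Lemma symbol_integral : \int[pm]_z (sigma z * psi (sigma z)) = \int[pm]_z phi (s z).
Proof.
pose N := [set z | sigma z < 0].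
have mN : measurable N.
  rewrite -[N]setTI; exact: (measurable_fun_ltr msigma (measurable_cst _)).
apply: (@Rintegral_null _ _ _ pm _ _ N mN).
  by apply: (@ae_null _ _ _ pm _ N mN sigma_ge0) => z h; rewrite /N /= ltNge h.
move=> z /negP; rewrite -leNgt => h.
have -> : s z = sigma z by apply/max_idPl.
by rewrite /phi extensionE.
Qed.

(** The constants [eps] and [D] are subject to a condition that does not involve h, so one choice of
    them serves for all h in the limit. *)
Lemma trace_estimate h : 0 < h ->
  let T := toeplitz h g sigma in
  let A := T \o fcalc (rkhs h g) psi T in
  trace_class (rkhs h g) A /\ exists2 tau : R, trace (rkhs h g) A = tau%:C &
    forall eps D : R, (forall x t, 0 <= x -> 0 <= t ->
      `|phi x - phi t - psi0 0 * (x - t)| <= eps * (x + t + x ^+ 2 + t ^+ 2) + D * (x - t) ^+ 2) ->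
    `|h * tau - \int[pm]_z phi (s z)| <=
    eps * (2 * (\int[pm]_z s z) + \int[pm]_z (s z * berezin h g s z) + \int[pm]_z (s z ^+ 2)) +
    D * (\int[pm]_z (s z ^+ 2) - \int[pm]_z (s z * berezin h g s z)).
Proof.
move=> h0 T A.
have TP := toeplitzP h0 g_L2 g1 msigma sig_ae is_ s0.
have [e he hd] := toeplitz_diag h0 g_L2 g1 is_ s0 TP.
have [h1 [tau h2 h3]] := toeplitz_trace h0 g_L2 g1 is_ s0 he hd extension_continuous extensionE.
split => //; exists tau => // eps D key.
have [K hK] := symbol_growth extension_continuous extension_lim.
have mphi : measurable_fun setT phi.
  by apply: measurable_funM => //; apply: continuous_measurable_fun; exact: extension_continuous.
have phi0 : phi 0 = 0 by rewrite /phi mul0r.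
exact: (toeplitz_estimate h0 g_L2 g1 is_ s0 TP he hd is2 mphi phi0 hK key h3).
Qed.

Lemma trace_limit : 
  ((h%:C * trace (rkhs h g) (toeplitz h g sigma \o fcalc (rkhs h g) psi (toeplitz h g sigma)) : R[i]^o)
    @[h --> (0 : R)^'+] --> ((\int[pm]_z (sigma z * psi (sigma z)))%:C : R[i]^o)).
Proof.
rewrite symbol_integral.
pose A h := toeplitz h g sigma \o fcalc (rkhs h g) psi (toeplitz h g sigma).
pose tr h := complex.Re (trace (rkhs h g) (A h)).
suff H : (fun h => h * tr h) @ (0 : R)^'+ --> \int[pm]_z phi (s z).
  have HC : ((fun h => (h * tr h)%:C) : R -> R[i]^o) @ (0 : R)^'+ --> ((\int[pm]_z phi (s z))%:C : R[i]^o).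
    by apply: cvg_real_complex.
  move: HC; apply: cvg_trans; apply: near_eq_cvg.
  near=> h; have h0 : 0 < h by [].
  have [_ [tau e _]] := trace_estimate h0.
  by rewrite /tr /A e /= rmorphM.
apply/cvgrPdist_le => eps e0.
pose I1 := \int[pm]_z s z; pose I2 := \int[pm]_z (s z ^+ 2).
pose J h := \int[pm]_z (s z * berezin h g s z).
have I10 : 0 <= I1 by apply: Rintegral_ge0.
have I20 : 0 <= I2 by apply: Rintegral_ge0 => z _; exact: sqr_ge0.
(* Once |I2 - J h| <= 1, the bracket 2 I1 + J h + I2 is at most B, so the first term of the estimate
   is at most eps/2; the added 1 also makes B positive. *)
pose B := 2 * I1 + 2 * I2 + 1.
have B0 : 0 < B by rewrite /B; lra.
have eB : 0 < eps / (2 * B) by rewrite divr_gt0// mulr_gt0.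
have [D D0 key] := symbol_ineq extension_continuous extension_lim eB.
(* With D fixed, D (I2 - J h) <= eps/2 as soon as the gap is at most eps / (2 (D + 1)). *)
have d0 : 0 < Num.min 1 (eps / (2 * (D + 1))).
  by rewrite lt_min ltr01 divr_gt0// mulr_gt0//; lra.
have cJ : \forall h \near (0 : R)^'+, `|I2 - J h| <= Num.min 1 (eps / (2 * (D + 1))).
  by have /cvgrPdist_le := berezin_cvg s0 is_ is2 g_L2 g1; exact.
near=> h; have h0 : 0 < h by [].
have [_ [tau e est]] := trace_estimate h0.
rewrite /tr /A e /= distrC; apply: (le_trans (est _ _ key)); rewrite -/I1 -/I2 -/(J h).
have : `|I2 - J h| <= Num.min 1 (eps / (2 * (D + 1))) by near: h.
rewrite le_min ler_norml => /andP[/andP[j1 j2] j3].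
have h1 : eps / (2 * B) * (2 * I1 + J h + I2) <= eps / 2.
  apply: (@le_trans _ _ (eps / (2 * B) * B)); first by apply: ler_wpM2l; [exact: ltW|rewrite /B; lra].
  by rewrite (_ : eps / (2 * B) * B = eps / 2)//; field; rewrite gt_eqF.
have h2 : D * (I2 - J h) <= eps / 2.
  apply: (@le_trans _ _ ((D + 1) * (eps / (2 * (D + 1))))).
    apply: (@le_trans _ _ ((D + 1) * `|I2 - J h|)); last by apply: ler_wpM2l => //; lra.
    apply: (@le_trans _ _ (D * `|I2 - J h|)); first by apply: ler_wpM2l => //; exact: ler_norm.
    by apply: ler_wpM2r => //; lra.
  by rewrite (_ : (D + 1) * (eps / (2 * (D + 1))) = eps / 2)//; field; rewrite gt_eqF//; lra.
by lra.
Unshelve. all: by end_near. Qed.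

End Main.

Theorem theorem6p1 (R : realType) (g : R -> R[i])
    (g_L2 : vecs L2 g) (g_unit : hnorm L2 g = 1)
    (sigma : R * R -> R)
    (sigma_L1 : sigma \in Lfun plane_measure 1%:E)
    (sigma_L2 : sigma \in Lfun plane_measure 2%:E)
    (sigma_ge0 : {ae plane_measure, forall z, 0 <= sigma z})
    (psi : R -> R)
    (psi_cont : {within [set t : R | 0 <= t], continuous psi})
    (psi_lim : exists c : R, psi t / t @[t --> +oo] --> c) :
  let T h := toeplitz h g sigma in
  let A h := T h \o fcalc (rkhs h g) psi (T h) in
  (forall h : R, 0 < h -> trace_class (rkhs h g) (A h)) /\
  ((h%:C * trace (rkhs h g) (A h) : R[i]^o) @[h --> (0 : R)^'+] -->
     ((\int[plane_measure]_z (sigma z * psi (sigma z)))%:C : R[i]^o)).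
Proof.
move=> T A; have [c lc] := psi_lim; split.
  by move=> h h0; have [] := trace_estimate g_L2 g_unit sigma_L1 sigma_L2 sigma_ge0 psi_cont lc h0.
exact: (trace_limit g_L2 g_unit sigma_L1 sigma_L2 sigma_ge0 psi_cont lc).
Qed.
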